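(* Consider the game Ramsey, Paper, Scissors on $n$ vertices with target $s$. If $s \leq \frac{1}{1000}\sqrt{n}\log n$, then Proposer has a (randomized) strategy that wins with high probability, no matter how Decider plays. If $s \geq 1000\sqrt{n}\log n$, then Decider has a (randomized) strategy that wins with high probability, no matter how Proposer plays.
   Context: Ramsey, Paper, Scissors is the following two-player game on a fixed set $V$ of $n$ vertices. Start with the empty graph $G_0$ on $V$ and an empty set $F$ of forbidden pairs. A pair $\{x,y\}$ of vertices that is not an edge of the current graph is called closed if there is a vertex $z$ with $\{x,z\}$ and $\{y,z\}$ both edges of the current graph, and open otherwise. On each turn, simultaneously, Proposer chooses an open pair not in $F$, and Decider (without knowing which pair Proposer chose) answers YES or NO. If the answer is YES, the chosen pair is added as an edge to the graph; in either case the pair is added to $F$. Thus the graph always stays triangle-free and no pair is proposed twice. Each player may base their move on everything revealed so far. The game ends when every open pair lies in $F$ (Proposer has no legal move). Proposer wins if the final graph has an independent set of size at least $s$; otherwise Decider wins. ''With high probability'' means with probability tending to $1$ as $n \to \infty$. Logarithms are base $2$. *)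

(* Defs.v *)
From mathcomp Require Import all_boot all_order all_algebra.
From mathcomp Require Import reals exp.

Set Implicit Arguments.
Unset Strict Implicit.
Unset Printing Implicit Defensive.

Import GRing.Theory Num.Theory.

Local Open Scope nat_scope.

(** The vertex set is ['I_n].  A pair of vertices is a set [e : {set 'I_n}]
    with [#|e| == 2], and a graph is the set [E] of its edges. *)

Section Game.

Variable n : nat.

(** The turns played so far, oldest first: the proposed pair and the answer
    ([true] is YES).  This is exactly what has been revealed to both players. *)
Definition history := seq ({set 'I_n} * bool).

Implicit Types (h : history) (e S : {set 'I_n}) (E : {set {set 'I_n}}).

Definition graph h : {set {set 'I_n}} := [set e | (e, true) \in h].

Definition forbidden h : {set {set 'I_n}} := [set e in [seq t.1 | t <- h]].

Definition closed_pair E e : bool :=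
  [&& #|e| == 2, e \notin E &
   [exists x, exists y, exists z,
     [&& e == [set x; y], [set x; z] \in E & [set y; z] \in E]]].

Definition open_pair E e : bool :=
  [&& #|e| == 2, e \notin E & ~~ closed_pair E e].

Definition legal h e : bool := open_pair (graph h) e && (e \notin forbidden h).

Definition game_over h : bool := [forall e, ~~ legal h e].

Record proposer := Proposer {
  propose :> history -> {set 'I_n};
  propose_legal : forall h, ~~ game_over h -> legal h (propose h) }.

(** Since [h] does not contain the current turn, Decider answers without
    knowing the pair being proposed. *)
Definition decider := history -> bool.

Definition turn (p : proposer) (d : decider) h : history :=
  if game_over h then h else rcons h (p h, d h).

(** Each turn forbids a new pair, so ['C(n, 2)] turns suffice to end the game:
    see [game_over_play]. *)
Definition play (p : proposer) (d : decider) : history :=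
  iter 'C(n, 2) (turn p d) [::].

Definition independent E S : bool :=
  [forall x in S, forall y in S, [set x; y] \notin E].

Definition proposer_wins (s : nat) (p : proposer) (d : decider) : bool :=
  [exists S, independent (graph (play p d)) S && (s <= #|S|)].

Definition decider_wins (s : nat) (p : proposer) (d : decider) : bool :=
  ~~ proposer_wins s p d.

Lemma game_over_play (p : proposer) (d : decider) : game_over (play p d).
Proof.
pose pairs := [set e : {set 'I_n} | #|e| == 2].
have card_pairs : #|pairs| = 'C(n, 2) by rewrite card_draws card_ord.
have inv k : let h := iter k (turn p d) [::] in
    game_over h \/ #|forbidden h| = k /\ forbidden h \subset pairs.
  elim: k => [|k /= IH].
    right; rewrite /= (_ : forbidden [::] = set0) ?cards0 ?sub0set //.
  set h := iter k _ _ in IH *; rewrite /turn.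
  case: ifP => [->|/negbT Nover]; first by left.
  case: IH => [over|[card_h sub_h]]; first by rewrite over in Nover.
  have /andP[/and3P[e2 _ _] Fe] := propose_legal p Nover.
  have -> : forbidden (rcons h (p h, d h)) = p h |: forbidden h.
    by apply/setP=> e; rewrite !inE map_rcons mem_rcons inE.
  by right; rewrite cardsU1 Fe card_h subUset sub_h andbT sub1set inE.
rewrite /play; case: (inv 'C(n, 2)) => //; set h := iter _ _ _ => -[card_h sub_h].
have eqF : forbidden h = pairs.
  by apply/eqP; rewrite eqEcard sub_h card_pairs card_h leqnn.
apply/forallP=> e; apply/negP=> /andP[/and3P[e2 _ _]].
by rewrite eqF inE e2.
Qed.

End Game.

Local Open Scope ring_scope.

(** A randomized strategy draws a deterministic strategy at random, according
    to a finite probability distribution.  Finite supports lose no generality: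
    for each [n] only finitely many histories can occur in play. *)
Record randomized (R : numDomainType) (X : Type) := Randomized {
  seed : finType;
  weight : seed -> R;
  draw : seed -> X;
  weight_ge0 : forall i, 0 <= weight i;
  weight_sum1 : \sum_i weight i = 1 }.

(** The probability of [A x y] for independent draws [x] from [P] and [y] from
    [Q]. *)
Definition prob (R : numDomainType) (X Y : Type)
    (P : randomized R X) (Q : randomized R Y) (A : X -> Y -> bool) : R :=
  \sum_(i : seed P) \sum_(j : seed Q)
    weight i * weight j * (A (draw i) (draw j))%:R.

Definition log2 (R : realType) (x : R) : R := ln x / ln 2.

(* Main.v *)
Require Import Defs.
From mathcomp Require Import all_boot all_order all_algebra.
From mathcomp Require Import reals sequences exp.
From mathcomp Require Import zify ring lra.

Set Implicit Arguments.
Unset Strict Implicit.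
Unset Printing Implicit Defensive.

Import Order.TTheory GRing.Theory Num.Theory.

Local Open Scope ring_scope.

(** In both halves the probability of losing is bounded by the initial value of
a nonnegative supermartingale that is at least 1 whenever the game is lost.

Decider answers YES independently with probability 1 - exp(-lam), where
lam = 1 / (10 sqrt n).  If an s-set S is independent at the end, then each of its
pairs was refused or has a common neighbour z, hence the number of pairs of S
that were never proposed is at most the sum of C(d(z), 2) over the numbers d(z)
of neighbours of z in S.  Hence exp(-lam) to that number, the probability that
those pairs would all have been refused, times the product over z of
exp(lam C(d(z), 2)) is at least 1.  Majorizing the factors of the product by
exponentials of d(z) makes the conditional expectations explicit; they are
summed over all S.

Proposer reserves equal targets A_0, ..., A_{K+1} and, for each phase i, centers.
In phase i he hides tokens, pairs inside A_i, among 2Q times as many trials,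
which join the current center to random vertices of A_{i+1} until k_i answers
are YES.  Decider cannot tell tokens from trials, so both have about the same
share of YES.  If A_i runs out of legal pairs before the centers are used up,
few tokens were accepted: A_i spans few edges, and being triangle-free has a
large independent set (Alon).  Otherwise most centers found k_i random
neighbours, since A_i has too few pairs for tokens to accompany that many
fruitless trials; these neighbourhoods close many pairs of A_{i+1}.  So A_{i+1}
starts with half as many legal pairs as A_i had, k_{i+1} = 2 k_i becomes
affordable, and in the last phase one successful center has at least s
neighbours, which are independent. *)

(** * Random play *)

(** Against an adaptive opponent no events are independent. What replaces independence is that the
    opponent's move in a turn is a function of the history alone, hence the same for all outcomes of
    the current draw, so the average over one turn can be computed exactly. Decider's obstacle is
    that the exponent C(d, 2) is quadratic in the degree. Exponentials of d majorize it only up to a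
    degree cap near 2 sqrt n, and a separate summand of the potential handles larger degrees. For
    Proposer, [Q] is a power of two of order log n and [u] is about sqrt n / (64 Q). The number c_i
    of centers halves while k_i doubles, so c_i k_i is the same in all phases and one bound on
    accepted tokens serves them all; the bound on the legal pairs of A_i halves as c_i does, so
    exhausting most centers always takes well over 2Q trials per available token. Going from k_0 =
    100 u to k_K = 100 u Q^2 needs only K = 2 log Q doublings. This small K lets all targets fit
    into n vertices and keeps the sum of the failure probabilities at O(1/Q). *)

Section RandomPlay.

Variables (R : realFieldType) (U : finType) (u0 : U) (w : U -> R).
Hypothesis w_ge0 : forall u, 0 <= w u.
Hypothesis w_sum1 : \sum_u w u = 1.

(** The draws of all turns are fixed in advance as a vector, built recursively so that the first
    draw splits off in the induction of [supermartingale]. *)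
Fixpoint seeds (k : nat) : finType :=
  if k is k'.+1 then (U * seeds k')%type : finType else unit : finType.

Fixpoint seed_weight (k : nat) : seeds k -> R :=
  if k is k'.+1 then fun s => w s.1 * seed_weight s.2 else fun=> 1.

Fixpoint seed_get (k : nat) : seeds k -> nat -> U :=
  if k is k'.+1 then
    fun s t => if t is t'.+1 then seed_get s.2 t' else s.1
  else fun _ _ => u0.

Lemma seed_weight_ge0 k (s : seeds k) : 0 <= seed_weight s.
Proof. by elim: k s => [|k IH] s //=; rewrite mulr_ge0. Qed.

Lemma seed_weight_sum1 k : \sum_(s : seeds k) seed_weight s = 1.
Proof.
elim: k => [|k IH] /=; first by rewrite big_const card_unit /= addr0.
rewrite -(pair_bigA _ (fun u s => w u * seed_weight s)) /=.
by under eq_bigr do rewrite -mulr_sumr IH mulr1.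
Qed.

Section Supermartingale.

Variable n : nat.
Implicit Types h : history n.
Variables (next : history n -> U -> history n).
Hypothesis size_next : forall h u, size (next h u) = (size h).+1.

(** The size of the history serves as a clock; [t] is the time at which the first entry of [s] is
    read. *)
Definition rturn k (s : seeds k) (t : nat) h : history n :=
  if game_over h then h else next h (seed_get s (size h - t)).

Lemma rturn_iter_over k (s : seeds k) t m h :
  game_over h -> iter m (rturn s t) h = h.
Proof. by move=> oh; elim: m => //= m ->; rewrite /rturn oh. Qed.

(** Past time [t] the head of the vector is never read again, so dropping it only shifts the
    offset. *)
Lemma rturn_iterS k u (s : seeds k) t m h : (t < size h)%N ->
  iter m (@rturn k.+1 (u, s) t) h = iter m (rturn s t.+1) h.
Proof.
move=> th; suff: iter m (@rturn k.+1 (u, s) t) h = iter m (rturn s t.+1) h /\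
   (t < size (iter m (rturn s t.+1) h))%N by case.
elim: m => // m [/= -> lt]; set g := iter _ _ _ in lt *.
have e : (size g - t = (size g - t.+1).+1)%N by lia.
split; rewrite /rturn; first by rewrite e.
by case: ifP => // _; rewrite size_next; lia.
Qed.

Variables (Inv : history n -> Prop) (Phi : nat -> history n -> R).
Hypothesis Inv_next : forall h u, Inv h -> ~~ game_over h -> Inv (next h u).
Hypothesis Phi_over : forall k h, Inv h -> game_over h -> Phi k h <= Phi k.+1 h.
Hypothesis Phi_next : forall k h, Inv h -> ~~ game_over h ->
  \sum_u w u * Phi k (next h u) <= Phi k.+1 h.

(** Here [k] counts the turns left. A game that ends early stands still while [k] decreases, whence
    the monotonicity in [k] required by [Phi_over]. *)
Lemma supermartingale k t h : Inv h -> size h = t ->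
  \sum_(s : seeds k) seed_weight s * Phi 0 (iter k (rturn s t) h) <= Phi k h.
Proof.
elim: k t h => [|k IH] t h Ih szh.
  by rewrite /= big_const card_unit /= mul1r addr0.
have [oh|noh] := boolP (game_over h).
  under eq_bigr do rewrite rturn_iter_over //.
  rewrite -mulr_suml seed_weight_sum1 mul1r.
  by elim: k.+1 => // m IHm; apply: le_trans IHm (Phi_over _ Ih oh).
apply: le_trans (Phi_next k Ih noh).
rewrite -(pair_bigA _ (fun u (s : seeds k) => w u * seed_weight s *
   Phi 0 (iter k.+1 (@rturn k.+1 (u, s) t) h))) /=.
apply: ler_sum => u _.
under eq_bigr => s _.
  rewrite -iterS iterSr {2}/rturn (negbTE noh) szh subnn /= -mulrA.
  rewrite rturn_iterS ?size_next ?szh //.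
  over.
rewrite -mulr_sumr; apply: ler_wpM2l => //.
by apply: IH; [exact: Inv_next|rewrite size_next szh].
Qed.

Lemma Inv_rturn k (s : seeds k) t m h : Inv h -> Inv (iter m (rturn s t) h).
Proof.
move=> Ih; elim: m => //= m IHm; rewrite {1}/rturn.
by case: ifP => // /negbT; exact: Inv_next.
Qed.

End Supermartingale.

Definition seeded X k (f : seeds k -> X) : randomized R X :=
  @Randomized R X (seeds k) (@seed_weight k) f (@seed_weight_ge0 k)
    (seed_weight_sum1 k).

End RandomPlay.

(** The two draws are independent, so a bound valid against each deterministic opponent survives
    averaging over opponents. *)
Lemma prob_ge_left (R : numDomainType) X Y (P : randomized R X)
    (Q : randomized R Y) (A : X -> Y -> bool) (c : R) :
  (forall y, c <= \sum_(i : seed P) weight i * (A (draw i) y)%:R) ->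
  c <= @prob R X Y P Q A.
Proof.
move=> H; rewrite /prob exchange_big /=.
have -> : c = \sum_(j : seed Q) weight j * c by rewrite -mulr_suml weight_sum1 mul1r.
apply: ler_sum => j _.
apply: le_trans (ler_wpM2l (weight_ge0 j) (H (draw j))) _.
rewrite mulr_sumr le_eqVlt; apply/orP; left; apply/eqP.
by apply: eq_bigr => i _; rewrite mulrA (mulrC (weight j)).
Qed.

Lemma prob_ge_right (R : numDomainType) X Y (P : randomized R X)
    (Q : randomized R Y) (A : X -> Y -> bool) (c : R) :
  (forall x, c <= \sum_(j : seed Q) weight j * (A x (draw j))%:R) ->
  c <= @prob R X Y P Q A.
Proof.
move=> H; rewrite /prob.
have -> : c = \sum_(i : seed P) weight i * c by rewrite -mulr_suml weight_sum1 mul1r.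
apply: ler_sum => i _.
apply: le_trans (ler_wpM2l (weight_ge0 i) (H (draw i))) _.
by rewrite mulr_sumr; under eq_bigr do rewrite mulrA.
Qed.

Lemma average_ge_compl (R : numDomainType) (I : finType) (v : I -> R)
    (A : pred I) (B : I -> R) (c : R) :
  (forall i, 0 <= v i) -> \sum_i v i = 1 -> (forall i, 0 <= B i) ->
  (forall i, ~~ A i -> 1 <= B i) -> \sum_i v i * B i <= c ->
  1 - c <= \sum_i v i * (A i)%:R.
Proof.
move=> v0 v1 B0 AB Bc; rewrite lerBlDr; apply: le_trans (lerD (lexx _) Bc).
rewrite -[in leLHS]v1 -big_split /=; apply: ler_sum => i _; rewrite -mulrDr.
rewrite -[leLHS]mulr1; apply: ler_wpM2l => //.
by have [/= _|/AB /= H] := boolP (A i); rewrite ?lerDl ?add0r.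
Qed.

Section Draws.

Variables (R : realFieldType) (U : finType) (u0 : U) (n : nat).
Implicit Types h : history n.

(** The fallback turns any function of history and draw into a [proposer]; it also supplies the
    arbitrary moves once a strategy has nothing left to do. *)
Definition legalize (e : {set 'I_n}) h :=
  if legal h e then e else odflt set0 [pick e | legal h e].

Lemma legalizeP e h : ~~ game_over h -> legal h (legalize e h).
Proof.
rewrite negb_forall => /existsP[e' /negPn le']; rewrite /legalize.
by case: ifP => //; case: pickP => // /(_ e'); rewrite le'.
Qed.

Variable f : history n -> U -> {set 'I_n}.

Definition seeded_proposer k (s : seeds U k) : proposer n :=
  Proposer (fun h => @legalizeP (f h (seed_get u0 s (size h))) h).

Lemma play_seeded_proposer (s : seeds U 'C(n, 2)) d :
  play (seeded_proposer s) d = iter 'C(n, 2)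
   (rturn u0 (fun h u => rcons h (legalize (f h u) h, d h)) s 0) [::].
Proof.
by apply: eq_iter => h; rewrite /turn /rturn; case: ifP; rewrite ?subn0.
Qed.

Variable g : history n -> U -> bool.

Definition seeded_decider k (s : seeds U k) : decider n :=
  fun h => g h (seed_get u0 s (size h)).

Lemma play_seeded_decider (s : seeds U 'C(n, 2)) p :
  play p (seeded_decider s) = iter 'C(n, 2)
   (rturn u0 (fun h u => rcons h (p h, g h u)) s 0) [::].
Proof.
by apply: eq_iter => h; rewrite /turn /rturn; case: ifP; rewrite ?subn0.
Qed.

End Draws.

Section StrategyBounds.

Variables (R : realFieldType) (U : finType) (u0 : U) (w : U -> R) (n s : nat).
Hypothesis w_ge0 : forall u, 0 <= w u.
Hypothesis w_sum1 : \sum_u w u = 1.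
Implicit Types h : history n.
Variables (Inv : history n -> Prop) (Phi : nat -> history n -> R).
Hypothesis Inv0 : Inv [::].
Hypothesis Phi_ge0 : forall h, Inv h -> 0 <= Phi 0 h.
Hypothesis Phi_over : forall k h, Inv h -> game_over h -> Phi k h <= Phi k.+1 h.

Lemma seeded_proposer_wins f d :
  (forall h u, Inv h -> ~~ game_over h ->
     Inv (rcons h (legalize (f h u) h, d h))) ->
  (forall k h, Inv h -> ~~ game_over h ->
     \sum_u w u * Phi k (rcons h (legalize (f h u) h, d h)) <= Phi k.+1 h) ->
  (forall h, Inv h -> game_over h ->
     (forall S, independent (graph h) S -> (#|S| < s)%N) -> 1 <= Phi 0 h) ->
  1 - Phi 'C(n, 2) [::] <= \sum_(x : seeds U 'C(n, 2))
     seed_weight w x * (proposer_wins s (seeded_proposer u0 f x) d)%:R.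
Proof.
move=> Inv_next Phi_next lossP; set N := 'C(n, 2).
pose hist (x : seeds U N) := play (seeded_proposer u0 f x) d.
have Ih x : Inv (hist x).
  by rewrite /hist play_seeded_proposer; apply: Inv_rturn.
apply: (@average_ge_compl R _ _ _ (fun x => Phi 0 (hist x))).
- by move=> x; exact: seed_weight_ge0.
- exact: seed_weight_sum1.
- by move=> x; exact: Phi_ge0.
- move=> x nwin; apply: lossP => //; first exact: game_over_play.
  move=> S indS; rewrite ltnNge; apply: contra nwin => sS.
  by apply/existsP; exists S; rewrite indS.
- rewrite (eq_bigr (fun x => seed_weight w x * Phi 0 (iter N
   (rturn u0 (fun h u => rcons h (legalize (f h u) h, d h)) x 0) [::]))).
    by apply: supermartingale Inv0 (erefl _) => // h u; rewrite size_rcons.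
  by move=> x _; rewrite /hist play_seeded_proposer.
Qed.

Lemma seeded_decider_wins g p :
  (forall h u, Inv h -> ~~ game_over h -> Inv (rcons h (propose p h, g h u))) ->
  (forall k h, Inv h -> ~~ game_over h ->
     \sum_u w u * Phi k (rcons h (propose p h, g h u)) <= Phi k.+1 h) ->
  (forall h S, Inv h -> game_over h -> independent (graph h) S -> (s <= #|S|)%N ->
     1 <= Phi 0 h) ->
  1 - Phi 'C(n, 2) [::] <= \sum_(x : seeds U 'C(n, 2))
     seed_weight w x * (decider_wins s p (seeded_decider u0 g x))%:R.
Proof.
move=> Inv_next Phi_next lossP; set N := 'C(n, 2).
pose hist (x : seeds U N) := play p (seeded_decider u0 g x).
have Ih x : Inv (hist x).
  by rewrite /hist play_seeded_decider; apply: Inv_rturn.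
apply: (@average_ge_compl R _ _ _ (fun x => Phi 0 (hist x))).
- by move=> x; exact: seed_weight_ge0.
- exact: seed_weight_sum1.
- by move=> x; exact: Phi_ge0.
- move=> x /negPn/existsP[S /andP[indS sS]].
  by apply: (lossP _ S) => //; exact: game_over_play.
- rewrite (eq_bigr (fun x => seed_weight w x * Phi 0 (iter N
   (rturn u0 (fun h u => rcons h (propose p h, g h u)) x 0) [::]))).
    by apply: supermartingale Inv0 (erefl _) => // h u; rewrite size_rcons.
  by move=> x _; rewrite /hist play_seeded_decider.
Qed.

End StrategyBounds.

(** * Independent sets in sparse triangle-free graphs *)

Section TriangleFree.

Local Open Scope nat_scope.

Lemma sum_card_powerset (T : finType) (X : {set T}) :
  2 * \sum_(Y in powerset X) #|Y| = #|X| * 2 ^ #|X|.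
Proof.
have e : \sum_(Y in powerset X) #|Y| = \sum_(Y in powerset X) #|X :\: Y|.
  rewrite (reindex_onto (fun Y => X :\: Y) (fun Y => X :\: Y)) /=.
    apply: eq_bigl => Y; rewrite !powersetE subsetDl /=; apply/eqP/idP => [<-|YX].
      exact: subsetDl.
    by rewrite setDDr setDv set0U; apply/setIidPr.
  by move=> Y; rewrite powersetE => YX; rewrite setDDr setDv set0U; apply/setIidPr.
rewrite mul2n -addnn {2}e -big_split /= -card_powerset mulnC -sum_nat_const.
apply: eq_bigr => Y; rewrite powersetE => YX.
by rewrite -[in RHS](cardsID Y X) (setIidPr YX).
Qed.

(** With [x] available neighbours, a fibre in [sum_occupancy] has 2^x + 1 stable sets, of total
    occupancy at least c + x 2^(x-1). For x <= 2t the term [c] alone gives average [t]; beyond that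
    the term x 2^(x-1) does. *)
Lemma alon_numeric c t x : t * (2 ^ (2 * t) + 1) <= c ->
  t * (2 ^ x + 1) * 2 <= 2 * c + x * 2 ^ x.
Proof.
move=> tc; have [xt|tx] := leqP x (2 * t).
  have : 2 ^ x <= 2 ^ (2 * t) by rewrite leq_exp2l.
  nia.
have h1 : t < 2 ^ t by apply: ltn_expl.
have h2 : 2 ^ t * 2 <= 2 ^ x by rewrite -expnSr leq_exp2l //; lia.
nia.
Qed.

Variables (T : finType) (e : rel T) (A : {set T}).
Hypothesis e_sym : symmetric e.
Hypothesis e_irr : irreflexive e.
Hypothesis e_tri : forall x y z, x \in A -> y \in A -> z \in A ->
  e x y -> e x z -> e y z -> False.

Definition stable (W : {set T}) :=
  (W \subset A) && [forall x in W, forall y in W, ~~ e x y].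

Lemma stableP (W : {set T}) : reflect
  (W \subset A /\ forall x y, x \in W -> y \in W -> ~~ e x y) (stable W).
Proof.
apply: (iffP andP) => -[WA H]; split=> //.
  by move=> x y xW yW; move/forall_inP/(_ x xW)/forall_inP: H; apply.
by apply/forall_inP=> x xW; apply/forall_inP=> y; apply: H.
Qed.

Definition stables := [set W : {set T} | stable W].

Definition nbh v := [set w in A | e v w].

Variables (c t : nat).
Hypothesis tc : t * (2 ^ (2 * t) + 1) <= c.

(** Summed over [v], this is at most (D + c) times the cardinal of [W] when degrees are at most [D];
    so a large mean occupancy forces a large stable set. *)
Definition occupancy v (W : {set T}) := c * (v \in W) + #|nbh v :&: W|.

(* Conditioned on the part [S] of a random stable set outside the closed
   neighbourhood of [v], the rest is either [v] or an arbitrary set of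
   neighbours of [v] not adjacent to [S]. *)
Lemma sum_occupancy v : v \in A ->
  t * #|stables| <= \sum_(W in stables) occupancy v W.
Proof.
move=> vA; pose key (W : {set T}) := W :\: (v |: nbh v).
rewrite mulnC -sum_nat_const.
rewrite (partition_big key predT) //= [leqRHS](partition_big key predT) //=.
apply: leq_sum => S _.
pose F := [set W : {set T} | stable W & key W == S].
have FP W : (W \in stables) && (key W == S) = (W \in F) by rewrite !inE.
under eq_bigl do rewrite FP.
under [leqRHS]eq_bigl do rewrite FP.
rewrite sum_nat_const.
have [-> | [W0]] := set_0Vmem F; first by rewrite cards0.
rewrite inE => /andP[/stableP[W0A W0i] /eqP kW0].
have SW0 : S \subset W0 by rewrite -kW0 subsetDl.
have SA : S \subset A := subset_trans SW0 W0A.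
have Si x y : x \in S -> y \in S -> ~~ e x y.
  by move=> xS yS; apply: W0i; apply: (subsetP SW0).
have vS : v \notin S by rewrite -kW0 !inE eqxx.
have nS x : x \in S -> x \notin nbh v.
  by rewrite -kW0 !inE negb_or => /andP[/andP[]].
have veS x : x \in S -> ~~ e v x.
  by move=> xS; have := nS _ xS; rewrite inE (subsetP SA).
pose X := [set x in nbh v | [forall y in S, ~~ e x y]].
have Xn x : x \in X -> x \in nbh v by rewrite inE => /andP[].
have XA x : x \in X -> x \in A by move/Xn; rewrite inE => /andP[].
have vX : v \notin X by apply/negP => /Xn; rewrite inE e_irr andbF.
have XS x y : x \in X -> y \in S -> ~~ e x y.
  by rewrite inE => /andP[_ /forall_inP]; apply.
(* Triangle-freeness enters here: neighbours of [v] are pairwise non-adjacent, so [S] may be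
   extended by every subset of [X]. *)
have Xi x y : x \in X -> y \in X -> ~~ e x y.
  move=> /Xn + /Xn; rewrite !inE => /andP[xA vx] /andP[yA vy].
  by apply/negP => xy; exact: (@e_tri v x y).
have FE : F = (v |: S) |: [set S :|: Y | Y in powerset X].
  apply/setP=> W; rewrite !inE; apply/idP/idP.
    move=> /andP[/stableP[WA Wi] /eqP kW].
    have SW : S \subset W by rewrite -kW subsetDl.
    have inW x : x \in W -> [|| x == v, x \in nbh v | x \in S].
      move=> xW; rewrite -kW in_setD in_setU1 xW andbT negb_or.
      by case: (x == v) => //=; case: (x \in nbh v).
    have [vW|vW] := boolP (v \in W).
      apply/orP; left; apply/eqP/setP=> x; rewrite in_setU1; apply/idP/idP.
        move=> xW; have := inW _ xW; case: (x == v) => //=.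
        by rewrite inE (negbTE (Wi _ _ vW xW)) andbF.
      by case/orP => [/eqP->|/(subsetP SW)].
    apply/orP; right; apply/imsetP; exists (W :&: nbh v).
      rewrite powersetE; apply/subsetP => x; rewrite !in_set => /andP[xW ->] /=.
      by apply/forall_inP => y yS; apply: Wi => //; apply: (subsetP SW).
    apply/setP => x; rewrite in_setU in_setI; apply/idP/idP.
      move=> xW; have := inW _ xW; rewrite xW.
      by case: eqP xW => [->|_ _ /= /orP[->|->]]; rewrite ?orbT // (negbTE vW).
    by case/orP => [/(subsetP SW)|/andP[]].
  case/orP => [/eqP-> | /imsetP[Y]].
    apply/andP; split.
      apply/stableP; split; first by rewrite subUset sub1set vA.
      move=> x y; rewrite !in_setU1 => /orP[/eqP->|xS] /orP[/eqP->|yS].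
      - by rewrite e_irr.
      - exact: veS.
      - by rewrite e_sym veS.
      - exact: Si.
    apply/eqP/setP => x; rewrite in_setD !in_setU1 negb_or.
    case: (x =P v) => [->|_] /=; first by rewrite (negbTE vS).
    by case xS: (x \in S); rewrite ?andbF // nS.
  rewrite powersetE => /subsetP YX ->; apply/andP; split.
    apply/stableP; split.
      by rewrite subUset SA /=; apply/subsetP => x /YX /XA.
    move=> x y; rewrite !in_setU => /orP[xS|/YX xY] /orP[yS|/YX yY].
    - exact: Si.
    - by rewrite e_sym XS.
    - exact: XS.
    - exact: Xi.
  apply/eqP/setP => x; rewrite in_setD in_setU1 in_setU negb_or.
  case xS: (x \in S); first by rewrite nS //; have -> : x != v by apply: contraNneq vS => <-.
  by case xY: (x \in Y); rewrite ?andbF // (Xn _ (YX _ xY)) andbF.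
have vSn : v |: S \notin [set S :|: Y | Y in powerset X].
  apply/imsetP => -[Y]; rewrite powersetE => /subsetP YX /setP/(_ v).
  rewrite in_setU1 eqxx in_setU (negbTE vS) /= => /esym /YX.
  by rewrite (negbTE vX).
have inj : {in powerset X &, injective (setU S)}.
  move=> Y Z; rewrite !powersetE => /subsetP YX /subsetP ZX /setP eYZ.
  apply/setP => x; have := eYZ x; rewrite !in_setU.
  have [xS _|//] := boolP (x \in S).
  by apply/idP/idP => [/YX|/ZX] /Xn; rewrite (negbTE (nS _ xS)).
rewrite FE cardsU1 vSn card_in_imset // card_powerset big_setU1 //= big_imset //=.
have f1 : c <= occupancy v (v |: S) by rewrite /occupancy setU11 muln1 leq_addr.
have f2 : \sum_(Y in powerset X) #|Y| <= \sum_(Y in powerset X) occupancy v (S :|: Y).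
  apply: leq_sum => Y; rewrite powersetE => YX.
  apply: leq_trans (leq_addl _ _); apply: subset_leq_card.
  rewrite subsetI subsetUr andbT.
  by apply/subsetP => x /(subsetP YX) /Xn.
have := sum_card_powerset X; have := @alon_numeric c t #|X| tc.
move: f1 f2 => /=.
move: (occupancy _ _) (2 ^ #|X|) => f p.
set g1 := \sum_(Y in powerset X) #|Y|; set g2 := \sum_(Y in powerset X) _.
by clearbody g1 g2 => *; nia.
Qed.

(** Sum [sum_occupancy] over [v], exchange the sums, and note that the largest stable set is at
    least as large as the average one. *)
Lemma alon_stable D : (forall v, v \in A -> #|nbh v| <= D) ->
  exists2 W, stable W & t * #|A| <= (D + c) * #|W|.
Proof.
move=> degD; pose I := stables.
have tot : t * #|A| * #|I| <= \sum_(W in I) (D + c) * #|W|.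
  rewrite mulnAC mulnC -sum_nat_const.
  apply: (@leq_trans (\sum_(v in A) \sum_(W in I) occupancy v W)).
    by apply: leq_sum => v vA; exact: sum_occupancy.
  rewrite exchange_big /=; apply: leq_sum => W; rewrite inE => /stableP[WA _].
  rewrite big_split /= -big_distrr /= mulnDl addnC leq_add //.
    rewrite (eq_bigr (fun v => \sum_(w in W) (e v w : nat))); last first.
      move=> v vA; rewrite -sum1dep_card big_mkcondr /= -big_mkcondr /=.
      rewrite big_mkcond [RHS]big_mkcond /=; apply: eq_bigr => w _.
      by rewrite !inE; have := subsetP WA w; case: (w \in W) => [->|] //=;
        rewrite ?andbF // andbT; case: (e v w).
    rewrite exchange_big /= mulnC -sum_nat_const; apply: leq_sum => w wW.
    apply: leq_trans (degD w (subsetP WA _ wW)).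
    rewrite -sum1_card big_mkcond [leqRHS]big_mkcond /=; apply: leq_sum => v _.
    by rewrite inE e_sym; case: (v \in A) => //=; case: (e w v).
  rewrite leq_mul2l; apply/orP; right.
  rewrite -sum1_card big_mkcond [leqRHS]big_mkcond /=; apply: leq_sum => v _.
  by case vW: (v \in W); [rewrite (subsetP WA _ vW)|case: (v \in A)].
have I0 : set0 \in I.
  by rewrite inE; apply/stableP; split; rewrite ?sub0set // => x y; rewrite inE.
have [W WI maxW] := @arg_maxnP _ set0 (mem I) (fun W => #|W|) I0.
have {}WI : W \in I := WI; exists W; first by rewrite inE in WI.
have Ipos : 0 < #|I| by apply/card_gt0P; exists set0.
rewrite -(leq_pmul2r Ipos); apply: leq_trans tot _.
rewrite mulnC -sum_nat_const; apply: leq_sum => W' W'I.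
by rewrite leq_mul2l; apply/orP; right; apply: maxW.
Qed.

End TriangleFree.

(** * Histories of the game as triangle-free graphs *)

Section Histories.

Local Open Scope nat_scope.

Variable n : nat.
Implicit Types (h : history n) (e S A : {set 'I_n}) (E : {set {set 'I_n}}).
Implicit Types x y z : 'I_n.

Lemma set2C x y : [set x; y] = [set y; x].
Proof. exact: setUC. Qed.

Lemma graph_rcons h e b :
  graph (rcons h (e, b)) = if b then e |: graph h else graph h.
Proof.
apply/setP => f; rewrite !inE mem_rcons inE xpair_eqE.
by case: b; rewrite ?inE ?andbT ?andbF.
Qed.

Lemma forbidden_rcons h e b : forbidden (rcons h (e, b)) = e |: forbidden h.
Proof. by apply/setP => f; rewrite !inE map_rcons mem_rcons inE. Qed.

Lemma graph_sub_forbidden h : graph h \subset forbidden h.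
Proof. by apply/subsetP => e; rewrite !inE => /(map_f fst). Qed.

Lemma graph_rcons_sub h e b : graph h \subset graph (rcons h (e, b)).
Proof. by rewrite graph_rcons; case: b => //; rewrite subsetUr. Qed.

Definition joined E x y := [exists z, ([set x; z] \in E) && ([set y; z] \in E)].

Lemma joinedP E x y :
  reflect (exists2 z, [set x; z] \in E & [set y; z] \in E) (joined E x y).
Proof.
apply: (iffP existsP) => [[z /andP[]]|[z xz yz]]; first by exists z.
by exists z; rewrite xz.
Qed.

Lemma set2_inj x y x' y' : [set x; y] = [set x'; y'] ->
  (x = x' /\ y = y') \/ (x = y' /\ y = x').
Proof.
move/setP => H.
have := H x; rewrite !inE eqxx /= => /esym/orP[]/eqP ex.
  have := H y'; rewrite !inE eqxx orbT => /orP[]/eqP ey; last by left.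
  by have := H y; rewrite !inE eqxx orbT => /esym/orP[]/eqP ?; left; split; congruence.
have := H x'; rewrite !inE eqxx => /orP[]/eqP ey; last by right.
by have := H y; rewrite !inE eqxx orbT => /esym/orP[]/eqP ?; right; split; congruence.
Qed.

Lemma closed_pairE E x y : x != y ->
  closed_pair E [set x; y] = ([set x; y] \notin E) && joined E x y.
Proof.
move=> xy; rewrite /closed_pair cards2 xy /=; congr (_ && _).
apply/existsP/joinedP => [[x' /existsP[y' /existsP[z /and3P[/eqP exy xz yz]]]]|[z xz yz]].
  by have [[-> ->]|[-> ->]] := set2_inj exy; exists z.
by exists x; apply/existsP; exists y; apply/existsP; exists z; rewrite eqxx xz.
Qed.

Lemma legalE h x y : x != y ->
  legal h [set x; y] = ([set x; y] \notin forbidden h) && ~~ joined (graph h) x y.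
Proof.
move=> xy; rewrite /legal /open_pair closed_pairE // cards2 xy /=.
case eF: (_ \in forbidden h); first by rewrite andbF.
have -> : [set x; y] \notin graph h.
  by apply/negP => /(subsetP (graph_sub_forbidden h)); rewrite eF.
by rewrite andbT.
Qed.

Lemma legal2 h e : legal h e -> exists x y, [/\ x != y & e = [set x; y]].
Proof. by case/andP => /and3P[/cards2P H _ _ _]; case: H => x [y []]; exists x, y. Qed.

Lemma legal_card h e : legal h e -> #|e| = 2.
Proof. by case/andP => /and3P[/eqP]. Qed.

Lemma legal_notin h e : legal h e -> e \notin forbidden h.
Proof. by case/andP. Qed.

Lemma joined_mono E E' x y : E \subset E' -> joined E x y -> joined E' x y.
Proof.
by move=> /subsetP EE' /joinedP[z xz yz]; apply/joinedP; exists z; apply: EE'.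
Qed.

Lemma legal_rcons h e b f : legal (rcons h (e, b)) f -> legal h f && (f != e).
Proof.
move=> lf; have [x [y [xy ef]]] := legal2 lf; move: lf; rewrite {}ef !legalE //.
rewrite forbidden_rcons in_setU1 negb_or => /andP[/andP[-> ->]] /=.
by rewrite andbT; apply: contra; apply: joined_mono; apply: graph_rcons_sub.
Qed.

Definition triangle_free E := forall x y z,
  [set x; y] \in E -> [set x; z] \in E -> [set y; z] \in E -> False.

Record wf h : Prop := Wf {
  wf_card : forall e, e \in forbidden h -> #|e| = 2;
  wf_tri : triangle_free (graph h) }.

Lemma wf_nil : wf [::].
Proof. by split=> // [e|x y z]; rewrite inE. Qed.

Lemma wf_edge h x y : wf h -> [set x; y] \in graph h -> x != y.
Proof.
move=> wh xy; have := wf_card wh (subsetP (graph_sub_forbidden h) _ xy).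
by rewrite cards2; case: eqP.
Qed.

Lemma wf_rcons h e b : wf h -> legal h e -> wf (rcons h (e, b)).
Proof.
move=> wh le; split.
- move=> f; rewrite forbidden_rcons => /setU1P[->|]; last exact: wf_card.
  exact: legal_card le.
- rewrite graph_rcons; case: b; last exact: wf_tri.
  have [u [v [uv ee]]] := legal2 le.
  (* A triangle using the new pair [e] as its first side: its third vertex is already a common
     neighbour, against openness, or two of its vertices coincide. The other positions of [e] follow
     by symmetry. *)
  have H u' v' z : e = [set u'; v'] ->
      [set u'; z] \in e |: graph h -> [set v'; z] \in e |: graph h -> False.
    move=> ee'; have uv' : u' != v' by move: (legal_card le); rewrite ee' cards2; case: eqP.
    move: le; rewrite ee' legalE // => /andP[_ nj].
    case/setU1P=> [/set2_inj[[_ E1]|[E1 E2]]|uz]; last first.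
      case/setU1P=> [/set2_inj[[E1 E2]|[E1 E2]]|vz].
      - by rewrite E1 eqxx in uv'.
      - by have := wf_edge wh uz; rewrite E2 eqxx.
      - by case/negP: nj; apply/joinedP; exists z.
    - by rewrite E1 eqxx in uv'.
    rewrite E1; case/setU1P=> [/set2_inj[[E3 E4]|[E3 E4]]|vz].
    - by rewrite E3 eqxx in uv'.
    - by rewrite E4 eqxx in uv'.
    by have := wf_edge wh vz; rewrite eqxx.
  move=> x y z xy xz yz.
  have [exy|nxy] := eqVneq [set x; y] e; first by apply: (H x y z) => //.
  have [exz|nxz] := eqVneq [set x; z] e.
    by apply: (H x z y) => //; rewrite set2C.
  have [eyz|nyz] := eqVneq [set y; z] e.
    by apply: (H y z x) => //; rewrite set2C.
  move: xy xz yz; rewrite !in_setU1 (negbTE nxy) (negbTE nxz) (negbTE nyz) /=.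
  exact: wf_tri.
Qed.

Definition edges_in E A := [set e in E | e \subset A].

Lemma sum_degree E A : (forall e, e \in E -> #|e| = 2) ->
  \sum_(v in A) #|[set w in A | [set v; w] \in E]| <= 2 * #|edges_in E A|.
Proof.
move=> E2; apply: (@leq_trans (\sum_(v in A) #|[set e in edges_in E A | v \in e]|)).
  apply: leq_sum => v vA.
  rewrite -(@card_in_imset _ _ (fun w => [set v; w])).
    apply/subset_leq_card/subsetP => e /imsetP[w]; rewrite inE => /andP[wA vw] ->.
    by rewrite !inE vw eqxx /= andbT subUset !sub1set vA.
  move=> w w'; rewrite !inE => /andP[_ vw] /andP[_ vw'] /set2_inj[[//]|[e1 e2]].
  by rewrite e2 -e1.
rewrite (eq_bigr (fun v => \sum_(e in edges_in E A) (v \in e : nat))); last first.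
  move=> v _; rewrite -sum1_card big_mkcond [RHS]big_mkcond /=.
  by apply: eq_bigr => e _; rewrite !inE; do !case: (_ \in _); case: (_ \subset _).
rewrite exchange_big /= mulnC -sum_nat_const; apply: leq_sum => e.
rewrite inE => /andP[eE _]; rewrite -(E2 _ eE) -[leqRHS]sum1_card.
rewrite big_mkcond [leqRHS]big_mkcond /=.
by apply: leq_sum => v _; case: (v \in A); case: (v \in e).
Qed.

(** By Markov's inequality on degrees at least half of [A] has degree at most [D] inside [A]. Alon's
    bound is applied to that half, which costs the factor 2. *)
Lemma sparse_independent h A D c t : wf h ->
  t * (2 ^ (2 * t) + 1) <= c -> 4 * #|edges_in (graph h) A| <= #|A| * D.+1 ->
  exists2 S, independent (graph h) S & t * #|A| <= 2 * (D + c) * #|S|.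
Proof.
move=> wh tc sparse; set E := graph h in sparse *.
pose deg v := #|[set w in A | [set v; w] \in E]|.
pose B := [set v in A | deg v <= D].
have AB : #|A| <= 2 * #|B|.
  have h1 : #|A :\: B| * D.+1 <= \sum_(v in A) deg v.
    rewrite [leqRHS](big_setID B) /= -sum_nat_const.
    apply: leq_trans (leq_addl _ _); apply: leq_sum => v.
    by rewrite !inE => /andP[]; case: (v \in A) => //=; rewrite -ltnNge.
  have h2 := @sum_degree E A _.
  have h3 := cardsID B A.
  have BA : A :&: B = B by apply/setIidPr; apply/subsetP => v; rewrite inE => /andP[].
  rewrite BA in h3.
  have {}h2 := leq_trans h1 (h2 (fun e eE =>
    wf_card wh (subsetP (graph_sub_forbidden h) e eE))).
  nia.
pose r := [rel x y | [set x; y] \in E].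
have rs : symmetric r by move=> x y /=; rewrite set2C.
have ri : irreflexive r.
  by move=> x /=; apply/negP => xx; have := wf_edge wh xx; rewrite eqxx.
have rt x y z : x \in B -> y \in B -> z \in B -> r x y -> r x z -> r y z -> False.
  by move=> _ _ _ /= xy xz yz; exact: (wf_tri wh xy xz yz).
have rD v : v \in B -> #|nbh r B v| <= D.
  rewrite inE => /andP[vA]; apply: leq_trans.
  apply/subset_leq_card/subsetP => w /setIdP[/setIdP[wA _] vw].
  by apply/setIdP.
have [W /stableP[WB Wi]] := alon_stable rs ri rt tc rD.
move=> WD; exists W; last by nia.
by apply/forall_inP => x xW; apply/forall_inP => y yW; exact: Wi.
Qed.

End Histories.

Lemma card_bigcup_le (I J : finType) (P : {set I}) (F : I -> {set J}) (X : {set J}) :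
  (forall x, x \in X -> exists2 i, i \in P & x \in F i) ->
  (#|X| <= \sum_(i in P) #|F i|)%N.
Proof.
move=> XF; rewrite -sum1_card.
rewrite [leqRHS](eq_bigr (fun i => \sum_(x : J) (x \in F i : nat))%N); last first.
  by move=> i _; rewrite -sum1_card big_mkcond; apply: eq_bigr => x _; case: (x \in _).
rewrite exchange_big /= big_mkcond; apply: leq_sum => x _.
case: ifP => // xX; have [i iP xi] := XF x xX.
by rewrite (bigD1 i) //= xi.
Qed.

(** * Decider's strategy *)

Lemma natr_bin2 (R : realFieldType) m : 'C(m, 2)%:R = m%:R * (m%:R - 1) / 2 :> R.
Proof.
have /(congr1 (fun k => k%:R : R)) := mul_bin_diag m 1; rewrite bin1 !natrM => /esym.
case: m => [|m] /=; first by rewrite bin0n !mul0r.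
have -> : m.+1%:R - 1 = m%:R :> R by rewrite -natr1 addrK.
by move=> <-; field.
Qed.

Section DeciderPotential.

Variables (R : realType) (n s : nat) (lam K : R) (Del : nat).
Hypothesis lam_ge0 : 0 <= lam.
Hypothesis K_ge0 : 0 <= K.
Implicit Types (h : history n) (e S : {set 'I_n}) (x y z w : 'I_n).

Definition yes_prob : R := 1 - expR (- lam).
Local Notation p := yes_prob.

Lemma yes_prob_ge0 : 0 <= p.
Proof. by rewrite subr_ge0 expR_le1 oppr_le0. Qed.

Lemma yes_prob_le1 : p <= 1.
Proof. by rewrite lerBlDr lerDl expR_ge0. Qed.

Lemma no_probE : 1 - p = expR (- lam).
Proof. by rewrite /yes_prob opprB addrC subrK. Qed.

Definition yes_nbr h S z := [set w in S | [set z; w] \in graph h].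
Definition free_nbr h S z := [set w in S | [set z; w] \notin forbidden h].

Lemma in_yes_nbr h S z w :
  (w \in yes_nbr h S z) = (w \in S) && ([set z; w] \in graph h).
Proof. by rewrite in_set. Qed.

Lemma in_free_nbr h S z w :
  (w \in free_nbr h S z) = (w \in S) && ([set z; w] \notin forbidden h).
Proof. by rewrite in_set. Qed.

(* The conditional expectation of [a ^+ d], where [d] is the final number of
   neighbours of [z] in [S], if all remaining pairs were to be proposed. *)
Definition deg_weight (a : R) h S z : R :=
  a ^+ #|yes_nbr h S z| * (1 + p * (a - 1)) ^+ #|free_nbr h S z|.

Lemma deg_weight_ge0 a h S z : 1 <= a -> 0 <= deg_weight a h S z.
Proof.
move=> a1; rewrite mulr_ge0 ?exprn_ge0 ?(le_trans ler01) //.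
by rewrite lerDl mulr_ge0 ?yes_prob_ge0 // subr_ge0.
Qed.

Lemma deg_weight_ge a h S z : 1 <= a -> a ^+ #|yes_nbr h S z| <= deg_weight a h S z.
Proof.
move=> a1; rewrite ler_peMr ?exprn_ge0 ?(le_trans ler01) //.
by rewrite exprn_ege1 // lerDl mulr_ge0 ?yes_prob_ge0 // subr_ge0.
Qed.

Lemma deg_weight_same a h S z e b : (forall w, w \in S -> [set z; w] != e) ->
  deg_weight a (rcons h (e, b)) S z = deg_weight a h S z.
Proof.
move=> H; rewrite /deg_weight; congr (_ ^+ _ * _ ^+ _); apply: eq_card => w.
  rewrite !in_yes_nbr; case wS: (w \in S) => //=.
  by rewrite graph_rcons; case: b; rewrite // in_setU1 (negbTE (H _ wS)).
rewrite !in_free_nbr; case wS: (w \in S) => //=.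
by rewrite forbidden_rcons in_setU1 (negbTE (H _ wS)).
Qed.

(** The answer replaces one factor 1 + p (a - 1), which is the mean of a^X for a Bernoulli(p)
    variable X, by [a] or by 1. *)
Lemma deg_weight_step a h S z w : w \in S -> z != w ->
  [set z; w] \notin forbidden h ->
  p * deg_weight a (rcons h ([set z; w], true)) S z +
  (1 - p) * deg_weight a (rcons h ([set z; w], false)) S z = deg_weight a h S z.
Proof.
move=> wS zw nf; rewrite /deg_weight.
have inj v : [set z; v] = [set z; w] -> v = w.
  by case/set2_inj => [[]|[e1]] //; rewrite e1 eqxx in zw.
have freeE b : #|free_nbr h S z| = #|free_nbr (rcons h ([set z; w], b)) S z|.+1.
  rewrite (cardsD1 w) in_free_nbr wS nf add1n; congr _.+1; apply: eq_card => v.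
  rewrite in_setD1 !in_free_nbr forbidden_rcons in_setU1 negb_or.
  rewrite andbCA; congr (_ && (_ && _)).
  by apply/idP/idP; apply: contra => /eqP; [move=> /inj ->|move=> ->].
have yesT : #|yes_nbr (rcons h ([set z; w], true)) S z| = #|yes_nbr h S z|.+1.
  rewrite (cardsD1 w) in_yes_nbr wS graph_rcons setU11 add1n; congr _.+1.
  apply: eq_card => v; rewrite in_setD1 !in_yes_nbr graph_rcons in_setU1.
  case: (v =P w) => [-> | vw] /=.
    by apply/esym/negP => /andP[_ /(subsetP (graph_sub_forbidden h))]; apply/negP.
  by case: eqP => [/inj|].
have yesF : #|yes_nbr (rcons h ([set z; w], false)) S z| = #|yes_nbr h S z|.
  by apply: eq_card => v; rewrite !in_yes_nbr graph_rcons.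
have <- : #|free_nbr (rcons h ([set z; w], true)) S z| =
          #|free_nbr (rcons h ([set z; w], false)) S z|.
  by apply: succn_inj; rewrite -!freeE.
rewrite yesT yesF (freeE true).
rewrite !exprS; set b := 1 + p * (a - 1).
set A := a ^+ _; set B := b ^+ _; rewrite /b; ring.
Qed.

Definition light_base : R := expR (lam * K / 2).
Definition heavy_base : R := expR (1 + lam * Del%:R / 2).

(* Majorizes [expR (lam * d (d - 1) / 2)] for degrees [d <= Del]: the two terms
   correspond to [d <= K] and [d > K]. *)
Definition vertex_weight h S z : R :=
  deg_weight light_base h S z + expR (- K) * deg_weight heavy_base h S z.

Lemma light_base_ge1 : 1 <= light_base.
Proof. by rewrite leNgt expR_lt1 -leNgt divr_ge0 // mulr_ge0. Qed.

Lemma heavy_base_ge1 : 1 <= heavy_base.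
Proof. by rewrite leNgt expR_lt1 -leNgt addr_ge0 // divr_ge0 // mulr_ge0. Qed.

Lemma vertex_weight_ge0 h S z : 0 <= vertex_weight h S z.
Proof.
apply: addr_ge0; last apply: mulr_ge0; rewrite ?expR_ge0 //.
  by apply: deg_weight_ge0; exact: light_base_ge1.
by apply: deg_weight_ge0; exact: heavy_base_ge1.
Qed.

Lemma vertex_weight_same h S z e b : (forall w, w \in S -> [set z; w] != e) ->
  vertex_weight (rcons h (e, b)) S z = vertex_weight h S z.
Proof. by move=> H; rewrite /vertex_weight !deg_weight_same. Qed.

Lemma vertex_weight_step h S z w : w \in S -> z != w ->
  [set z; w] \notin forbidden h ->
  p * vertex_weight (rcons h ([set z; w], true)) S z +
  (1 - p) * vertex_weight (rcons h ([set z; w], false)) S z = vertex_weight h S z.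
Proof.
move=> wS zw nf; rewrite /vertex_weight.
rewrite -(deg_weight_step light_base wS zw nf).
rewrite -(deg_weight_step heavy_base wS zw nf); ring.
Qed.

Lemma vertex_weight_ge h S z : (#|yes_nbr h S z| <= Del)%N ->
  expR (lam * 'C(#|yes_nbr h S z|, 2)%:R) <= vertex_weight h S z.
Proof.
set d := #|_| => dD.
have dge0 : 0 <= d%:R :> R by [].
have [dK|Kd] := lerP d%:R K.
  apply: le_trans (_ : deg_weight light_base h S z <= _); last first.
    by rewrite lerDl mulr_ge0 ?expR_ge0 // deg_weight_ge0 // heavy_base_ge1.
  apply: le_trans (deg_weight_ge _ _ _ light_base_ge1).
  rewrite -/d -expRM_natr ler_expR natr_bin2.
  have : 0 <= lam * d%:R * (K - d%:R + 1) by rewrite !mulr_ge0 //; lra.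
  by lra.
apply: le_trans (_ : expR (- K) * deg_weight heavy_base h S z <= _); last first.
  by rewrite lerDr deg_weight_ge0 // light_base_ge1.
apply: le_trans (ler_wpM2l (expR_ge0 _) (deg_weight_ge _ _ _ heavy_base_ge1)).
rewrite -/d -expRM_natr -expRD ler_expR natr_bin2.
have : 0 <= lam * d%:R * (Del%:R - d%:R + 1).
  by rewrite !mulr_ge0 //; have : d%:R <= Del%:R :> R; [rewrite ler_nat|lra].
by lra.
Qed.

Definition free_pairs h S := [set e : {set 'I_n} | [&& #|e| == 2, e \subset S & e \notin forbidden h]].

Lemma in_free_pairs h S e :
  (e \in free_pairs h S) = [&& #|e| == 2, e \subset S & e \notin forbidden h].
Proof. by rewrite in_set. Qed.

(** The conditional probability that [S] spans no edge at the end, if all its remaining pairs were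
    to be proposed. *)
Definition inner_weight h S : R :=
  (edges_in (graph h) S == set0)%:R * (1 - p) ^+ #|free_pairs h S|.

Lemma in_edges_in (E : {set {set 'I_n}}) S e :
  (e \in edges_in E S) = (e \in E) && (e \subset S).
Proof. by rewrite in_set. Qed.

Lemma inner_weight_same h S e b : ~~ (e \subset S) ->
  inner_weight (rcons h (e, b)) S = inner_weight h S.
Proof.
move=> eS; rewrite /inner_weight.
have -> : edges_in (graph (rcons h (e, b))) S = edges_in (graph h) S.
  apply/setP => f; rewrite !in_edges_in graph_rcons; case: b => //.
  by rewrite in_setU1; case: (f =P e) => [->|//]; rewrite (negbTE eS) !andbF.
congr (_ * _ ^+ _); apply: eq_card => f; rewrite !in_free_pairs forbidden_rcons.
by rewrite in_setU1; case: (f =P e) => [->|//]; rewrite (negbTE eS) !andbF.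
Qed.

Lemma inner_weight_step h S e : e \subset S -> #|e| = 2 -> e \notin forbidden h ->
  p * inner_weight (rcons h (e, true)) S +
  (1 - p) * inner_weight (rcons h (e, false)) S = inner_weight h S.
Proof.
move=> eS e2 ef; rewrite /inner_weight.
have -> : edges_in (graph (rcons h (e, true))) S == set0 = false.
  apply/negbTE/set0Pn; exists e.
  by rewrite in_edges_in graph_rcons setU11.
have -> : edges_in (graph (rcons h (e, false))) S = edges_in (graph h) S.
  by apply/setP => f; rewrite !in_edges_in graph_rcons.
have -> : #|free_pairs h S| = #|free_pairs (rcons h (e, false)) S|.+1.
  rewrite (cardsD1 e) in_free_pairs e2 eS ef add1n; congr _.+1.
  apply: eq_card => f; rewrite in_setD1 !in_free_pairs forbidden_rcons in_setU1.
  by case: (f =P e); rewrite ?andbF.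
by rewrite exprS mul0r mulr0 add0r mulrCA.
Qed.

Definition set_weight h S : R :=
  inner_weight h S * \prod_(z in ~: S) vertex_weight h S z.

Lemma set_weight_ge0 h S : 0 <= set_weight h S.
Proof.
rewrite mulr_ge0 ?prodr_ge0 // => [|z _]; last exact: vertex_weight_ge0.
by rewrite mulr_ge0 ?exprn_ge0 ?subr_ge0 ?yes_prob_le1.
Qed.

Lemma set_weight_same h S e b : (forall z w, w \in S -> [set z; w] != e) ->
  ~~ (e \subset S) -> set_weight (rcons h (e, b)) S = set_weight h S.
Proof.
move=> H eS; rewrite /set_weight inner_weight_same //; congr (_ * _).
by apply: eq_bigr => z _; apply: vertex_weight_same => w; exact: H.
Qed.

Lemma set_weight_cross h S x y : x \notin S -> y \in S ->
  [set x; y] \notin forbidden h ->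
  p * set_weight (rcons h ([set x; y], true)) S +
  (1 - p) * set_weight (rcons h ([set x; y], false)) S = set_weight h S.
Proof.
move=> xS yS nf; have xy : x != y by apply: contraNneq xS => ->.
have xyS : ~~ ([set x; y] \subset S) by rewrite subUset sub1set (negbTE xS).
rewrite /set_weight !inner_weight_same //.
have xC : x \in ~: S by rewrite in_setC.
rewrite !(bigD1 x xC) /=.
have same b : \prod_(z in ~: S | z != x) vertex_weight (rcons h ([set x; y], b)) S z
            = \prod_(z in ~: S | z != x) vertex_weight h S z.
  apply: eq_bigr => z /andP[_ zx]; apply: vertex_weight_same => w wS.
  apply/eqP => /set2_inj[[zx' _]|[_ wx]]; first by rewrite zx' eqxx in zx.
  by rewrite -wx wS in xS.
by rewrite !same -(vertex_weight_step yS xy nf); ring.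
Qed.

Lemma set_weight_step h S e : legal h e ->
  p * set_weight (rcons h (e, true)) S +
  (1 - p) * set_weight (rcons h (e, false)) S = set_weight h S.
Proof.
move=> le; have nf := legal_notin le; have e2 := legal_card le.
have [x [y [xy ee]]] := legal2 le.
have [xS|xS] := boolP (x \in S); have [yS|yS] := boolP (y \in S).
- have eS : e \subset S by rewrite ee subUset !sub1set xS.
  have same b : \prod_(z in ~: S) vertex_weight (rcons h (e, b)) S z
            = \prod_(z in ~: S) vertex_weight h S z.
    apply: eq_bigr => z; rewrite in_setC => zS; apply: vertex_weight_same => w wS.
    by apply: contraNneq zS => zwe; apply: (subsetP eS); rewrite -zwe set21.
  rewrite /set_weight !same -(inner_weight_step eS e2 nf); ring.
- by rewrite ee set2C in nf *; apply: set_weight_cross.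
- by rewrite ee in nf *; apply: set_weight_cross.
have H z w : w \in S -> [set z; w] != e.
  move=> wS; apply/eqP => ezw; have : w \in e by rewrite -ezw set22.
  by rewrite ee in_set2 => /orP[]/eqP wE; rewrite -wE wS in xS yS.
rewrite !set_weight_same //; first by ring.
- by rewrite ee subUset !sub1set (negbTE xS).
- by rewrite ee subUset !sub1set (negbTE xS).
Qed.

Lemma set_weight_ge1 h S : wf h -> game_over h -> independent (graph h) S ->
  (forall z, #|yes_nbr h setT z| <= Del)%N -> 1 <= set_weight h S.
Proof.
move=> wh oh indS degD; rewrite /set_weight /inner_weight.
have Sedge x y : x \in S -> y \in S -> [set x; y] \notin graph h.
  by move=> xS yS; move/forall_inP: indS => /(_ x xS)/forall_inP; apply.
have -> : edges_in (graph h) S == set0.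
  apply/eqP/setP => e; rewrite in_edges_in in_set0; apply/negP => /andP[eG eS].
  have e2 := wf_card wh (subsetP (graph_sub_forbidden h) _ eG).
  have /cards2P[x [y [_ exy]]] : #|e| == 2 by rewrite e2.
  move: eG eS; rewrite exy subUset !sub1set => eG /andP[xS yS].
  by rewrite (negbTE (Sedge _ _ xS yS)) in eG.
rewrite mul1r no_probE.
(* The game is over, so an unproposed pair of [S] is closed; its common neighbour lies outside [S]
   because [S] is independent. *)
have card : (#|free_pairs h S| <= \sum_(z in ~: S) 'C(#|yes_nbr h S z|, 2))%N.
  pose F z := [set e : {set 'I_n} | (e \subset yes_nbr h S z) && (#|e| == 2)].
  rewrite (eq_bigr (fun z => #|F z|)); last by move=> z _; rewrite cards_draws.
  apply: card_bigcup_le => e; rewrite in_free_pairs => /and3P[/cards2P[x [y [xy ->]]]].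
  rewrite subUset !sub1set => /andP[xS yS] nf.
  have : ~~ legal h [set x; y] by move/forallP: oh.
  rewrite legalE // nf /= negbK => /joinedP[z xz yz].
  exists z; first by rewrite in_setC; apply: contraL xz; exact: Sedge.
  rewrite in_set cards2 xy andbT subUset !sub1set !in_yes_nbr xS yS.
  by rewrite !(set2C z) xz yz.
apply: (@le_trans _ _ (\prod_(z in ~: S) (expR (- lam) ^+ 'C(#|yes_nbr h S z|, 2) *
    vertex_weight h S z))).
  have e1 : \prod_(z in ~: S) (1 : R) = 1 by rewrite big1_eq.
  rewrite -[leLHS]e1; apply: ler_prod => z _; rewrite ler01 /= -expRM_natr mulNr expRN.
  rewrite -ler_pdivrMl ?invr_gt0 ?expR_gt0 // invrK mulr1.
  apply: vertex_weight_ge; apply: leq_trans (degD z).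
  by apply/subset_leq_card/subsetP => w; rewrite !in_yes_nbr in_setT => /andP[].
rewrite big_split /= ler_wpM2r ?prodr_ge0 // => [z _|]; first exact: vertex_weight_ge0.
rewrite prodrXr ler_wiXn2l // ?expR_ge0 //.
by rewrite expR_le1 oppr_le0.
Qed.

(** The first sum pays for vertices whose degree exceeds [Del], beyond which [vertex_weight] need
    not majorize: such a vertex alone contributes at least 1. The second sum is a union bound over
    all candidate sets. *)
Definition decider_potential (k : nat) h : R :=
  \sum_z deg_weight 2 h setT z / 2 ^+ Del + \sum_(S : {set 'I_n} | #|S| == s) set_weight h S.

Lemma degree_step h e : legal h e ->
  \sum_z (p * (deg_weight 2 (rcons h (e, true)) setT z / 2 ^+ Del) +
    (1 - p) * (deg_weight 2 (rcons h (e, false)) setT z / 2 ^+ Del)) =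
  \sum_z deg_weight 2 h setT z / 2 ^+ Del.
Proof.
move=> le; have nf := legal_notin le.
have [x [y [xy ee]]] := legal2 le; apply: eq_bigr => z _.
rewrite (mulrA p) (mulrA (1 - p)) -mulrDl; congr (_ / _).
have [w /eqP ezw|H] := pickP (fun w => [set z; w] == e); last first.
  by rewrite !deg_weight_same ?addrNK => [|w _|w _]; rewrite ?H //; ring.
move: (legal_card le) nf; rewrite -ezw cards2 => zw nf.
by apply: deg_weight_step; rewrite ?in_setT //; case: eqP zw.
Qed.

Lemma decider_potential_step k h e : legal h e ->
  p * decider_potential k (rcons h (e, true)) +
  (1 - p) * decider_potential k (rcons h (e, false)) = decider_potential k.+1 h.
Proof.
move=> le; rewrite /decider_potential -(degree_step le) !mulrDr !mulr_sumr.
rewrite addrACA -!big_split /=; congr (_ + _).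
by apply: eq_bigr => S _; apply: set_weight_step.
Qed.

Lemma decider_potential_ge0 k h : 0 <= decider_potential k h.
Proof.
rewrite addr_ge0 ?sumr_ge0 // => [z _|S _]; last exact: set_weight_ge0.
by rewrite divr_ge0 ?exprn_ge0 // deg_weight_ge0 // ler1n.
Qed.

Lemma decider_potential_lost k h S : wf h -> game_over h ->
  independent (graph h) S -> (s <= #|S|)%N -> 1 <= decider_potential k h.
Proof.
move=> wh oh indS sS.
(* The potential ranges over sets of exactly [s] vertices, so the independent set is cut down to
   that size. *)
have [T TS sT] : exists2 T : {set 'I_n}, T \subset S & #|T| = s.
  exists [set x in take s (enum S)].
    by apply/subsetP => x; rewrite inE => /mem_take; rewrite mem_enum.
  rewrite cardsE; have /card_uniqP -> : uniq (take s (enum S)).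
    by rewrite take_uniq // enum_uniq.
  by rewrite size_takel // -cardE.
have indT : independent (graph h) T.
  apply/forall_inP => x /(subsetP TS) xS; apply/forall_inP => y /(subsetP TS) yS.
  by move/forall_inP: indS => /(_ x xS)/forall_inP; apply.
have [/existsP[z dz]|/existsPn degD] :=
    boolP [exists z, (Del < #|yes_nbr h setT z|)%N].
  apply: ler_wpDr; first by apply: sumr_ge0 => S' _; exact: set_weight_ge0.
  have nn z' : 0 <= deg_weight 2 h setT z' / 2 ^+ Del.
    by rewrite divr_ge0 ?exprn_ge0 // deg_weight_ge0 // ler1n.
  rewrite (bigD1 z) //=; apply: ler_wpDr; first by apply: sumr_ge0.
  rewrite ler_pdivlMr ?exprn_gt0 // mul1r.
  apply: le_trans (deg_weight_ge _ _ _ _); last by rewrite ler1n.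
  by rewrite ler_weXn2l ?ler1n // ltnW.
apply: ler_wpDl.
  by apply: sumr_ge0 => z _; rewrite divr_ge0 ?exprn_ge0 // deg_weight_ge0 // ler1n.
rewrite (bigD1 T) /= ?sT //; apply: ler_wpDr.
  by apply: sumr_ge0 => S' _; exact: set_weight_ge0.
by apply: set_weight_ge1 => // z; rewrite leqNgt.
Qed.

Lemma decider_potential_nil k : decider_potential k [::] =
  n%:R * (1 + p) ^+ n / 2 ^+ Del +
  'C(n, s)%:R * ((1 - p) ^+ 'C(s, 2) *
    ((1 + p * (light_base - 1)) ^+ s +
     expR (- K) * (1 + p * (heavy_base - 1)) ^+ s) ^+ (n - s)).
Proof.
have g0 : graph [::] = set0 :> {set {set 'I_n}} by apply/setP => e; rewrite !inE.
have f0 : forbidden [::] = set0 :> {set {set 'I_n}}.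
  by apply/setP => e; rewrite !inE.
have yes0 S z : #|yes_nbr [::] S z| = 0.
  by apply/eqP; rewrite cards_eq0; apply/eqP/setP => w; rewrite in_yes_nbr g0 !in_set0 andbF.
have free0 S z : #|free_nbr [::] S z| = #|S|.
  by apply: eq_card => w; rewrite in_free_nbr f0 in_set0 andbT.
have dw a S z : deg_weight a [::] S z = (1 + p * (a - 1)) ^+ #|S|.
  by rewrite /deg_weight yes0 free0 expr0 mul1r.
rewrite /decider_potential; congr (_ + _).
  rewrite -mulr_suml; congr (_ / _).
  under eq_bigr do rewrite dw cardsT card_ord.
  by rewrite sumr_const card_ord mulr_natl; congr ((_ + _) ^+ _ *+ _); ring.
rewrite (eq_bigr (fun=> (1 - p) ^+ 'C(s, 2) *
    ((1 + p * (light_base - 1)) ^+ s +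
     expR (- K) * (1 + p * (heavy_base - 1)) ^+ s) ^+ (n - s))); last first.
  move=> S /eqP cS; rewrite /set_weight /inner_weight.
  have -> : edges_in (graph [::]) S == set0.
    by apply/eqP/setP => e; rewrite in_edges_in g0 !in_set0.
  have -> : #|free_pairs [::] S| = 'C(s, 2).
    rewrite -cS -cards_draws; apply: eq_card => e.
    by rewrite in_free_pairs f0 !inE andbT andbC.
  rewrite mul1r; congr (_ * _); under eq_bigr do rewrite /vertex_weight !dw cS.
  by rewrite prodr_const cardsCs setCK cS card_ord.
rewrite sumr_const mulr_natl; congr (_ *+ _).
by rewrite -[in RHS](card_ord n) -card_draws; apply: eq_card => S; rewrite !inE.
Qed.

Definition yes_weight (u : bool) : R := if u then p else 1 - p.

Lemma decider_seeded_wins (q : proposer n) :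
  1 - decider_potential 'C(n, 2) [::] <=
  \sum_(x : seeds bool 'C(n, 2)) seed_weight yes_weight x *
    (decider_wins s q (seeded_decider true (fun _ u => u) x))%:R.
Proof.
apply: (@seeded_decider_wins R bool true yes_weight n s _ _ (@wf n)
  decider_potential).
- by case; rewrite /yes_weight ?yes_prob_ge0 // subr_ge0 yes_prob_le1.
- by rewrite big_bool /= addrC subrK.
- exact: wf_nil.
- by move=> h _; exact: decider_potential_ge0.
- by move=> k h.
- by move=> h u wh oh; apply: wf_rcons => //; exact: propose_legal.
- move=> k h wh oh; rewrite big_bool /= decider_potential_step //.
  exact: propose_legal.
- by move=> h S wh oh; exact: decider_potential_lost.
Qed.

End DeciderPotential.

(** * Estimating the initial value of Decider's potential *)

Section DeciderAsymptotics.

Variable R : realType.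

Lemma expR_le_inv (y : R) : y < 1 -> expR y <= (1 - y)^-1.
Proof.
move=> y1; rewrite -[y in expR y]opprK expRN lef_pV2 ?posrE ?expR_gt0 ?subr_gt0 //.
exact: expR_ge1Dx.
Qed.

Lemma expR_le_1D2 (y : R) : 0 <= y -> y <= 2^-1 -> expR y <= 1 + 2 * y.
Proof.
move=> y0 y1; apply: le_trans (expR_le_inv _) _; first by lra.
by rewrite -[_^-1]mul1r ler_pdivrMr; nra.
Qed.

Lemma exprD1_le_expR (y : R) m : 0 <= y -> (1 + y) ^+ m <= expR (y * m%:R).
Proof. by move=> y0; rewrite expRM_natr lerXn2r ?nnegrE ?addr_ge0 ?expR_ge0 // expR_ge1Dx. Qed.

(** The exponent 11/10 bounds that of [heavy_base], which is 1 + lam Del / 2. A quarter of it is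
    small enough for 1 / (1 - y), which gives 40/29, and the fourth power of 40/29 is below 4. *)
Lemma expR_11_10 : expR (11 / 10 : R) <= 4.
Proof.
have h : expR (11 / 40 : R) <= 40 / 29.
  have <- : (1 - 11 / 40)^-1 = 40 / 29 :> R by field.
  by apply: expR_le_inv; lra.
have -> : 11 / 10 = 11 / 40 + 11 / 40 + (11 / 40 + 11 / 40) :> R by field.
rewrite !expRD; have := expR_ge0 (11 / 40 : R); move: (expR _) h => y h y0.
have y2 : y * y <= 2 by nra.
have : 0 <= y * y by nra.
by nra.
Qed.

Lemma bin_le_exp n s : ('C(n, s) <= n ^ s)%N.
Proof.
rewrite bin_ffactd; apply: leq_trans (leq_div _ _) _.
by elim: s n => [|s IH] n; rewrite ?ffactn0 // ffactnSr expnSr leq_mul // leq_subr.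
Qed.

Lemma ln2_gt0 : 0 < ln 2 :> R.
Proof. by rewrite ln_gt0 // ltr1n. Qed.

Lemma ln2_le1 : ln 2 <= 1 :> R.
Proof.
rewrite -ler_expR lnK ?posrE //; apply: le_trans (expR_ge1Dx 1).
by rewrite -natr1.
Qed.

Lemma ln_le_log2 (x : R) : 1 <= x -> ln x <= log2 x.
Proof.
move=> x1; rewrite /log2 ler_pdivlMr ?ln2_gt0 //.
by rewrite ler_piMr ?ln2_le1 // ln_ge0.
Qed.

Lemma yes_prob_le (lam : R) : yes_prob lam <= lam.
Proof. by rewrite /yes_prob; have := expR_ge1Dx (- lam); lra. Qed.

Variables (n s : nat).
Hypothesis n4 : (4 <= n)%N.
Let sq : R := Num.sqrt n%:R.
Hypothesis sle : 1000 * sq * log2 (n%:R : R) <= s%:R.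

Definition decider_rate : R := (10 * Num.sqrt n%:R)^-1.
Local Notation lam := decider_rate.
Let T : R := lam * s%:R.
Let L : R := ln n%:R.

Let n_gt0 : 0 < n%:R :> R. Proof. by rewrite ltr0n; lia. Qed.
Let sq_ge2 : 2 <= sq.
Proof.
have -> : 2 = Num.sqrt (2 ^+ 2) :> R by rewrite sqrtr_sqr ger0_norm.
by rewrite ler_sqrt // -natrX ler_nat.
Qed.
Let sqE : sq ^+ 2 = n%:R. Proof. by rewrite sqr_sqrtr ?ltW. Qed.
Let L_ge1 : 1 <= L.
Proof.
rewrite -ler_expR lnK ?posrE //; apply: le_trans (_ : expR (11 / 10) <= _).
  by rewrite ler_expR; lra.
by apply: le_trans expR_11_10 _; rewrite ler_nat.
Qed.
Let lam_gt0 : 0 < lam.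
Proof. by have := sq_ge2; rewrite /decider_rate -/sq invr_gt0; lra. Qed.
Let lamE : lam * sq = 10^-1.
Proof. by have := sq_ge2; rewrite /decider_rate -/sq => ?; field; lra. Qed.
Let T_ge : 100 * L <= T.
Proof.
have q2 := sq_ge2; have h1 : 1000 * sq * L <= s%:R.
  apply: le_trans sle; apply: ler_wpM2l; first by nra.
  by apply: ln_le_log2; rewrite ler1n; lia.
have := ler_wpM2l (ltW lam_gt0) h1; rewrite -/T.
have -> : lam * (1000 * sq * L) = 1000 * (lam * sq) * L by ring.
by rewrite lamE; lra.
Qed.
Let s_ge : 1000 <= s%:R :> R.
Proof.
have q2 := sq_ge2; have l1 := L_ge1.
apply: le_trans sle; have := @ln_le_log2 n%:R; rewrite ler1n -/L.
move=> /(_ ltac:(lia)) lgL; apply: le_trans (_ : 1000 * 2 * 1 <= _); first lra.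
by apply: ler_pM; lra.
Qed.

(** Expected degrees are at most lam n = sq / 10, so this cap lies far in the tail, while lam Del <=
    1/5 keeps [heavy_base] bounded. *)
Let Del := Num.truncn (2 * sq).
Let Del_le : Del%:R <= 2 * sq.
Proof. by have := sq_ge2; rewrite truncn_le; lra. Qed.
Let Del_ge : sq <= Del%:R.
Proof.
have : 2 * sq < Del.+1%:R by exact: truncnS_gt.
by have := sq_ge2; rewrite -natr1; lra.
Qed.

Let p_ge0 : 0 <= yes_prob lam. Proof. exact/yes_prob_ge0/ltW. Qed.

Lemma degree_term_le :
  n%:R * (1 + yes_prob lam) ^+ n / 2 ^+ Del <= 1000 / n%:R.
Proof.
have [q2 dl dg] := And3 sq_ge2 Del_le Del_ge; have n0 := n_gt0.
(* The remaining decay exp(- 2 sq / 5) has to absorb n^2 = sq^4; one term of the exponential series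
   is enough. *)
have h5 : sq ^+ 4 <= 1000 * expR (2 / 5 * sq).
  have := @expR_ge1Dxn R (2 / 5 * sq) 3 ltac:(lra).
  have -> : (4`!)%:R = 24 :> R by [].
  have -> : (2 / 5 * sq) ^+ 4 / 24 = sq ^+ 4 * (16 / 15000) by field.
  have : 0 <= sq ^+ 4 by rewrite exprn_ge0 //; lra.
  by lra.
have h4 : expR (sq / 2) = expR (sq / 10) * expR (2 / 5 * sq).
  by rewrite -expRD; congr expR; lra.
have E1 := expR_gt0 (sq / 10).
have h1 : (1 + yes_prob lam) ^+ n <= expR (sq / 10).
  apply: le_trans (exprD1_le_expR _ p_ge0) _; rewrite ler_expR.
  have := ler_wpM2r (ltW n_gt0) (yes_prob_le lam).
  have -> : lam * n%:R = (lam * sq) * sq by rewrite -sqE; ring.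
  by rewrite lamE; lra.
have h2 : expR (sq / 2) <= 2 ^+ Del.
  apply: le_trans (_ : expR (2^-1 * Del%:R) <= _); first by rewrite ler_expR; lra.
  rewrite expRM_natr lerXn2r ?nnegrE ?expR_ge0 //.
  have e2 : (1 - 2^-1)^-1 = 2 :> R by field.
  rewrite -[leRHS]e2.
  by apply: expR_le_inv; lra.
have -> : n%:R = sq ^+ 2 by rewrite sqE.
have sq2 : 0 < sq ^+ 2 by rewrite exprn_gt0 //; lra.
rewrite ler_pdivrMr ?exprn_gt0 // [leRHS]mulrAC ler_pdivlMr //.
apply: le_trans (_ : expR (sq / 10) * sq ^+ 4 <= _).
  have -> : sq ^+ 2 * (1 + yes_prob lam) ^+ n * sq ^+ 2 =
    (1 + yes_prob lam) ^+ n * sq ^+ 4 by ring.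
  by apply: ler_wpM2r h1; rewrite exprn_ge0 //; lra.
apply: le_trans (_ : expR (sq / 10) * (1000 * expR (2 / 5 * sq)) <= _).
  by rewrite ler_wpM2l // ltW.
by rewrite mulrCA -h4 ler_wpM2l.
Qed.

(** Since [heavy_base] - 1 is at most 3, the heavy term is at most exp(- K + 3 T) = exp(- T) <= 1/n,
    and over all vertices it contributes at most a factor e. *)
Let K := 4 * T.

Lemma set_term_le : (s <= n)%N ->
  'C(n, s)%:R * ((1 - yes_prob lam) ^+ 'C(s, 2) *
    ((1 + yes_prob lam * (light_base lam K - 1)) ^+ s +
     expR (- K) * (1 + yes_prob lam * (heavy_base lam Del - 1)) ^+ s) ^+ (n - s))
  <= n%:R^-1.
Proof.
have [q2 dl dg] := And3 sq_ge2 Del_le Del_ge; have n0 := n_gt0.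
have [L1 tl sg] := And3 L_ge1 T_ge s_ge; have lg0 := lam_gt0.
move=> sn; have sn' : s%:R <= n%:R :> R by rewrite ler_nat.
have T0 : 0 < T by lra.
have lam0 := ltW lam_gt0.
have lamT : lam * T = s%:R / (100 * n%:R).
  by rewrite /T /decider_rate -/sq -sqE; field; lra.
have lamT_le : lam * T <= 100^-1.
  by rewrite lamT ler_pdivrMr ?mulr_gt0 //; lra.
have light : (1 + yes_prob lam * (light_base lam K - 1)) ^+ s <= expR (4 * (lam * T) * T).
  have l1 : light_base lam K - 1 <= 4 * (lam * T).
    apply: le_trans (_ : 2 * (lam * K / 2) <= _); last by rewrite /K; lra.
    by rewrite lerBlDl; apply: expR_le_1D2; rewrite /K; nra.
  have l0 : 0 <= light_base lam K - 1.
    by rewrite subr_ge0 light_base_ge1 // /K; lra.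
  apply: le_trans (exprD1_le_expR _ (mulr_ge0 p_ge0 l0)) _.
  rewrite ler_expR.
  have -> : 4 * (lam * T) * T = lam * (4 * (lam * T)) * s%:R by rewrite {2}/T; ring.
  rewrite ler_wpM2r //; apply: ler_pM => //; exact: yes_prob_le.
have heavy : expR (- K) * (1 + yes_prob lam * (heavy_base lam Del - 1)) ^+ s <= expR (- T).
  have l1 : heavy_base lam Del - 1 <= 3.
    have : heavy_base lam Del <= expR (11 / 10).
      by rewrite ler_expR; have := ler_wpM2l lam0 Del_le; have := lamE; lra.
    by have := expR_11_10; lra.
  have l0 : 0 <= heavy_base lam Del - 1 by rewrite subr_ge0 heavy_base_ge1.
  apply: le_trans (ler_wpM2l (expR_ge0 _) (exprD1_le_expR _ (mulr_ge0 p_ge0 l0))) _.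
  rewrite -expRD ler_expR /K.
  have : yes_prob lam * (heavy_base lam Del - 1) * s%:R <= lam * 3 * s%:R.
    by rewrite ler_wpM2r //; apply: ler_pM => //; exact: yes_prob_le.
  by rewrite /T; lra.
have eT : expR (- T) <= n%:R^-1.
  by rewrite -[n%:R^-1]lnK ?posrE ?invr_gt0 // ler_expR lnV ?posrE // -/L; lra.
have bracket : ((1 + yes_prob lam * (light_base lam K - 1)) ^+ s +
     expR (- K) * (1 + yes_prob lam * (heavy_base lam Del - 1)) ^+ s) ^+ (n - s)
     <= expR (s%:R * T / 25 + 1).
  set A := (X in X ^+ (n - s)).
  have A1 : A <= expR (4 * (lam * T) * T + n%:R^-1).
    apply: le_trans (_ : expR (4 * (lam * T) * T) * (1 + n%:R^-1) <= _).
      rewrite mulrDr mulr1 lerD //; apply: le_trans heavy _.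
      apply: le_trans eT _; apply: ler_peMl; first by rewrite invr_ge0 ltW.
      by rewrite leNgt expR_lt1 -leNgt !mulr_ge0 // ltW.
    by rewrite expRD ler_wpM2l ?expR_ge0 // expR_ge1Dx.
  have A0 : 0 <= A.
    rewrite addr_ge0 ?mulr_ge0 ?expR_ge0 ?exprn_ge0 // addr_ge0 // mulr_ge0 //.
      by rewrite subr_ge0 light_base_ge1 // /K; lra.
    by rewrite subr_ge0 heavy_base_ge1.
  apply: le_trans (_ : expR (4 * (lam * T) * T + n%:R^-1) ^+ (n - s) <= _).
    by rewrite lerXn2r ?nnegrE ?expR_ge0.
  rewrite -expRM_natr ler_expR.
  apply: le_trans (_ : (4 * (lam * T) * T + n%:R^-1) * n%:R <= _).
    apply: ler_wpM2l; last by rewrite ler_nat leq_subr.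
    by rewrite addr_ge0 ?invr_ge0 // !mulr_ge0 // ltW.
  rewrite mulrDl mulVf ?gt_eqF // lamT lerD2r.
  have -> : 4 * (s%:R / (100 * n%:R)) * T * n%:R = s%:R * T / 25.
    by field; rewrite gt_eqF.
  by [].
have bound : 'C(n, s)%:R <= expR (L * s%:R).
  rewrite expRM_natr lnK ?posrE // -natrX ler_nat; exact: bin_le_exp.
rewrite no_probE -expRM_natr natr_bin2.
apply: le_trans (_ : expR (L * s%:R) * (expR (- lam * (s%:R * (s%:R - 1) / 2)) *
   expR (s%:R * T / 25 + 1)) <= _).
  apply: ler_pM => //; last by rewrite ler_wpM2l ?expR_ge0.
  rewrite mulr_ge0 ?expR_ge0 // exprn_ge0 // addr_ge0 // ?mulr_ge0 ?expR_ge0 //.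
  - rewrite exprn_ge0 // addr_ge0 // mulr_ge0 // subr_ge0 light_base_ge1 // /K; lra.
  - by rewrite exprn_ge0 // addr_ge0 // mulr_ge0 // subr_ge0 heavy_base_ge1.
(* The exponent is L s - T (s - 1) / 2 + s T / 25 + 1. The gain of about s T / 2 from refusals beats
   both the choice of the set, L s <= s T / 100, and the light terms, n times 4 lam T^2, which is s
   T / 25. *)
rewrite -!expRD -[n%:R^-1]lnK ?posrE ?invr_gt0 // ler_expR lnV ?posrE // -/L.
have -> : - lam * (s%:R * (s%:R - 1) / 2) = - (T * (s%:R - 1) / 2) by rewrite /T; ring.
have : L * s%:R <= T / 100 * s%:R by rewrite ler_wpM2r //; lra.
have : 1000 * T <= s%:R * T by rewrite ler_wpM2r // ltW.
by lra.
Qed.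

Lemma decider_potential_nil_le k :
  decider_potential s lam K Del k ([::] : history n) <= 1001 / n%:R.
Proof.
rewrite decider_potential_nil.
have -> : 1001 / n%:R = 1000 / n%:R + n%:R^-1 :> R by field; rewrite gt_eqF.
apply: lerD; first exact: degree_term_le.
have [sn|ns] := leqP s n; first exact: set_term_le.
by rewrite bin_small // mul0r invr_ge0 ltW.
Qed.

Lemma decider_rate_wins (q : proposer n) :
  1 - 1001 / n%:R <=
  \sum_(x : seeds bool 'C(n, 2)) seed_weight (yes_weight lam) x *
    (decider_wins s q (seeded_decider true (fun _ u => u) x))%:R.
Proof.
have K0 : 0 <= K by have := L_ge1; have := T_ge; rewrite /K; lra.
have := decider_seeded_wins s Del (ltW lam_gt0) K0 q.
by apply: le_trans; rewrite lerD2l lerN2 decider_potential_nil_le.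
Qed.

End DeciderAsymptotics.

Section DeciderStrategy.

Variable R : realType.

Lemma decider_rate_ge0 n : 0 <= decider_rate R n.
Proof. by rewrite invr_ge0 mulr_ge0 ?sqrtr_ge0. Qed.

Lemma yes_weight_ge0 (lam : R) u : 0 <= lam -> 0 <= yes_weight lam u.
Proof.
by case: u => lam0; rewrite /yes_weight ?yes_prob_ge0 // subr_ge0 yes_prob_le1.
Qed.

Lemma yes_weight_sum1 (lam : R) : \sum_u yes_weight lam u = 1.
Proof. by rewrite big_bool /= addrC subrK. Qed.

Definition decider_strategy n : randomized R (decider n) :=
  seeded (fun u => yes_weight_ge0 u (decider_rate_ge0 n)) (yes_weight_sum1 _)
    (seeded_decider true (fun (_ : history n) u => u) (k := 'C(n, 2))).

Lemma decider_strategy_wins (eps : R) : 0 < eps ->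
  exists N, forall n, (N <= n)%N -> forall s : nat,
    1000 * Num.sqrt n%:R * log2 (n%:R : R) <= s%:R ->
    forall P : randomized R (proposer n),
      1 - eps <= prob P (decider_strategy n) (@decider_wins n s).
Proof.
move=> eps0; exists (maxn 4 (Num.truncn (1001 / eps)).+1) => n.
rewrite geq_max => /andP[n4 nN] s hs P; apply: prob_ge_right => q.
apply: le_trans (decider_rate_wins n4 hs q).
rewrite lerD2l lerN2 ler_pdivrMr ?ltr0n; last by lia.
rewrite mulrC -ler_pdivrMr //; apply/ltW.
by apply: lt_le_trans (truncnS_gt _) _; rewrite ler_nat.
Qed.

End DeciderStrategy.

(** * Proposer's strategy *)

Section RandomSubset.

Variables (R : realFieldType) (T : finType) (B : {set T}) (k : nat).
Implicit Types (A N : {set T}) (H : {set {set T}}).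
Hypothesis kB : (k <= #|B|)%N.

Definition ksubsets := [set N : {set T} | (N \subset B) && (#|N| == k)].

Lemma in_ksubsets N : (N \in ksubsets) = (N \subset B) && (#|N| == k).
Proof. by rewrite in_set. Qed.

Lemma card_ksubsets : #|ksubsets| = 'C(#|B|, k).
Proof. exact: cards_draws. Qed.

Lemma card_ksubsets_sup A : A \subset B -> (#|A| <= k)%N ->
  #|[set N in ksubsets | A \subset N]| = 'C(#|B| - #|A|, k - #|A|).
Proof.
move=> AB Ak; have -> : (#|B| - #|A| = #|B :\: A|)%N.
  by rewrite cardsD (setIidPr AB).
rewrite -cards_draws -[RHS](@card_in_imset _ _ (fun N => A :|: N)); last first.
  move=> M N; rewrite !in_set !subsetD => /andP[/andP[_ MA] _] /andP[/andP[_ NA] _].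
  move=> eMN; have dif (X : {set T}) : [disjoint X & A] -> (A :|: X) :\: A = X.
    by move=> XA; rewrite setDUl setDv set0U; apply/setDidPl.
  by rewrite -(dif M) // -(dif N) // eMN.
apply: eq_card => N; rewrite in_set in_ksubsets; apply/idP/imsetP.
  move=> /andP[/andP[NB /eqP Nk] AN]; exists (N :\: A).
    rewrite in_set setSD //= cardsD (setIidPr AN) Nk eqxx //.
  apply/setP => x; rewrite in_setU in_setD.
  by case xA: (x \in A) => //=; rewrite (subsetP AN).
move=> [M]; rewrite in_set subsetD => /andP[/andP[MB MA] /eqP Mk] ->.
rewrite subsetUl andbT subUset AB MB /= cardsU.
have /eqP -> : A :&: M == set0 by rewrite setI_eq0 disjoint_sym.
by rewrite cards0 Mk subn0 subnKC.
Qed.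

(** The probability that a uniform [k]-subset of [B] contains a given [a]-subset. *)
Definition sup_freq (a : nat) : R := 'C(#|B| - a, k - a)%:R / 'C(#|B|, k)%:R.

Lemma bin_gt0R : 0 < 'C(#|B|, k)%:R :> R.
Proof. by rewrite ltr0n bin_gt0. Qed.

Lemma sup_freq_ge0 a : 0 <= sup_freq a.
Proof. by rewrite divr_ge0. Qed.

Lemma sup_freqS a : (a < k)%N ->
  sup_freq a.+1 = sup_freq a * ((k - a)%:R / (#|B| - a)%:R).
Proof.
move=> ak; rewrite /sup_freq mulrAC; congr (_ / _).
have := mul_bin_diag (#|B| - a) (k - a.+1).
have -> : ((#|B| - a).-1 = #|B| - a.+1)%N by lia.
have -> : ((k - a.+1).+1 = k - a)%N by lia.
move=> /(congr1 (fun m => m%:R : R)); rewrite !natrM => E.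
have Ba : (#|B| - a)%:R != 0 :> R by rewrite pnatr_eq0; lia.
by apply: (mulfI Ba); rewrite E; field.
Qed.

Lemma sup_freq0 : sup_freq 0 = 1.
Proof. by rewrite /sup_freq !subn0 divff // gt_eqF // bin_gt0R. Qed.

Hypothesis k2 : (2 <= k)%N.

Let b2 : (2 <= #|B|)%N. Proof. exact: leq_trans kB. Qed.

Lemma sup_freq2 :
  sup_freq 2 = k%:R * (k%:R - 1) / (#|B|%:R * (#|B|%:R - 1)).
Proof.
rewrite !sup_freqS ?sup_freq0 //; last by lia.
rewrite !subn0 mul1r !natrB //; [|lia..].
have b0 : #|B|%:R != 0 :> R by rewrite pnatr_eq0; have := b2; lia.
have b1 : #|B|%:R - 1 != 0 :> R.
  by rewrite subr_eq0 (eqr_nat R _ 1); have := b2; lia.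
by field; rewrite b0 b1.
Qed.

Lemma ratio_sub_le a : (a < k)%N ->
  (k - a)%:R / (#|B| - a)%:R <= k%:R / #|B|%:R :> R.
Proof.
move=> ak; rewrite ler_pdivrMr ?ltr0n; last by lia.
rewrite mulrAC ler_pdivlMr ?ltr0n; last by lia.
by rewrite -!natrM ler_nat; nia.
Qed.

Lemma ratio1_sub_le a : (a.+1 < k)%N ->
  (k - a.+1)%:R / (#|B| - a.+1)%:R <= (k%:R - 1) / (#|B|%:R - 1) :> R.
Proof.
move=> ak; rewrite -!(natrB R (n := 1)); [|lia..].
rewrite ler_pdivrMr ?ltr0n; last by lia.
rewrite mulrAC ler_pdivlMr ?ltr0n; last by lia.
by rewrite -!natrM ler_nat; nia.
Qed.

Variable H : {set {set T}}.
Hypothesis H2 : forall e, e \in H -> #|e| = 2.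
Hypothesis HB : forall e, e \in H -> e \subset B.

Definition covered N := #|[set e in H | e \subset N]|.

Lemma coveredE N : (covered N)%:R = \sum_(e in H) (e \subset N)%:R :> R.
Proof.
rewrite /covered -sum1_card natr_sum big_mkcond [RHS]big_mkcond /=.
by apply: eq_bigr => e _; rewrite inE; case: (e \in H); case: (_ \subset _).
Qed.

Lemma sum_sup A : A \subset B -> (#|A| <= k)%N ->
  \sum_(N in ksubsets) (A \subset N)%:R = 'C(#|B|, k)%:R * sup_freq #|A| :> R.
Proof.
move=> AB Ak; rewrite /sup_freq mulrCA mulfV ?gt_eqF ?bin_gt0R // mulr1.
rewrite -card_ksubsets_sup // -sum1_card natr_sum big_mkcond [RHS]big_mkcond /=.
apply: eq_bigr => N _; rewrite [in RHS]in_set.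
by case: (N \in ksubsets); case: (_ \subset _).
Qed.

Definition mean_covered : R := #|H|%:R * sup_freq 2.

Lemma sum_covered : \sum_(N in ksubsets) (covered N)%:R =
  'C(#|B|, k)%:R * mean_covered :> R.
Proof.
under eq_bigr do rewrite coveredE.
rewrite exchange_big /= (eq_bigr (fun=> 'C(#|B|, k)%:R * sup_freq 2)).
  by rewrite sumr_const /mean_covered [RHS]mulrCA [RHS]mulr_natl.
by move=> e eH; have := sum_sup (HB eH); rewrite (H2 eH) => /(_ k2).
Qed.

Hypothesis k4 : (4 <= k)%N.

Lemma card_meet1 e : e \in H ->
  (#|[set f in H | #|e :&: f| == 1]| <= 2 * #|B|)%N.
Proof.
move=> eH; rewrite -[X in (X * _)%N](H2 eH) -cardsX.
apply: leq_trans (leq_imset_card (fun p => [set p.1; p.2]) _).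
apply/subset_leq_card/subsetP => f /setIdP[fH /cards1P[x ex]].
have /setIP[xe xf] : x \in e :&: f by rewrite ex set11.
have : #|f :\ x| == 1 by have := cardsD1 x f; rewrite xf (H2 fH) add1n => -[<-].
case/cards1P => w fw; apply/imsetP; exists (x, w) => /=.
  rewrite in_setX xe /=; apply: (subsetP (HB fH)).
  have : w \in f :\ x by rewrite fw set11.
  by rewrite in_setD1 => /andP[].
by rewrite -fw setD1K.
Qed.

(** Disjoint pairs are negatively correlated under sampling without replacement, so the square
    suffices for them; the other two terms pay for equal pairs and for pairs sharing one vertex. *)
Lemma pair_freq_le e f : e \in H -> f \in H ->
  sup_freq #|e :|: f| <= sup_freq 2 ^+ 2 + (e == f)%:R * sup_freq 2 +
    (#|e :&: f| == 1)%:R * (sup_freq 2 * (k%:R / #|B|%:R)).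
Proof.
move=> eH fH; have := cardsUI e f; rewrite (H2 eH) (H2 fH) => cUI.
have p2 := sup_freq_ge0 2; have kb : 0 <= k%:R / #|B|%:R :> R by rewrite divr_ge0.
have [ef|nef] := eqVneq e f.
  rewrite -ef setUid (H2 eH) mul1r addrAC lerDr addr_ge0 ?exprn_ge0 //.
  by apply: mulr_ge0 => //; apply: mulr_ge0.
have cI : (#|e :&: f| < 2)%N.
  rewrite -[X in (_ < X)%N](H2 eH) ltn_neqAle subset_leq_card ?subsetIl // andbT.
  apply/eqP => cE; have : e :&: f == e by rewrite eqEcard subsetIl cE leqnn.
  move/eqP/setIidPl => ef; move: nef.
  by rewrite eqEcard ef (H2 eH) (H2 fH).
have [c1|c0] : #|e :&: f| = 1 \/ #|e :&: f| = 0 by lia.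
  have -> : #|e :|: f| = 3 by lia.
  rewrite c1 mul0r addr0 mul1r (@sup_freqS 2); last by lia.
  apply: ler_wpDl; first exact: exprn_ge0.
  by apply: ler_wpM2l => //; apply: ratio_sub_le; lia.
have -> : #|e :|: f| = 4 by lia.
rewrite c0 !mul0r !addr0 (@sup_freqS 3) ?(@sup_freqS 2); [|lia..].
rewrite expr2 -mulrA; apply: ler_wpM2l => //.
rewrite sup_freq2 invfM [leRHS]mulrACA.
by apply: ler_pM; rewrite ?divr_ge0 //; [apply: ratio_sub_le|apply: ratio1_sub_le]; lia.
Qed.

(** Equal pairs cost one mean. Each pair meets at most 2 |B| others in one vertex, each at relative
    cost k / |B|, which adds 2 k means. The variance is thus at most (2 k + 1) times the mean. *)
Lemma sum_covered_sq : \sum_(N in ksubsets) (covered N)%:R ^+ 2 <=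
  'C(#|B|, k)%:R * (mean_covered ^+ 2 + mean_covered * (2 * k%:R + 1)) :> R.
Proof.
have -> : \sum_(N in ksubsets) (covered N)%:R ^+ 2 =
    \sum_(e in H) \sum_(f in H) 'C(#|B|, k)%:R * sup_freq #|e :|: f| :> R.
  transitivity (\sum_(N in ksubsets) \sum_(e in H) \sum_(f in H)
      (e :|: f \subset N)%:R : R).
    apply: eq_bigr => N _; rewrite expr2 {1}coveredE mulr_suml.
    apply: eq_bigr => e _; rewrite coveredE mulr_sumr; apply: eq_bigr => f _.
    by rewrite -natrM mulnb subUset.
  rewrite exchange_big; apply: eq_bigr => e eH.
  rewrite exchange_big; apply: eq_bigr => f fH.
  rewrite sum_sup // ?subUset ?HB //.
  by apply: leq_trans k4; have := cardsUI e f; rewrite (H2 eH) (H2 fH); lia.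
under eq_bigr do rewrite -mulr_sumr.
rewrite -mulr_sumr; apply: ler_wpM2l => //.
have p2 := sup_freq_ge0 2.
apply: le_trans (_ : \sum_(e in H) (#|H|%:R * sup_freq 2 ^+ 2 + sup_freq 2 +
  sup_freq 2 * (2 * k%:R)) <= _); last first.
  rewrite sumr_const /mean_covered -[leLHS]mulr_natl le_eqVlt; apply/orP; left.
  by apply/eqP; ring.
apply: ler_sum => e eH.
apply: le_trans (ler_sum _ (fun f fH => pair_freq_le eH fH)) _.
rewrite !big_split /=; apply: lerD; first apply: lerD.
- by rewrite sumr_const mulr_natl.
- rewrite -mulr_suml (bigD1 e) //= eqxx big1 ?addr0 ?mul1r //.
  by move=> f /andP[_]; rewrite eq_sym => /negbTE->.
rewrite -mulr_suml.
have b0 : 0 < #|B|%:R :> R by rewrite ltr0n; have := b2; lia.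
have -> : \sum_(f in H) (#|e :&: f| == 1)%:R = #|[set f in H | #|e :&: f| == 1]|%:R :> R.
  rewrite -sum1_card natr_sum big_mkcond [RHS]big_mkcond /=.
  by apply: eq_bigr => f _; rewrite inE; case: (f \in H); case: (_ == _).
rewrite mulrCA; apply: ler_wpM2l => //.
rewrite mulrA ler_pdivrMr // -!natrM ler_nat mulnAC.
by rewrite leq_mul2r card_meet1 // orbT.
Qed.

Lemma chebyshev_covered (q : nat) : 0 < mean_covered -> 2 * q%:R <= mean_covered ->
  #|[set N in ksubsets | (covered N < q)%N]|%:R / 'C(#|B|, k)%:R <=
  4 * (2 * k%:R + 1) / mean_covered.
Proof.
set mu := mean_covered => mu0 qmu.
have C0 := bin_gt0R.
have dev : \sum_(N in ksubsets) ((covered N)%:R - mu) ^+ 2 <=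
    'C(#|B|, k)%:R * (mu * (2 * k%:R + 1)).
  rewrite (eq_bigr (fun N => (covered N)%:R ^+ 2 + (mu ^+ 2 - 2 * mu * (covered N)%:R))).
    rewrite big_split /= sumrB -[X in _ - X]mulr_sumr sum_covered sumr_const.
    rewrite card_ksubsets -[X in _ + (X - _)]mulr_natl -/mu.
    have := sum_covered_sq; rewrite -/mu.
    by set c := 'C(_, _)%:R; set S := \sum_(_ in _) _; nra.
  by move=> N _; ring.
have low : #|[set N in ksubsets | (covered N < q)%N]|%:R * (mu / 2) ^+ 2 <=
    \sum_(N in ksubsets) ((covered N)%:R - mu) ^+ 2.
  rewrite mulr_natl -sumr_const big_mkcond [leRHS]big_mkcond /=; apply: ler_sum => N _.
  rewrite in_set; case: (N \in ksubsets) => //=; case: ifP => [cq|_]; last exact: sqr_ge0.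
  have cq' : (covered N)%:R <= q%:R :> R by rewrite ler_nat ltnW.
  by nra.
rewrite ler_pdivrMr // mulrAC ler_pdivlMr //.
have := le_trans low dev; set x := #|_|%:R; set c := 'C(_, _)%:R; nra.
Qed.

End RandomSubset.

(** * Random neighbourhoods revealed one vertex at a time *)

Section CompletionProbability.

Variables (R : realFieldType) (T : finType) (bad : {set T} -> bool).
Implicit Types (N X : {set T}).

Definition bad_completions N X m :=
  [set Q in ksubsets X m | bad (N :|: Q)].

(* The probability that [N], completed by a uniformly random [m]-subset of [X],
   is bad; it is [0] when [m] exceeds the cardinal of [X]. *)
Definition bad_freq N X m : R :=
  #|bad_completions N X m|%:R / 'C(#|X|, m)%:R.

Lemma bad_freq_ge0 N X m : 0 <= bad_freq N X m.
Proof. by rewrite divr_ge0. Qed.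

Lemma in_bad_completions N X m Q : (Q \in bad_completions N X m) =
  [&& Q \subset X, #|Q| == m & bad (N :|: Q)].
Proof. by rewrite in_set in_ksubsets andbA. Qed.

Lemma bad_freq0 N X : bad_freq N X 0 = (bad N)%:R.
Proof.
rewrite /bad_freq bin0 divr1; congr _%:R.
have [bN|nbN] := boolP (bad N).
  apply/eqP/cards1P; exists set0; apply/setP => Q.
  rewrite in_bad_completions in_set1 cards_eq0.
  by case: eqP => [->|]; rewrite ?andbF // sub0set setU0 bN.
apply/eqP; rewrite cards_eq0; apply/eqP/setP => Q.
rewrite in_bad_completions in_set0 cards_eq0.
by case: eqP => [->|]; rewrite ?andbF // setU0 (negbTE nbN) !andbF.
Qed.

Lemma sum_card_mem (I : finType) (X : {set I}) (F : {set {set I}}) :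
  (\sum_(x in X) #|[set Q in F | x \in Q]| = \sum_(Q in F) #|Q :&: X|)%N.
Proof.
rewrite (eq_bigr (fun x => \sum_(Q in F) (x \in Q : nat))%N); last first.
  move=> x _; rewrite -sum1_card big_mkcond [RHS]big_mkcond /=.
  by apply: eq_bigr => Q _; rewrite inE; case: (_ \in F); case: (_ \in _).
rewrite exchange_big; apply: eq_bigr => Q _.
rewrite -sum1_card big_mkcond [RHS]big_mkcond /=.
by apply: eq_bigr => x _; rewrite in_setI; case: (x \in X); case: (x \in Q).
Qed.

(** Double counting of the pairs (w, Q) with [w] in a bad completion [Q] of size m + 1. *)
Lemma sum_completions_yes N X m :
  (\sum_(w in X) #|bad_completions (w |: N) (X :\ w) m| =
   m.+1 * #|bad_completions N X m.+1|)%N.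
Proof.
rewrite mulnC -sum_nat_const.
rewrite (eq_bigr (fun w => #|[set Q in bad_completions N X m.+1 | w \in Q]|)).
  rewrite sum_card_mem; apply: eq_bigr => Q.
  by rewrite in_bad_completions => /and3P[/setIidPl -> /eqP].
move=> w wX; rewrite -(@card_in_imset _ _ (fun Q => w |: Q)) /=; last first.
  move=> P Q; rewrite !in_bad_completions !subsetD1.
  move=> /andP[/andP[_ wP] _] /andP[/andP[_ wQ] _] e.
  by rewrite -(setU1K wP) -(setU1K wQ) e.
apply: eq_card => Q; rewrite in_set in_bad_completions; apply/imsetP/idP.
  move=> [P]; rewrite in_bad_completions subsetD1.
  move=> /and3P[/andP[PX wP] /eqP Pm bP] ->.
  rewrite setU11 subUset sub1set wX PX cardsU1 wP Pm eqxx /= andbT.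
  by rewrite setUCA setUA.
move=> /andP[/and3P[QX /eqP Qm bQ] wQ]; exists (Q :\ w); last by rewrite setD1K.
rewrite in_bad_completions setSD // -setUA setUCA setD1K // bQ andbT.
by have := cardsD1 w Q; rewrite wQ Qm add1n => -[<-]; rewrite eqxx.
Qed.

Lemma sum_completions_no N X m :
  (\sum_(w in X) #|bad_completions N (X :\ w) m| =
   (#|X| - m) * #|bad_completions N X m|)%N.
Proof.
rewrite mulnC -sum_nat_const.
transitivity (\sum_(w in X) \sum_(Q in bad_completions N X m) (w \notin Q : nat))%N.
  apply: eq_bigr => w wX; rewrite -sum1_card big_mkcond [RHS]big_mkcond /=.
  apply: eq_bigr => Q _; rewrite !in_bad_completions subsetD1.
  by case: (Q \subset X); case: (w \in Q); case: (_ == m); case: (bad _).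
rewrite exchange_big; apply: eq_bigr => Q.
rewrite in_bad_completions => /and3P[QX /eqP <- _].
rewrite -[#|Q|](congr1 (fun S : {set T} => #|S|) (setIidPr QX)) -cardsD.
rewrite -sum1_card big_mkcond [RHS]big_mkcond /=.
by apply: eq_bigr => x _; rewrite in_setD; case: (x \in X); case: (x \in Q).
Qed.

(** [c] and [d] will be binomials, which may vanish; they then vanish together, and inverses of 0
    are 0. *)
Lemma weighted_ratio (r a c d x : R) : 0 < r -> a != 0 -> r * d = a * c ->
  a * x / d = r * (x / c).
Proof.
move=> r0 a0 e; have [c0|c0] := eqVneq c 0.
  have /eqP : r * d = 0 by rewrite e c0 mulr0.
  by rewrite mulf_eq0 gt_eqF //= c0 => /eqP ->; rewrite !invr0 !mulr0.
have d0 : d != 0.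
  by apply: contra_eq_neq e => ->; rewrite mulr0 eq_sym mulf_neq0.
apply: (mulIf d0); apply: (mulIf c0); rewrite divfK //.
have -> : r * (x / c) * d * c = r * d * x * (c / c) by ring.
by rewrite e divff // mulr1; ring.
Qed.

(** A uniform [w] followed by a uniform [m]-subset of the rest is a uniform (m + 1)-subset. With
    [bad_freq_no] this shows that Decider cannot bias the hits by timing the YES answers. *)
Lemma bad_freq_yes N X m : (0 < #|X|)%N ->
  \sum_(w in X) bad_freq (w |: N) (X :\ w) m = #|X|%:R * bad_freq N X m.+1.
Proof.
move=> X0; have cD w : w \in X -> #|X :\ w| = #|X|.-1.
  by move=> wX; rewrite [in RHS](cardsD1 w) wX.
rewrite (eq_bigr (fun w => #|bad_completions (w |: N) (X :\ w) m|%:R /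
  'C(#|X|.-1, m)%:R)); last by move=> w wX; rewrite /bad_freq cD.
rewrite -mulr_suml -natr_sum sum_completions_yes natrM /bad_freq.
apply: weighted_ratio; rewrite ?ltr0n ?pnatr_eq0 //.
by rewrite -natrM mul_bin_diag natrM.
Qed.

(** After a uniform vertex is discarded, a uniform [m]-subset of the rest is still uniform in [X].
    Equality can fail only when [m] is at least the size of [X], where the left side is 0. *)
Lemma bad_freq_no N X m : (0 < #|X|)%N ->
  \sum_(w in X) bad_freq N (X :\ w) m <= #|X|%:R * bad_freq N X m.
Proof.
move=> X0; have cD w : w \in X -> #|X :\ w| = #|X|.-1.
  by move=> wX; rewrite [in RHS](cardsD1 w) wX.
rewrite (eq_bigr (fun w => #|bad_completions N (X :\ w) m|%:R /
  'C(#|X|.-1, m)%:R)); last by move=> w wX; rewrite /bad_freq cD.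
rewrite -mulr_suml -natr_sum sum_completions_no natrM /bad_freq.
have [mX|Xm] := ltnP m #|X|; last first.
  have -> : (#|X| - m = 0)%N by lia.
  by rewrite !mul0r; apply: mulr_ge0 => //; exact: divr_ge0.
rewrite (@weighted_ratio #|X|%:R _ 'C(#|X|, m)%:R) ?ltr0n //.
  by rewrite pnatr_eq0; lia.
by rewrite -!natrM mul_bin_down.
Qed.

End CompletionProbability.

(* Reducing a uniform element of ['I_M] modulo [#|X|], which divides [M], gives
   a uniform element of [X]. *)
Section UniformPick.

Variables (R : realFieldType) (T : finType).

Definition pick_at (x0 : T) (X : {set T}) (m : nat) : T :=
  nth x0 (enum X) (m %% #|X|).

Lemma sum_modn (F : nat -> R) r m :
  \sum_(0 <= x < m * r) F (x %% r)%N = m%:R * \sum_(0 <= y < r) F y.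
Proof.
elim: m => [|m IH]; first by rewrite mul0n big_geq // mul0r.
rewrite mulSn addnC (big_cat_nat (n := (m * r)%N)) //= ?leq_addr // IH.
rewrite -natr1 mulrDl mul1r; congr (_ + _).
rewrite -[X in \sum_(X <= _ < _) _]add0n big_addn addKn.
by apply: eq_big_nat => y /andP[_ yr]; rewrite addnC modnMDl modn_small.
Qed.

Lemma sum_pick_at x0 (X : {set T}) M (F : T -> R) : (0 < #|X|)%N -> (#|X| %| M)%N ->
  (0 < M)%N ->
  \sum_(x < M) M%:R^-1 * F (pick_at x0 X x) = #|X|%:R^-1 * \sum_(w in X) F w.
Proof.
move=> X0 XM M0; rewrite -mulr_sumr.
rewrite -(big_mkord xpredT (fun x => F (pick_at x0 X x))).
have [m eM] := dvdnP XM.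
rewrite /pick_at eM (sum_modn (fun y => F (nth x0 (enum X) y))).
rewrite -(big_enum _ _ X F) (big_nth x0) -cardE natrM.
have m0 : m%:R != 0 :> R by rewrite pnatr_eq0; nia.
have X0' : #|X|%:R != 0 :> R by rewrite pnatr_eq0 -lt0n.
by rewrite invfM mulrACA mulVf // mul1r.
Qed.

End UniformPick.

(** * Bookkeeping of Proposer's phases, and the potential *)

Section ProposerMachine.

Variables (T : finType) (role : T -> nat + nat * nat).
Variables (K a : nat) (c k q ob : nat -> nat).
Implicit Types (e X : {set T}) (x y z w : T) (i j : nat).

Definition target i : {set T} := [set v | role v == inl i].

Lemma in_target i v : (v \in target i) = (role v == inl i).
Proof. by rewrite in_set. Qed.

Definition pairs_of X : {set {set T}} :=
  [set e : {set T} | (e \subset X) && (#|e| == 2)].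

Hypothesis card_target : forall i, (i <= K.+1)%N -> #|target i| = a.

(* In phase [i], row [j], a turn is either a token (a pair inside [target i]) or
   a trial (a pair joining [center i j] to a vertex of [target i.+1]).  [hits]
   and [pool] are the YES neighbours and the untried vertices of the current
   row; [cand] and [cov] contain all legal pairs inside [target i] and inside
   [target i.+1].  A row ends when it has [k i] hits (it then failed or
   succeeded, depending on how many pairs of [cov] it closes) or when its pool is
   exhausted. *)
Record pstate := PState {
  phase : nat; row : nat;
  tokens : nat; trials : nat; token_yes : nat; trial_yes : nat;
  failed : nat; succeeded : nat; exhausted : nat;
  hits : {set T}; pool : {set T};
  cand : {set {set T}}; cov : {set {set T}} }.
Implicit Types st : pstate.

Definition token_step st e (b : bool) :=
  PState (phase st) (row st) (tokens st).+1 (trials st) (token_yes st + b)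
    (trial_yes st) (failed st) (succeeded st) (exhausted st) (hits st) (pool st)
    (cand st :\ e) (cov st).

(** The tried vertex is recovered from the proposed pair: [W] is its singleton. *)
Definition trial_step st e (b : bool) :=
  let W := e :&: target (phase st).+1 in
  PState (phase st) (row st) (tokens st) (trials st).+1 (token_yes st)
    (trial_yes st + b) (failed st) (succeeded st) (exhausted st)
    (if b then W :|: hits st else hits st) (pool st :\: W) (cand st) (cov st).

(** In the last phase a row with [k K] hits already yields the independent set, so it never counts
    as failed. *)
Definition poor i (O : {set {set T}}) X := (i < K)%N && (covered O X < q i)%N.

Definition end_row st :=
  let f := poor (phase st) (cov st) (hits st) in
  PState (phase st) (row st).+1 (tokens st) (trials st) (token_yes st)
    (trial_yes st) (failed st + f) (succeeded st + ~~ f) (exhausted st) set0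
    (target (phase st).+1) (cand st) [set e in cov st | ~~ (e \subset hits st)].

Definition abandon_row st :=
  PState (phase st) (row st).+1 (tokens st) (trials st) (token_yes st)
    (trial_yes st) (failed st) (succeeded st) (exhausted st).+1 set0
    (target (phase st).+1) (cand st) (cov st).

Definition next_phase st :=
  PState (phase st).+1 0 0 0 0 0 0 0 0 set0 (target (phase st).+2)
    (cov st) (pairs_of (target (phase st).+2)).

(** Hits are tested before the pool: a row whose last vertex brings the final hit is not exhausted.
    A phase is left as soon as few enough pairs of the next target may still be legal. *)
Definition settle st :=
  if #|hits st| == k (phase st) then
    if (phase st < K)%N && (#|cov (end_row st)| <= ob (phase st).+1)%N
    then next_phase (end_row st) else end_row st
  else if pool st == set0 then abandon_row st else st.

Definition start := PState 0 0 0 0 0 0 0 0 0 set0 (target 1)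
  (pairs_of (target 0)) (pairs_of (target 1)).

Hypothesis a_gt0 : (0 < a)%N.
Hypothesis k_gt0 : forall i, (i <= K)%N -> (0 < k i)%N.
Hypothesis c_gt0 : forall i, (i <= K)%N -> (0 < c i)%N.
Hypothesis ob0 : ('C(a, 2) <= ob 0)%N.
Hypothesis obS : forall i, (i < K)%N -> (ob i.+1 < 'C(a, 2))%N.

(** Three budgets matter: a token uses up one of at most [ob] candidates ([cand_le]), an exhausted
    row has tried all [a] vertices ([exh_le]), and a success removes at least [q] pairs from [cov]
    ([succ_le]). *)
Record counts_raw st : Prop := CountsRaw {
  phase_le : (phase st <= K)%N;
  row_le : (row st <= c (phase st))%N;
  row_sum : row st = (succeeded st + failed st + exhausted st)%N;
  cand_le : (#|cand st| + tokens st <= ob (phase st))%N;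
  exh_le : (a * exhausted st + #|target (phase st).+1 :\: pool st| <= trials st)%N;
  succ_le : (phase st < K)%N ->
    (succeeded st * q (phase st) + #|cov st| <= 'C(a, 2))%N;
  cov_gt : (phase st < K)%N -> (ob (phase st).+1 < #|cov st|)%N;
  yes_le : (trial_yes st <= k (phase st) * row st + #|hits st|)%N;
  hits_sub : hits st \subset target (phase st).+1;
  pool_sub : pool st \subset target (phase st).+1;
  hits_pool : [disjoint hits st & pool st];
  cov_sub : cov st \subset pairs_of (target (phase st).+1);
  failed_last : phase st = K -> failed st = 0;
  hits_le : (#|hits st| <= k (phase st))%N }.

(** The two extra clauses say that the current row is open. They are restored by [settle], while
    [counts_raw] also covers the moment between a trial and [settle]. *)
Record counts st : Prop := Counts {
  counts_counts_raw :> counts_raw st;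
  hits_lt : (#|hits st| < k (phase st))%N;
  pool_gt0 : (0 < #|pool st|)%N }.

Lemma card_pairs_of i : (i <= K.+1)%N -> #|pairs_of (target i)| = 'C(a, 2).
Proof. by move=> iK; rewrite cards_draws card_target. Qed.

Lemma counts_start : counts start.
Proof.
split; [split|..] => //=; rewrite ?cards0 ?sub0set ?card_pairs_of ?addn0 ?setDv ?cards0 ?muln0 //.
- by move=> K0; exact: obS.
- by rewrite -setI_eq0 set0I.
- exact: k_gt0.
- by rewrite card_target.
Qed.

Lemma counts_token st e b : counts st -> e \in cand st -> counts (token_step st e b).
Proof.
case=> -[phK rc rs cl el sl cg yl hs ps hp cs fl hl] hlt pg eU.
split; [split|..] => //=.
by move: cl; rewrite (cardsD1 e (cand st)) eU add1n addSnnS.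
Qed.

Lemma counts_trial st e b w : counts st ->
  e :&: target (phase st).+1 = [set w] -> w \in pool st -> counts_raw (trial_step st e b).
Proof.
case=> -[phK rc rs cl el sl cg yl hs ps hp cs fl hl] hlt pg eW wR.
have wT : w \in target (phase st).+1 := subsetP ps _ wR.
have wN : w \notin hits st.
  by apply/negP => wN; move: hp => /pred0P/(_ w); rewrite /= wN wR.
have cH : #|if b then w |: hits st else hits st| = (#|hits st| + b)%N.
  by case: b; rewrite ?cardsU1 ?wN ?add1n ?addn1 ?addn0.
split=> //=; rewrite eW ?cH //.
- rewrite setDDr setIC (setIidPl _) ?sub1set // setUC cardsU1 in_setD wR /= add1n.
  lia.
- lia.
- by case: (b) => //; rewrite subUset sub1set wT.
- exact: subset_trans (subsetDl _ _) ps.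
- rewrite -setI_eq0; apply/eqP/setP => x; rewrite in_set0 in_setI in_setD1.
  have [->|xw] := eqVneq x w; rewrite ?andbF //=.
  have xNR : ~~ ((x \in hits st) && (x \in pool st)).
    by move: hp => /pred0P/(_ x) /= ->.
  by apply/negbTE; case: (b); rewrite // in_setU1 (negbTE xw).
- lia.
Qed.

Lemma card_closed_pairs st : #|cov st| =
  (#|cov (end_row st)| + covered (cov st) (hits st))%N.
Proof.
rewrite -(cardsID [set e : {set T} | e \subset hits st] (cov st)) addnC; congr (_ + _)%N.
  by apply: eq_card => e; rewrite !inE andbC.
by apply: eq_card => e; rewrite !inE.
Qed.

Lemma counts_settle st : counts_raw st -> (row st < c (phase st))%N ->
  counts (settle st).
Proof.
case=> [phK rc rs cl el sl cg yl hs ps hp cs fl hl] rlt; rewrite /settle.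
have ph1 : ((phase st).+1 <= K.+1)%N by [].
case: eqP => [hk|hk]; last first.
  case: eqP => [R0|/eqP R0]; last first.
    by split=> //; [rewrite ltn_neqAle hl andbT; apply/eqP|rewrite lt0n cards_eq0].
  split; [split|..] => //=; rewrite ?setDv ?cards0 ?sub0set ?k_gt0 ?card_target //; try lia.
    by move: el; rewrite R0 setD0 card_target //; lia.
  by rewrite -setI_eq0 set0I.
have cc := card_closed_pairs st.
case: ifP => [/andP[pK nob]|nph].
  split; [split|..] => //=; rewrite ?setDv ?cards0 ?sub0set ?muln0 ?addn0 ?card_pairs_of ?k_gt0 ?card_target //.
  - by move=> K1; exact: obS.
  - by rewrite -setI_eq0 set0I.
split; [split|..] => //=; rewrite ?setDv ?cards0 ?sub0set ?k_gt0 ?card_target //; try lia.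
- move=> pK; have := sl pK; rewrite cc /poor pK /=.
  case: (ltnP (covered _ _) _) => qc /=; rewrite ?addn0 ?addn1 ?mulSn; lia.
- by move=> pK; move: nph; rewrite pK /= => /negbT; rewrite -ltnNge.
- by rewrite -setI_eq0 set0I.
- by apply/subsetP => e; rewrite in_set => /andP[/(subsetP cs)].
- by move=> pK; rewrite (fl pK) /poor pK ltnn.
Qed.

Section MachinePotential.

Variables (R : realFieldType) (Q : nat) (D1 D2 eps : R).
Hypothesis D1_gt0 : 0 < D1.
Hypothesis D2_gt0 : 0 < D2.
Hypothesis eps_ge0 : 0 <= eps.
Hypothesis poor_freq : forall i (O : {set {set T}}), (i < K)%N -> O \subset pairs_of (target i.+1) ->
  (ob i.+1 < #|O|)%N ->
  bad_freq R (poor i O) set0 (target i.+1) (k i) <= eps.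

(** Up to the factor 8 / c, this bounds the expected final number of failed rows: those so far, the
    conditional probability for the current row, and [eps] for each later one. It reaches 1 when an
    eighth of the rows has failed. *)
Definition row_part st : R := (8 / (c (phase st))%:R) *
  ((failed st)%:R + (row st < c (phase st))%:R *
     bad_freq R (poor (phase st) (cov st)) (hits st) (pool st) (k (phase st) - #|hits st|) +
   eps * (c (phase st) - (row st).+1)%:R).

(* As a token is drawn with probability [1 / (2 Q + 1)], these two differences
   are martingales with increments of variance at most [2 Q]. *)
Definition yes_drift st : R := 2 * Q%:R * (token_yes st)%:R - (trial_yes st)%:R.
Definition draw_drift st : R := (trials st)%:R - 2 * Q%:R * (tokens st)%:R.

(** The term in [t] pays for the variance of the turns still to come; the last term holds 8 [eps] in
    reserve for the [row_part] of each later phase. *)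
Definition potential (t : nat) st : R :=
  yes_drift st ^+ 2 / D1 + draw_drift st ^+ 2 / D2 +
  2 * Q%:R * t%:R * (D1^-1 + D2^-1) * (K - phase st).+1%:R + row_part st +
  8 * eps * (K - phase st)%:R.

Lemma row_part_ge0 st : 0 <= row_part st.
Proof.
apply: mulr_ge0; first exact: divr_ge0.
by rewrite !addr_ge0 // mulr_ge0 // bad_freq_ge0.
Qed.

Lemma potential_ge_yes t st : yes_drift st ^+ 2 / D1 <= potential t st.
Proof.
rewrite /potential -!addrA lerDl !addr_ge0 ?row_part_ge0 //.
- by rewrite divr_ge0 ?sqr_ge0 // ltW.
- by rewrite !mulr_ge0 // addr_ge0 // invr_ge0 ltW.
- by rewrite !mulr_ge0.
Qed.

Lemma potential_ge_draw t st : draw_drift st ^+ 2 / D2 <= potential t st.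
Proof.
rewrite /potential [leRHS](_ : _ = draw_drift st ^+ 2 / D2 + (yes_drift st ^+ 2 / D1 +
  2 * Q%:R * t%:R * (D1^-1 + D2^-1) * (K - phase st).+1%:R + row_part st +
  8 * eps * (K - phase st)%:R)); last by ring.
rewrite lerDl !addr_ge0 ?row_part_ge0 //.
- by rewrite divr_ge0 ?sqr_ge0 // ltW.
- by rewrite !mulr_ge0 // addr_ge0 // invr_ge0 ltW.
- by rewrite !mulr_ge0.
Qed.

Lemma potential_ge_failed t st :
  8 / (c (phase st))%:R * (failed st)%:R <= potential t st.
Proof.
apply: le_trans (_ : row_part st <= _).
  apply: ler_wpM2l; first exact: divr_ge0.
  by rewrite -addrA lerDl addr_ge0 // mulr_ge0 // bad_freq_ge0.
rewrite /potential [leRHS](_ : _ = row_part st + (yes_drift st ^+ 2 / D1 +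
  draw_drift st ^+ 2 / D2 +
  2 * Q%:R * t%:R * (D1^-1 + D2^-1) * (K - phase st).+1%:R +
  8 * eps * (K - phase st)%:R)); last by ring.
rewrite lerDl !addr_ge0 //.
- by rewrite divr_ge0 ?sqr_ge0 // ltW.
- by rewrite divr_ge0 ?sqr_ge0 // ltW.
- by rewrite !mulr_ge0 // addr_ge0 // invr_ge0 ltW.
- by rewrite !mulr_ge0.
Qed.

Lemma potential_ge0 t st : 0 <= potential t st.
Proof.
by apply: le_trans (potential_ge_yes t st); rewrite divr_ge0 ?sqr_ge0 // ltW.
Qed.

Lemma potential_mono t st : potential t st <= potential t.+1 st.
Proof.
rewrite /potential lerD2r lerD2r lerD2l; apply: ler_wpM2r => //; apply: ler_wpM2r.
  by rewrite addr_ge0 // invr_ge0 ltW.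
by rewrite ler_wpM2l ?mulr_ge0 // ler_nat.
Qed.

(** Opening a row spends one [eps]: more than [ob i.+1] pairs are still uncovered, so [poor_freq]
    applies; in the last phase nothing is bad. *)
Lemma fresh_row_le i (O : {set {set T}}) (r : nat) : (i <= K)%N ->
  ((i < K)%N -> O \subset pairs_of (target i.+1)) ->
  ((i < K)%N -> (ob i.+1 < #|O|)%N) ->
  (r < c i)%:R * bad_freq R (poor i O) set0 (target i.+1) (k i - #|set0 : {set T}|) +
    eps * (c i - r.+1)%:R <= eps * (c i - r)%:R.
Proof.
move=> iK Osub Oob; rewrite cards0 subn0.
case: ltnP => rc; last by rewrite mul0r add0r (_ : c i - r.+1 = c i - r)%N //; lia.
have -> : (c i - r = (c i - r.+1).+1)%N by lia.
rewrite mul1r -[in leRHS]natr1 mulrDr mulr1 addrC lerD2l.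
have [iltK|Ki] := ltnP i K; first by apply: poor_freq; auto.
rewrite /bad_freq (_ : bad_completions _ _ _ _ = set0) ?cards0 ?mul0r //.
apply/setP => X; rewrite in_bad_completions in_set0 /poor ltnNge Ki /=.
by rewrite !andbF.
Qed.

(** At a completed row [bad_freq] has become the indicator of failure and moves into [failed]. At a
    change of phase both squares drop to 0 and one reserve of 8 [eps] pays for the new
    [row_part]. *)
Lemma potential_settle t st : counts_raw st -> (row st < c (phase st))%N ->
  potential t (settle st) <= potential t st.
Proof.
move=> cr rlt; have ct := counts_settle cr rlt; move: ct; rewrite /settle.
have phK := phase_le cr.
have c0 : 0 <= 8 / (c (phase st))%:R :> R by exact: divr_ge0.
case: eqP => hk; last first.
  case: ifP => // _ ct; rewrite /potential lerD2r lerD2l ler_wpM2l //=.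
  rewrite -!addrA lerD2l rlt.
  apply: le_trans (fresh_row_le (row st).+1 phK _ _) _.
  - by move=> _; apply: cov_sub ct.
  - by move=> pK; apply: cov_gt ct pK.
  by rewrite lerDr mul1r bad_freq_ge0.
have rowE : row_part (end_row st) <= row_part st \/
    ((phase st < K)%N && (#|cov (end_row st)| <= ob (phase st).+1)%N).
  have [|nph] := boolP ((phase st < K)%N && _); [by right|left].
  rewrite /row_part /= ler_wpM2l // natrD -!addrA lerD2l rlt mul1r hk subnn bad_freq0.
  rewrite lerD2l; apply: (fresh_row_le (row st).+1 phK).
    move=> _; apply/subsetP => e; rewrite in_set => /andP[eO _].
    exact: (subsetP (cov_sub cr)).
  by move=> pK; move: nph; rewrite pK /= -ltnNge.
case: ifP => [/andP[pK nob]|nph] ct; last first.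
  have {}rowE : row_part (end_row st) <= row_part st.
    by case: rowE => //; rewrite nph.
  by rewrite /potential lerD2r lerD2l.
rewrite /potential /yes_drift /draw_drift /=.
rewrite !mulr0 subrr expr0n /= !mul0r !add0r.
have [m Km] : exists m, (K - phase st = m.+1)%N by exists (K - phase st).-1; lia.
have -> : (K - (phase st).+1 = m)%N by lia.
rewrite Km.
have fr : row_part (next_phase (end_row st)) <= 8 * eps.
  rewrite /row_part /= add0r.
  apply: le_trans (ler_wpM2l _ (fresh_row_le 0 pK _ _)) _.
  - exact: divr_ge0.
  - by [].
  - by move=> pK1; rewrite /= card_pairs_of //; apply: obS.
  rewrite subn0 mulrCA; rewrite -mulrA mulVf ?mulr1 1?mulrC //.
  by rewrite pnatr_eq0 -lt0n c_gt0.
have y0 : 0 <= yes_drift st ^+ 2 / D1 by rewrite divr_ge0 ?sqr_ge0 // ltW.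
have d0 : 0 <= draw_drift st ^+ 2 / D2 by rewrite divr_ge0 ?sqr_ge0 // ltW.
have r0 := row_part_ge0 st.
have t0 : 0 <= 2 * Q%:R * t%:R * (D1^-1 + D2^-1).
  by rewrite !mulr_ge0 // addr_ge0 // invr_ge0 ltW.
have m1 : m.+1%:R = m%:R + 1 :> R by rewrite -natr1.
have m2 : m.+2%:R = m%:R + 1 + 1 :> R by rewrite -natr1 m1.
rewrite m1 m2; set X := 2 * Q%:R * t%:R * _ in t0 *.
move: y0 d0 r0 t0 fr; rewrite /yes_drift /draw_drift; clearbody X.
set y := _ / D1; set d := _ / D2; set rn := row_part (next_phase _); set r := row_part st.
by clearbody y d rn r; lra.
Qed.

Lemma row_part_trials st (e : T -> {set T}) b : counts st ->
  (row st < c (phase st))%N ->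
  (forall w, w \in pool st -> e w :&: target (phase st).+1 = [set w]) ->
  \sum_(w in pool st) row_part (trial_step st (e w) b) <=
  #|pool st|%:R * row_part st.
Proof.
move=> ct rlt eW; have [cr hlt pg] := ct.
have c0 : 0 <= 8 / (c (phase st))%:R :> R by exact: divr_ge0.
rewrite /row_part /= [leRHS]mulrCA -mulr_sumr; apply: ler_wpM2l => //.
rewrite rlt !big_split /= !sumr_const !mulrDr mul1r.
rewrite [_ * (failed st)%:R]mulr_natl [_ * (eps * _)]mulr_natl lerD2r lerD2l.
have [m km] : exists m, (k (phase st) - #|hits st| = m.+1)%N.
  by exists (k (phase st) - #|hits st|).-1; lia.
rewrite km; case: b.
  rewrite -(bad_freq_yes _ _ _ _ pg) le_eqVlt; apply/orP; left; apply/eqP.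
  apply: eq_bigr => w wR; rewrite eW // mul1r cardsU1.
  have -> : w \notin hits st.
    by apply/negP => wN; move: (hits_pool cr) => /pred0P/(_ w); rewrite /= wN wR.
  by congr bad_freq; rewrite add1n; lia.
apply: le_trans (bad_freq_no _ _ _ _ pg); apply: ler_sum => w wR.
by rewrite eW // mul1r km.
Qed.

Hypothesis Q_gt0 : (0 < Q)%N.

(** The same answer [b] occurs in both branches. So [yes_drift] moves by 2Q b with probability 1 /
    (2Q + 1) and by - b otherwise: mean 0 and second moment 2Q b. Likewise [draw_drift] has mean 0
    and second moment 2Q. *)
Lemma potential_step t st (f : {set T}) (e : T -> {set T}) b :
  counts st -> (row st < c (phase st))%N ->
  (forall w, w \in pool st -> e w :&: target (phase st).+1 = [set w]) ->
  (2 * Q + 1)%:R^-1 * potential t (token_step st f b) +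
  (2 * Q)%:R * (2 * Q + 1)%:R^-1 * (#|pool st|%:R^-1 *
     \sum_(w in pool st) potential t (settle (trial_step st (e w) b))) <=
  potential t.+1 st.
Proof.
move=> ct rlt eW; have [cr hlt pg] := ct.
set r := #|pool st|%:R; have r0 : 0 < r :> R by rewrite ltr0n.
have yt w : yes_drift (trial_step st (e w) b) = yes_drift st - b%:R.
  by rewrite /yes_drift /= natrD; ring.
have dt w : draw_drift (trial_step st (e w) b) = draw_drift st + 1.
  by rewrite /draw_drift /= -natr1; ring.
have yk : yes_drift (token_step st f b) = yes_drift st + 2 * Q%:R * b%:R.
  by rewrite /yes_drift /= natrD; ring.
have dk : draw_drift (token_step st f b) = draw_drift st - 2 * Q%:R.
  by rewrite /draw_drift /= -natr1; ring.
set y := yes_drift st in yt yk; set d := draw_drift st in dt dk.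
set W := 2 * Q%:R * (D1^-1 + D2^-1) * (K - phase st).+1%:R.
set M := 8 * eps * (K - phase st)%:R.
have trial_le : r^-1 * \sum_(w in pool st) potential t (settle (trial_step st (e w) b))
   <= (y - b%:R) ^+ 2 / D1 + (d + 1) ^+ 2 / D2 + t%:R * W + row_part st + M.
  rewrite ler_pdivrMl //.
  apply: le_trans (_ : \sum_(w in pool st) (row_part (trial_step st (e w) b) +
    ((y - b%:R) ^+ 2 / D1 + (d + 1) ^+ 2 / D2 + t%:R * W + M)) <= _).
    apply: ler_sum => w wR; apply: le_trans (potential_settle t _ _) _ => //.
      exact: counts_trial ct (eW w wR) wR.
    by rewrite /potential yt dt /= le_eqVlt /W /M; apply/orP; left; apply/eqP; ring.
  rewrite big_split /= sumr_const -[X in _ + X <= _]mulr_natl -/r.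
  have := row_part_trials b ct rlt eW; rewrite -/r => H.
  apply: le_trans (lerD H (lexx _)) _.
  by rewrite le_eqVlt; apply/orP; left; apply/eqP; ring.
have q0 : 0 < Q%:R :> R by rewrite ltr0n.
rewrite natrD natrM.
apply: le_trans (_ : (2 * Q%:R + 1)^-1 * potential t (token_step st f b) +
  2 * Q%:R / (2 * Q%:R + 1) * ((y - b%:R) ^+ 2 / D1 + (d + 1) ^+ 2 / D2 + t%:R * W +
     row_part st + M) <= _).
  by rewrite lerD2l ler_wpM2l // divr_ge0 ?addr_ge0 ?mulr_ge0 // ltW.
have -> : potential t (token_step st f b) = (y + 2 * Q%:R * b%:R) ^+ 2 / D1 +
    (d - 2 * Q%:R) ^+ 2 / D2 + t%:R * W + row_part st + M.
  by rewrite /potential yk dk /row_part /= /W /M; ring.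
have -> : potential t.+1 st = y ^+ 2 / D1 + d ^+ 2 / D2 + t%:R * W + W +
   row_part st + M.
  by rewrite /potential /W /M -/y -/d -natr1; ring.
have bb : b%:R ^+ 2 = b%:R :> R by case: (b); rewrite ?expr1n ?expr0n.
have b1 : b%:R <= 1 :> R by case: (b); rewrite ?ler01.
set A := t%:R * W; set G := row_part st.
have nz : 2 * Q%:R + 1 != 0 :> R by rewrite gt_eqF // addr_gt0 // mulr_gt0.
have D1z : D1 != 0 by rewrite gt_eqF.
have D2z : D2 != 0 by rewrite gt_eqF.
have -> : (2 * Q%:R + 1)^-1 * ((y + 2 * Q%:R * b%:R) ^+ 2 / D1 +
    (d - 2 * Q%:R) ^+ 2 / D2 + A + G + M) +
  2 * Q%:R / (2 * Q%:R + 1) * ((y - b%:R) ^+ 2 / D1 + (d + 1) ^+ 2 / D2 + A + G + M) =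
  y ^+ 2 / D1 + d ^+ 2 / D2 + A + G + M + 2 * Q%:R * (b%:R ^+ 2 / D1 + D2^-1).
  by field; rewrite nz D1z D2z.
rewrite bb.
have W_ge : 2 * Q%:R * (b%:R / D1 + D2^-1) <= W.
  rewrite /W; apply: le_trans (_ : 2 * Q%:R * (D1^-1 + D2^-1) <= _).
    rewrite ler_wpM2l ?mulr_ge0 // lerD2r -[leRHS]mul1r ler_wpM2r // invr_ge0 ltW //.
  by rewrite ler_peMr ?ler1n // !mulr_ge0 // addr_ge0 // invr_ge0 ltW.
by move: W_ge; rewrite -!addrA !lerD2l addrC; clearbody A G M; lra.
Qed.

Lemma potential_start t : potential t start <=
  2 * Q%:R * t%:R * (D1^-1 + D2^-1) * K.+1%:R + 8 * eps * K.+1%:R.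
Proof.
rewrite /potential /yes_drift /draw_drift /= !mulr0 subrr expr0n /= !mul0r !add0r subn0.
have -> : 8 * eps * K.+1%:R = 8 * eps + 8 * eps * K%:R by rewrite -natr1; ring.
rewrite -addrA lerD2l lerD2r /row_part /= add0r.
apply: le_trans (ler_wpM2l _ (fresh_row_le 0 (leq0n K) _ _)) _.
- exact: divr_ge0.
- by [].
- by move=> K0; rewrite card_pairs_of //; apply: obS.
rewrite subn0 mulrCA -mulrA mulVf ?mulr1 1?mulrC //.
by rewrite pnatr_eq0 -lt0n c_gt0.
Qed.

End MachinePotential.

End ProposerMachine.

Lemma exhausted_most (m s f e : nat) : m = (s + f + e)%N ->
  (8 * s < m)%N -> (8 * f < m)%N -> (3 * m <= 4 * e)%N.
Proof. by lia. Qed.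

Lemma draw_excess (a m e Q o t r v : nat) : (3 * m <= 4 * e)%N -> (a * e <= r)%N ->
  (t <= o)%N -> (4 * (2 * Q * o + v) <= 3 * a * m)%N -> (v + 2 * Q * t <= r)%N.
Proof. by nia. Qed.

(** * Running the machine on histories *)

Section ProposerStrategy.

Variables (n : nat) (role : 'I_n -> nat + nat * nat) (center : nat -> nat -> 'I_n).
Variables (K a Q : nat) (c k q ob : nat -> nat).
Implicit Types (h : history n) (e X : {set 'I_n}) (x y z w : 'I_n) (i j : nat).
Implicit Types (st : pstate 'I_n).

Hypothesis card_target : forall i, (i <= K.+1)%N -> #|target role i| = a.
Hypothesis role_center : forall i j, (i <= K)%N -> (j < c i)%N ->
  role (center i j) = inr (i, j).
Hypothesis a_gt0 : (0 < a)%N.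
Hypothesis k_gt0 : forall i, (i <= K)%N -> (0 < k i)%N.
Hypothesis c_gt0 : forall i, (i <= K)%N -> (0 < c i)%N.
Hypothesis ob0 : ('C(a, 2) <= ob 0)%N.
Hypothesis obS : forall i, (i < K)%N -> (ob i.+1 < 'C(a, 2))%N.

Local Notation target := (target role).
Local Notation settle := (settle role K k q ob).
Local Notation trial_step := (trial_step role).
Local Notation counts := (counts role K a c k q ob).
Local Notation counts_raw := (counts_raw role K a c k q ob).
Local Notation end_row := (end_row role K q).
Local Notation abandon_row := (abandon_row role).
Local Notation next_phase := (next_phase role).

(** Once this fails the state is frozen, and it fails from then on: the legal pairs only become
    fewer. The rest of the game is played arbitrarily. *)
Definition active h st :=
  (row st < c (phase st))%N && [exists e, legal h e && (e \subset target (phase st))].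

Definition update h st e b :=
  if active h st then
    if e \subset target (phase st) then token_step st e b
    else settle (trial_step st e b)
  else st.

(** [update] must see the history before each turn to evaluate [active], so the fold rebuilds the
    history along with the state. *)
Definition track h : history n * pstate 'I_n :=
  foldl (fun hs t => (rcons hs.1 t, update hs.1 hs.2 t.1 t.2)) ([::], start role) h.

Definition state_of h := (track h).2.

Lemma track1 h : (track h).1 = h.
Proof.
by elim/last_ind: h => // h t IH; rewrite /track foldl_rcons /= -/(track h) IH.
Qed.

Lemma state_of_rcons h e b : state_of (rcons h (e, b)) = update h (state_of h) e b.
Proof. by rewrite /state_of /track foldl_rcons /= -/(track h) track1. Qed.

(* Strong enough to make every pair from the current center to the pool legal. *)
Record layout h st : Prop := Layout {
  layout_cand : forall e, legal h e -> e \subset target (phase st) -> e \in cand st;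
  layout_cov : forall e, legal h e -> e \subset target (phase st).+1 -> e \in cov st;
  layout_late : forall e x i, e \in forbidden h -> x \in e -> role x = inl i ->
    (i <= (phase st).+1)%N;
  layout_target : forall e x, e \in forbidden h -> x \in e ->
    role x = inl (phase st).+1 ->
    exists j, [/\ e = [set center (phase st) j; x],
      role (center (phase st) j) = inr (phase st, j) &
      (j < row st)%N \/ j = row st /\ x \notin pool st];
  layout_center : forall e x i j, e \in forbidden h -> x \in e -> role x = inr (i, j) ->
    (i < phase st)%N \/ i = phase st /\ (j <= row st)%N;
  layout_row : forall e, e \in forbidden h -> center (phase st) (row st) \in e ->
    exists2 w, e = [set center (phase st) (row st); w] & role w = inl (phase st).+1;
  layout_hits : forall w, w \in hits st ->
    [set center (phase st) (row st); w] \in graph h }.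

Definition row_live st := (row st < c (phase st))%N.

Record tracked h st : Prop := Tracked {
  tracked_edges : row_live st ->
    (#|edges_in (graph h) (target (phase st))| <= token_yes st)%N;
  tracked_last : phase st = K -> (0 < succeeded st)%N ->
    exists z, (k K <= #|yes_nbr h setT z|)%N }.

Lemma yes_nbr_mono h e b z : (#|yes_nbr h setT z| <= #|yes_nbr (rcons h (e, b)) setT z|)%N.
Proof.
apply/subset_leq_card/subsetP => w; rewrite !in_yes_nbr => /andP[-> zw].
exact: (subsetP (graph_rcons_sub _ _ _)).
Qed.

Lemma role_row st : counts st -> row_live st ->
  role (center (phase st) (row st)) = inr (phase st, row st).
Proof. by move=> ct rl; apply: role_center => //; apply: phase_le ct. Qed.

Lemma role_pool st w : counts st -> w \in pool st -> role w = inl (phase st).+1.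
Proof.
by move=> ct /(subsetP (pool_sub ct)); rewrite in_target => /eqP.
Qed.

Lemma center_neq_pool st w : counts st -> row_live st -> w \in pool st ->
  center (phase st) (row st) != w.
Proof.
move=> ct rl wR; apply/eqP => cw; have := role_row ct rl.
by rewrite cw (role_pool ct wR).
Qed.

Lemma trial_pair_meet st w : counts st -> row_live st -> w \in pool st ->
  [set center (phase st) (row st); w] :&: target (phase st).+1 = [set w].
Proof.
move=> ct rl wR; apply/setP => x; rewrite in_setI in_set2 in_set1 in_target.
have [->|xw] := eqVneq x w; first by rewrite (role_pool ct wR) orbT eqxx.
rewrite orbF; case: eqP => [->|//]; by rewrite (role_row ct rl).
Qed.

Lemma trial_pair_notin st w i : counts st -> row_live st -> w \in pool st ->
  ~~ ([set center (phase st) (row st); w] \subset target i).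
Proof.
move=> ct rl wR; rewrite subUset sub1set in_target (role_row ct rl).
by apply/negP => /andP[/eqP].
Qed.

(** A common neighbour would have to lie in the next target, seen from the center, and be a center,
    seen from [w]. *)
Lemma trial_legal h st w : counts st -> row_live st -> layout h st -> w \in pool st ->
  legal h [set center (phase st) (row st); w].
Proof.
move=> ct rl [_ _ _ lt lc lr _] wR; rewrite legalE; last exact: center_neq_pool.
have rw := role_pool ct wR.
apply/andP; split.
  apply/negP => /[dup] ef /(lt _ w); rewrite set22 => /(_ isT rw) [j [e1 rj jr]].
  case: (set2_inj e1) => [[cj _]|[_ wj]]; last by rewrite -wj rw in rj.
  move: rj; rewrite -cj (role_row ct rl) => -[jE].
  by case: jr => [|[_]]; rewrite ?wR // -jE ltnn.
apply/joinedP => -[z /(subsetP (graph_sub_forbidden h)) cz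
  /(subsetP (graph_sub_forbidden h)) wz].
have [w' e1 rw'] := lr _ cz (set21 _ _).
have zE : role z = inl (phase st).+1.
  case: (set2_inj e1) => [[_ ->]|[cw _]] //.
  by move: (role_row ct rl); rewrite cw rw'.
have [j [e2 rj _]] := lt _ w wz (set21 _ _) rw.
have : center (phase st) j \in [set w; z] by rewrite e2 set21.
by rewrite in_set2 => /orP[]/eqP ce; move: rj; rewrite ce ?rw ?zE.
Qed.

Lemma layout_trial h st w b : counts st -> row_live st -> layout h st -> w \in pool st ->
  layout (rcons h ([set center (phase st) (row st); w], b))
    (trial_step st [set center (phase st) (row st); w] b).
Proof.
move=> ct rl [lu lo ll lt lc lr lh] wR.
have rw := role_pool ct wR; have rr := role_row ct rl.
split=> /=; rewrite ?trial_pair_meet //.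
- by move=> e /legal_rcons/andP[le _]; apply: lu.
- by move=> e /legal_rcons/andP[le _]; apply: lo.
- move=> e x i; rewrite forbidden_rcons => /setU1P[->|]; last exact: ll.
  by rewrite in_set2 => /orP[]/eqP->; rewrite ?rr ?rw // => -[<-].
- move=> e x; rewrite forbidden_rcons => /setU1P[->|].
    rewrite in_set2 => /orP[]/eqP-> rx; first by rewrite rr in rx.
    exists (row st); split=> //; right; split=> //.
    by rewrite in_setD1 eqxx.
  move=> ef xe rx; have [j [e1 rj jr]] := lt e x ef xe rx.
  exists j; split=> //; case: jr => [|[jE xR]]; [by left|right; split=> //].
  by rewrite in_setD1 (negbTE xR) andbF.
- move=> e x i j; rewrite forbidden_rcons => /setU1P[->|]; last exact: lc.
  rewrite in_set2 => /orP[]/eqP->; rewrite ?rr ?rw // => -[<- <-].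
  by right.
- move=> e; rewrite forbidden_rcons => /setU1P[-> _|]; last exact: lr.
  by exists w.
- move=> x; rewrite graph_rcons; case: b => [|/lh //].
  by case/setU1P => [->|/lh]; rewrite in_setU1 ?eqxx // => ->; rewrite orbT.
Qed.

Lemma layout_token h st e b : layout h st -> e \subset target (phase st) ->
  role (center (phase st) (row st)) = inr (phase st, row st) ->
  layout (rcons h (e, b)) (token_step st e b).
Proof.
move=> [lu lo ll lt lc lr lh] eT rr.
have re x : x \in e -> role x = inl (phase st).
  by move=> /(subsetP eT); rewrite in_target => /eqP.
split=> /=.
- by move=> f /legal_rcons/andP[lf fe] fT; rewrite in_setD1 fe lu.
- by move=> f /legal_rcons/andP[lf _]; apply: lo.
- move=> f x i; rewrite forbidden_rcons => /setU1P[->|]; last exact: ll.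
  by move=> /re -> [<-].
- move=> f x; rewrite forbidden_rcons => /setU1P[->|]; last exact: lt.
  by move=> /re -> [] /eqP; rewrite -[X in X == _]addn0 -addn1 eqn_add2l.
- move=> f x i j; rewrite forbidden_rcons => /setU1P[->|]; last exact: lc.
  by move=> /re ->.
- move=> f; rewrite forbidden_rcons => /setU1P[->|]; last exact: lr.
  by move=> /re; rewrite rr.
- by move=> x /lh; apply: (subsetP (graph_rcons_sub _ _ _)).
Qed.

Lemma layout_next_row h st st' : layout h st -> phase st' = phase st ->
  row st' = (row st).+1 -> cand st' = cand st ->
  (forall e, legal h e -> e \subset target (phase st).+1 -> e \in cov st -> e \in cov st') ->
  hits st' = set0 ->
  role (center (phase st) (row st).+1) = inr (phase st, (row st).+1) ->
  layout h st'.
Proof.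
move=> [lu lo ll lt lc lr lh] pE rE cE covE hE rr.
split; rewrite ?pE ?rE ?cE ?hE //.
- by move=> e le eT; apply: covE => //; apply: lo.
- move=> e x ef xe rx; have [j [e1 rj jr]] := lt e x ef xe rx.
  by exists j; split=> //; left; case: jr => [|[-> _]] //; exact: ltnW.
- move=> e x i j ef xe rx; case: (lc e x i j ef xe rx) => [|[-> jr]]; first by left.
  by right; split=> //; exact: leqW.
- move=> e ef ce; case: (lc _ _ _ _ ef ce rr) => [|[_]]; by rewrite ltnn.
- by move=> w; rewrite in_set0.
Qed.

(** Pairs of hits are closed by the current center, so [end_row] discards no legal pair. *)
Lemma cov_end_row h st e : layout h st -> legal h e ->
  e \in cov st -> e \in cov (end_row st).
Proof.
move=> lay le eO; rewrite in_set eO /=; apply/negP => eN.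
have [x [y [xy exy]]] := legal2 le; move: le eN.
rewrite exy legalE // subUset !sub1set => /andP[_ /joinedP nj] /andP[xN yN].
apply: nj; exists (center (phase st) (row st)).
  by rewrite set2C; apply: layout_hits lay _ xN.
by rewrite set2C; apply: layout_hits lay _ yN.
Qed.

Lemma layout_end_row h st : counts_raw st -> layout h st -> row_live (end_row st) ->
  layout h (end_row st).
Proof.
move=> cr lay rl.
apply: (layout_next_row (st' := end_row st) lay) => //=; last first.
  by apply: role_center => //; apply: phase_le cr.
by move=> e le eT eO; exact: (cov_end_row lay le eO).
Qed.

Lemma layout_next_phase h st : (phase st < K)%N -> layout h st ->
  layout h (next_phase (end_row st)).
Proof.
move=> pK lay; have [lu lo ll lt lc lr lh] := lay.
split=> /=.
- by move=> e le eT; exact: (cov_end_row lay le (lo e le eT)).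
- by move=> e le eT; rewrite in_set eT (legal_card le).
- by move=> e x i ef xe rx; apply: leqW; apply: ll ef xe rx.
- by move=> e x ef xe rx; have := ll e x _ ef xe rx; rewrite ltnn.
- move=> e x i j ef xe rx; left; case: (lc e x i j ef xe rx) => [|[-> _]] //.
  exact: leqW.
- move=> e ef ce; have rr : role (center (phase st).+1 0) = inr ((phase st).+1, 0).
    by apply: role_center => //; apply: c_gt0.
  by case: (lc _ _ _ _ ef ce rr) => [|[/esym/eqP]]; rewrite ?ltnNge ?leqnSn // ltn_eqF.
- by move=> w; rewrite in_set0.
Qed.

(** So far the next target has only been joined to centers; hence [token_yes] may restart from 0. *)
Lemma no_edges_next h st : wf h -> layout h st ->
  edges_in (graph h) (target (phase st).+1) = set0.
Proof.
move=> wh lay; apply/setP => e; rewrite in_edges_in in_set0; apply/negP => /andP[eG eT].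
have ef := subsetP (graph_sub_forbidden h) _ eG.
have /cards2P[x [y [xy exy]]] : #|e| == 2 by rewrite (wf_card wh ef).
have xe : x \in e by rewrite exy set21.
have rx : role x = inl (phase st).+1.
  by have := subsetP eT _ xe; rewrite in_target => /eqP.
have [j [e1 rj _]] := layout_target lay ef xe rx.
have : center (phase st) j \in target (phase st).+1.
  by apply: (subsetP eT); rewrite e1 set21.
by rewrite in_target rj.
Qed.

Lemma tracked_settle h st : wf h -> counts_raw st -> row_live st -> layout h st ->
  tracked h st -> tracked h (settle st) /\ (row_live (settle st) -> layout h (settle st)).
Proof.
move=> wh cr rl lay [te tl]; rewrite /settle.
have rlE st' : phase st' = phase st -> row st' = (row st).+1 -> row_live st' ->
    role (center (phase st) (row st).+1) = inr (phase st, (row st).+1).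
  by rewrite /row_live => -> -> rl'; apply: role_center => //; apply: phase_le cr.
case: eqP => hk; last first.
  case: ifP => // _; split; first by split=> // _; exact: te.
  move=> rl'; apply: (layout_next_row (st' := abandon_row st) lay) => //=.
  exact: (rlE (abandon_row st)).
have [tr ly] : tracked h (end_row st) /\
    (row_live (end_row st) -> layout h (end_row st)).
  split; last exact: layout_end_row.
  split=> [_|/= pK _]; first exact: te.
  exists (center (phase st) (row st)).
  rewrite -pK -hk; apply/subset_leq_card/subsetP => w wN.
  by rewrite in_yes_nbr in_setT; apply: layout_hits lay _ wN.
case: ifP => // /andP[pK nob]; split.
  split=> [_|_] /=; last by rewrite ltnn.
  by rewrite /= (no_edges_next wh lay) cards0.
by move=> _; apply: layout_next_phase.
Qed.

Record invariant h : Prop := Invariant {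
  inv_wf : wf h;
  inv_counts : counts (state_of h);
  inv_tracked : tracked h (state_of h);
  inv_layout : active h (state_of h) -> layout h (state_of h) }.

Lemma layout_start : layout [::] (start role).
Proof.
have f0 e : (e \in forbidden ([::] : history n)) = false by rewrite /forbidden in_set.
split=> //= [e le eT|e le eT|e x i|e x|e x i j|e|w]; rewrite ?f0 ?in_set0 //.
  by rewrite in_set eT (legal_card le).
by rewrite in_set eT (legal_card le).
Qed.

Lemma invariant_nil : invariant [::].
Proof.
split.
- exact: wf_nil.
- exact: counts_start.
- split=> //= _; rewrite leqn0 cards_eq0; apply/eqP/setP => e.
  by rewrite in_edges_in !in_set0.
- by move=> _; apply: layout_start.
Qed.

Variables (d : decider n).

(** The first coordinate is 0 for a token. The second is uniform on n! values because every possible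
    pool size divides n!, so one distribution serves all turns. *)
Definition rps_draw := ('I_(2 * Q).+1 * 'I_(n`!))%type.

Definition rps_choice h (u : rps_draw) : {set 'I_n} :=
  let st := state_of h in
  if active h st then
    if u.1 == ord0 then
      odflt set0 [pick e | legal h e && (e \subset target (phase st))]
    else [set center (phase st) (row st); pick_at (center 0 0) (pool st) u.2]
  else set0.

Definition token_pair h : {set 'I_n} :=
  odflt set0 [pick e | legal h e && (e \subset target (phase (state_of h)))].

Lemma token_pairP h : active h (state_of h) ->
  legal h (token_pair h) && (token_pair h \subset target (phase (state_of h))).
Proof.
case/andP => _ /existsP[e He]; rewrite /token_pair.
by case: pickP => // /(_ e); rewrite He.
Qed.

Lemma legalize_legal h e : legal h e -> legalize e h = e.
Proof. by rewrite /legalize => ->. Qed.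

Lemma pick_at_in (x0 : 'I_n) X m : (0 < #|X|)%N -> pick_at x0 X m \in X.
Proof.
by move=> X0; rewrite -mem_enum /pick_at mem_nth // -cardE ltn_mod.
Qed.

Lemma active_forward h e b : wf h -> legal h e -> active (rcons h (e, b)) (state_of h) ->
  active h (state_of h).
Proof.
move=> wh le /andP[rl /existsP[f /andP[lf fT]]]; rewrite /active rl.
by apply/existsP; exists f; rewrite fT andbT; case/andP: (legal_rcons lf).
Qed.

(** If rows are left, the freeze means that the current target has no legal pair, so arbitrary play
    adds no edge inside it. *)
Lemma invariant_idle h e b : invariant h -> legal h e -> ~~ active h (state_of h) ->
  invariant (rcons h (e, b)).
Proof.
move=> [wh ct [te tl] lay] le nact.
have sE : state_of (rcons h (e, b)) = state_of h.
  by rewrite state_of_rcons /update (negbTE nact).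
split; rewrite ?sE //; first exact: wf_rcons.
  split=> [rl|pK s0]; last first.
    have [z kz] := tl pK s0; exists z; exact: leq_trans kz (yes_nbr_mono _ _ _ _).
  apply: leq_trans (te rl); apply/subset_leq_card/subsetP => f.
  rewrite !in_edges_in graph_rcons => /andP[+ fT]; rewrite fT andbT.
  case: b {sE} => // /setU1P[fe|//].
  case/negP: nact; rewrite /active /row_live in rl *; rewrite rl /=.
  by apply/existsP; exists e; rewrite le -fe.
by move=> act; case/negP: nact; apply: active_forward act.
Qed.

Lemma edges_in_rcons h e b X :
  (#|edges_in (graph (rcons h (e, b))) X| <= #|edges_in (graph h) X| + b)%N.
Proof.
rewrite graph_rcons; case: b; last by rewrite addn0.
rewrite addn1 -(add1n #|_|) -(cards1 e); apply: leq_trans (leq_card_setU _ _).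
apply/subset_leq_card/subsetP => f; rewrite in_setU !in_edges_in in_setU1 in_set1.
by case: (f == e).
Qed.

Lemma invariant_token h e b : invariant h -> legal h e -> active h (state_of h) ->
  e \subset target (phase (state_of h)) -> invariant (rcons h (e, b)).
Proof.
move=> [wh ct [te tl] lay] le act eT.
have rl : row_live (state_of h) by case/andP: act.
have ly := lay act.
have sE : state_of (rcons h (e, b)) = token_step (state_of h) e b.
  by rewrite state_of_rcons /update act eT.
split; rewrite ?sE; first exact: wf_rcons.
- by apply: counts_token => //; apply: layout_cand ly _ le eT.
- split=> [_|pK s0] /=.
    by apply: leq_trans (edges_in_rcons _ _ _ _) _; rewrite leq_add2r te.
  have [z kz] := tl pK s0; exists z; exact: leq_trans kz (yes_nbr_mono _ _ _ _).
- by move=> _; apply: layout_token => //; apply: role_row.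
Qed.

Lemma invariant_trial h w b : invariant h -> active h (state_of h) ->
  w \in pool (state_of h) ->
  invariant (rcons h ([set center (phase (state_of h)) (row (state_of h)); w], b)).
Proof.
move=> [wh ct [te tl] lay] act wR; set st := state_of h in ct te tl act wR lay *.
have rl : row_live st by case/andP: act.
have ly := lay act; set e := [set _; _].
have nT i : ~~ (e \subset target i) by apply: trial_pair_notin.
have le : legal h e by apply: trial_legal.
have sE : state_of (rcons h (e, b)) = settle (trial_step st e b).
  by rewrite state_of_rcons /update -/st act (negbTE (nT _)).
have eW : e :&: target (phase st).+1 = [set w] by apply: trial_pair_meet.
have wh' : wf (rcons h (e, b)) by apply: wf_rcons.
have cr : counts_raw (trial_step st e b) by exact: counts_trial ct eW wR.
have tr : tracked (rcons h (e, b)) (trial_step st e b).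
  split=> [_|pK s0] /=.
    apply: leq_trans (te rl); apply/subset_leq_card/subsetP => f.
    rewrite !in_edges_in graph_rcons => /andP[+ fT]; rewrite fT andbT.
    case: b {sE wh' cr} => // /setU1P[fe|//].
    by move: fT; rewrite fe (negbTE (nT _)).
  have [z kz] := tl pK s0; exists z; exact: leq_trans kz (yes_nbr_mono _ _ _ _).
have ly' := layout_trial b ct rl ly wR.
have [tr2 ly2] := tracked_settle wh' cr rl ly' tr.
split; rewrite ?sE //; first exact: counts_settle.
by case/andP => rl2 _; apply: ly2.
Qed.

Lemma choice_token h u : active h (state_of h) -> u.1 = ord0 ->
  legalize (rps_choice h u) h = token_pair h.
Proof.
move=> act u0; rewrite /rps_choice act u0 eqxx -/(token_pair h).
by apply: legalize_legal; case/andP: (token_pairP act).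
Qed.

Lemma choice_trial h u : invariant h -> active h (state_of h) -> u.1 != ord0 ->
  legalize (rps_choice h u) h = [set center (phase (state_of h)) (row (state_of h));
    pick_at (center 0 0) (pool (state_of h)) u.2].
Proof.
move=> inv act u0; rewrite /rps_choice act (negbTE u0).
apply: legalize_legal; apply: trial_legal.
- exact: inv_counts inv.
- by case/andP: act.
- exact: inv_layout inv act.
- by apply: pick_at_in; apply: pool_gt0 (inv_counts inv).
Qed.

Lemma invariant_next h u : invariant h -> ~~ game_over h ->
  invariant (rcons h (legalize (rps_choice h u) h, d h)).
Proof.
move=> inv oh; have [act|nact] := boolP (active h (state_of h)); last first.
  by apply: invariant_idle => //; exact: legalizeP.
have [u0|u0] := eqVneq u.1 ord0.
  rewrite choice_token //; have /andP[le eT] := token_pairP act.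
  exact: invariant_token.
rewrite choice_trial //; apply: invariant_trial => //.
by apply: pick_at_in; apply: pool_gt0 (inv_counts inv).
Qed.

Variables (R : realFieldType) (D1 D2 eps : R).
Hypothesis D1_gt0 : 0 < D1.
Hypothesis D2_gt0 : 0 < D2.
Hypothesis eps_ge0 : 0 <= eps.
Hypothesis Q_gt0 : (0 < Q)%N.
Hypothesis poor_freq : forall i (O : {set {set 'I_n}}), (i < K)%N ->
  O \subset pairs_of (target i.+1) -> (ob i.+1 < #|O|)%N ->
  bad_freq R (poor K q i O) set0 (target i.+1) (k i) <= eps.

Definition rps_weight (u : rps_draw) : R := ((2 * Q).+1%:R)^-1 * (n`!%:R)^-1.

Lemma rps_weight_ge0 u : 0 <= rps_weight u.
Proof. by rewrite mulr_ge0 ?invr_ge0. Qed.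

Lemma rps_weight_sum1 : \sum_u rps_weight u = 1.
Proof.
rewrite sumr_const card_prod !card_ord -[LHS]mulr_natl natrM /rps_weight.
by rewrite mulrACA !mulfV ?mul1r // pnatr_eq0 // -lt0n fact_gt0.
Qed.

Local Notation pot := (potential K c k q Q D1 D2 eps).

Lemma potential_next t h : invariant h -> ~~ game_over h ->
  \sum_u rps_weight u * pot t (state_of (rcons h (legalize (rps_choice h u) h, d h))) <=
  pot t.+1 (state_of h).
Proof.
move=> inv oh; set st := state_of h; set b := d h.
have [act|nact] := boolP (active h st); last first.
  rewrite (eq_bigr (fun u => rps_weight u * pot t st)).
    by rewrite -mulr_suml rps_weight_sum1 mul1r potential_mono.
  by move=> u _; rewrite state_of_rcons /update -/st (negbTE nact).
have rl : row_live st by case/andP: act.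
have ct := inv_counts inv.
pose e w := [set center (phase st) (row st); w].
have eW w : w \in pool st -> e w :&: target (phase st).+1 = [set w].
  exact: trial_pair_meet.
apply: le_trans (potential_step card_target a_gt0 k_gt0 c_gt0 ob0 obS D1_gt0 D2_gt0
  eps_ge0 poor_freq Q_gt0 t (token_pair h) b ct rl eW).
pose F w := pot t (settle (trial_step st (e w) b)).
rewrite -(pair_bigA _ (fun (u : 'I_(2 * Q).+1) (v : 'I_(n`!)) => rps_weight (u, v) *
  pot t (state_of (rcons h (legalize (rps_choice h (u, v)) h, b))))) /=.
rewrite (bigD1 ord0) //= addn1; apply: lerD.
  rewrite (eq_bigr (fun=> (2 * Q).+1%:R^-1 * n`!%:R^-1 * pot t (token_step st (token_pair h) b))).
    rewrite sumr_const card_ord -[leLHS]mulr_natl.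
    set P := pot _ _; rewrite le_eqVlt; apply/orP; left; apply/eqP.
    have f0 : n`!%:R != 0 :> R by rewrite pnatr_eq0 -lt0n fact_gt0.
    have gen (u v z : R) : v != 0 -> v * (u / v * z) = u * z by move=> v0; field.
    exact: gen.
  move=> y _; rewrite choice_token // state_of_rcons /update -/st act.
  by case/andP: (token_pairP act) => _ ->.
have pg := pool_gt0 ct.
rewrite (eq_bigr (fun=> (2 * Q).+1%:R^-1 * (#|pool st|%:R^-1 * \sum_(w in pool st) F w))).
  rewrite sumr_const -[leLHS]mulr_natl mulrA.
  rewrite (_ : #|_| = 2 * Q)%N ?lexx //.
  by rewrite (cardC1 (ord0 : 'I_(2 * Q).+1)) card_ord.
move=> x x0; rewrite -(sum_pick_at (center 0 0) F pg _ (fact_gt0 n)); last first.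
  rewrite dvdn_fact // pg /=; apply: leq_trans (max_card _) _.
  by rewrite card_ord.
rewrite mulr_sumr; apply: eq_bigr => y _.
rewrite mulrA choice_trial //= state_of_rcons /update -/st act.
have wR : pick_at (center 0 0) (pool st) y \in pool st by apply: pick_at_in.
by rewrite (negbTE (trial_pair_notin _ ct rl wR)).
Qed.

Variables (s E dev1 dev2 : nat).
Hypothesis sparse_win : forall h i, wf h -> (i <= K)%N ->
  (#|edges_in (graph h) (target i)| <= E)%N ->
  exists2 S, independent (graph h) S & (s <= #|S|)%N.
Hypothesis k_last : (s <= k K)%N.
Hypothesis dev1P : forall i, (i <= K)%N -> (k i * c i + dev1 <= 2 * Q * E.+1)%N.
Hypothesis dev2P : forall i, (i <= K)%N -> (4 * (2 * Q * ob i + dev2) <= 3 * a * c i)%N.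
Hypothesis qP : forall i, (i < K)%N -> (8 * 'C(a, 2) < c i * q i)%N.
Hypothesis D1E : D1 = dev1%:R ^+ 2.
Hypothesis D2E : D2 = dev2%:R ^+ 2.

Lemma yes_nbr_independent h z : wf h -> independent (graph h) (yes_nbr h setT z).
Proof.
move=> wh; apply/forall_inP => x; rewrite in_yes_nbr => /andP[_ zx].
apply/forall_inP => y; rewrite in_yes_nbr => /andP[_ zy].
by apply/negP => xy; apply: (wf_tri wh zx zy xy).
Qed.

Lemma sqr_ratio_ge1 (x : R) (dev : nat) : 0 < (dev%:R : R) ^+ 2 -> dev%:R <= x ->
  1 <= x ^+ 2 / dev%:R ^+ 2.
Proof.
by move=> d0 dx; rewrite ler_pdivlMr // mul1r lerXn2r ?nnegrE ?(le_trans _ dx).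
Qed.

(** If rows are left, more than [E] tokens were accepted, which puts [yes_drift] above [dev1].
    Otherwise either an eighth of the rows failed, or, fewer than an eighth having succeeded, three
    quarters were exhausted, which puts [draw_drift] above [dev2]. *)
Lemma potential_lost h : invariant h ->
  (forall S, independent (graph h) S -> (#|S| < s)%N) -> 1 <= pot 0 (state_of h).
Proof.
move=> [wh ct [te tl] _] lost; move: (state_of h) ct te tl => st ct te tl.
have phK := phase_le ct; have ci0 := c_gt0 phK.
have [rl|] := boolP (row_live st).
  have yE : (E < token_yes st)%N.
    rewrite ltnNge; apply/negP => yE.
    have [S /lost] := sparse_win wh phK (leq_trans (te rl) yE).
    by rewrite ltnNge => /negbTE->.
  apply: le_trans (_ : @yes_drift _ R Q st ^+ 2 / D1 <= _); last exact: potential_ge_yes.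
  rewrite D1E; apply: sqr_ratio_ge1; first by rewrite -D1E.
  rewrite /yes_drift lerBrDr -natrM -natrM -natrD ler_nat.
  apply: leq_trans (_ : 2 * Q * E.+1 <= _)%N; last by rewrite leq_mul2l yE orbT.
  apply: leq_trans (dev1P phK); rewrite addnC leq_add2r.
  apply: leq_trans (yes_le ct) _.
  apply: leq_trans (_ : k (phase st) * (row st).+1 <= _)%N; last first.
    by rewrite leq_mul2l; apply/orP; right.
  by rewrite mulnS addnC leq_add2r ltnW // (hits_lt ct).
rewrite /row_live -leqNgt => cr.
have rE : row st = c (phase st) by apply/eqP; rewrite eqn_leq cr (row_le ct).
have [cf|fc] := leqP (c (phase st)) (8 * failed st).
  apply: le_trans (_ : 8 / (c (phase st))%:R * (failed st)%:R <= _); last exact: potential_ge_failed.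
  rewrite mulrAC ler_pdivlMr ?ltr0n // mul1r -natrM ler_nat //.
have exh : (3 * c (phase st) <= 4 * exhausted st)%N.
  have [pK|pK] := ltnP (phase st) K.
    have s1 := succ_le ct pK; have s2 := qP pK.
    have : (8 * succeeded st < c (phase st))%N.
      have : (8 * succeeded st * q (phase st) < c (phase st) * q (phase st))%N.
        rewrite -mulnA; apply: leq_ltn_trans s2; rewrite leq_mul2l /=.
        exact: leq_trans (leq_addr _ _) s1.
      by rewrite ltn_mul2r => /andP[].
    by move=> s8; apply: exhausted_most s8 fc; rewrite -rE (row_sum ct).
  have pE : phase st = K by apply/eqP; rewrite eqn_leq phK.
  have s0 : succeeded st = 0.
    apply/eqP; rewrite -leqn0 leqNgt; apply/negP => s0; have [z kz] := tl pE s0.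
    have := lost _ (yes_nbr_independent z wh).
    by rewrite ltnNge (leq_trans k_last kz).
  apply: (@exhausted_most _ (succeeded st) (failed st)) => //.
  - by rewrite -rE (row_sum ct).
  - by rewrite s0 muln0.
apply: le_trans (_ : @draw_drift _ R Q st ^+ 2 / D2 <= _); last exact: potential_ge_draw.
rewrite D2E; apply: sqr_ratio_ge1; first by rewrite -D2E.
rewrite /draw_drift lerBrDr -natrM -natrM -natrD ler_nat.
have t1 := exh_le ct; have t2 := cand_le ct; have t3 := dev2P phK.
have t4 : (tokens st <= ob (phase st))%N by apply: leq_trans t2; apply: leq_addl.
have t5 : (a * exhausted st <= trials st)%N by apply: leq_trans t1; apply: leq_addr.
exact: draw_excess exh t5 t4 t3.
Qed.

Lemma rps_seeded_wins :
  1 - (2 * Q%:R * 'C(n, 2)%:R * (D1^-1 + D2^-1) * K.+1%:R + 8 * eps * K.+1%:R) <=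
  \sum_(x : seeds rps_draw 'C(n, 2)) seed_weight rps_weight x *
    (proposer_wins s (seeded_proposer (ord0, Ordinal (fact_gt0 n)) rps_choice x) d)%:R.
Proof.
apply: le_trans (_ : 1 - pot 'C(n, 2) (state_of [::]) <= _).
  rewrite lerD2l lerN2.
  exact: (potential_start card_target a_gt0 c_gt0 ob0 obS Q D1_gt0 D2_gt0 eps_ge0 poor_freq).
apply: (seeded_proposer_wins (ord0, Ordinal (fact_gt0 n)) rps_weight_ge0 rps_weight_sum1
  invariant_nil (Phi := fun t h => pot t (state_of h))) => //.
- by move=> h _; apply: potential_ge0.
- by move=> t h _ _; apply: potential_mono.
- by move=> h u inv oh; apply: invariant_next.
- by move=> t h inv oh; apply: potential_next.
- by move=> h inv _; apply: potential_lost.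
Qed.

End ProposerStrategy.

(** * Placing targets and centers among the vertices *)

Section Layout.

Local Open Scope nat_scope.

Lemma card_interval n lo m : lo + m <= n ->
  #|[set v : 'I_n | lo <= v < lo + m]| = m.
Proof.
move=> mn; have H (j : 'I_m) : lo + j < n by have := ltn_ord j; lia.
rewrite -[RHS]card_ord -(@card_imset _ _ (fun j => Ordinal (H j))).
  apply: eq_card => v; rewrite in_set; apply/idP/imsetP.
    move=> /andP[lov vm]; have vj : v - lo < m by lia.
    by exists (Ordinal vj) => //; apply: val_inj => /=; lia.
  by move=> [j _ ->] /=; have := ltn_ord j; lia.
by move=> j j' /(congr1 val) /= /addnI /val_inj.
Qed.

Variables (n K a : nat) (c : nat -> nat).

Let base := K.+2 * a.

(* The targets come first; the centers of phase [i] occupy the positions [c i]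
   to [2 * c i - 1] after them, which are disjoint as [c] halves with each phase. *)
Definition block_role (v : 'I_n) : nat + nat * nat :=
  if v < base then inl (v %/ a)
  else if [pick i : 'I_K.+1 | c i <= v - base < 2 * c i] is Some i
  then inr (nat_of_ord i, v - base - c i) else inl K.+2.

Hypothesis n_gt0 : 0 < n.

Definition block_center (i j : nat) : 'I_n :=
  insubd (Ordinal n_gt0) (base + c i + j).

Hypothesis a_gt0 : 0 < a.
Hypothesis fit : base + 2 * c 0 <= n.
Hypothesis c_half : forall i, i < K -> c i = 2 * c i.+1.

Lemma card_block_target i : i <= K.+1 -> #|target block_role i| = a.
Proof.
move=> iK; have fi : i * a + a <= n.
  by apply: leq_trans fit; rewrite /base addnC -mulSn; nia.
rewrite -[RHS](card_interval fi); apply: eq_card => v.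
rewrite in_target in_set /block_role.
have ia : i * a + a <= base by rewrite addnC -mulSn leq_mul2r ltnS iK orbT.
case: ltnP => vb.
  apply/eqP/idP => [[<-]|/andP[lo hi]].
    by rewrite leq_trunc_div /= {1}(divn_eq v a) ltn_add2l ltn_mod.
  congr inl; apply/eqP; rewrite eqn_leq leq_divRL // lo andbT.
  by rewrite -ltnS ltn_divLR // mulSn addnC.
have -> : (i * a <= v < i * a + a) = false by lia.
by case: pickP => [j _|_]; apply/eqP => -[] // e; move: iK; rewrite -e ltnn.
Qed.

Lemma c_anti i j : i <= j -> j <= K -> c j <= c i.
Proof.
move=> ij; elim: j ij => [|j IH]; first by rewrite leqn0 => /eqP->.
rewrite leq_eqVlt => /orP[/eqP->//|ij] jK.
by apply: leq_trans (IH ij (ltnW jK)); rewrite (c_half jK); lia.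
Qed.

Lemma c_gap i j : i < j -> j <= K -> 2 * c j <= c i.
Proof.
move=> ij jK; have iK : i < K by apply: leq_trans jK.
by rewrite (c_half iK) leq_mul2l c_anti.
Qed.

Lemma role_block_center i j : i <= K -> j < c i ->
  block_role (block_center i j) = inr (i, j).
Proof.
move=> iK jc; have vb : base + c i + j < n.
  by apply: leq_trans fit; have := c_anti (leq0n i) iK; lia.
rewrite /block_role /block_center /insubd insubT /=.
have -> : (base + c i + j < base) = false by lia.
have -> : base + c i + j - base = c i + j by lia.
case: pickP => [i' /andP[lo hi]|/(_ (Ordinal (iK : i < K.+1)))] /=; last first.
  by rewrite leq_addr mul2n -addnn ltn_add2l jc.
have i'K : i' <= K by have := ltn_ord i'.
have -> : i' = i :> nat.
  case: (ltngtP i' i) => // ii.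
    by have := c_gap ii iK; lia.
  by have := c_gap ii i'K; lia.
by congr (inr (_, _)); lia.
Qed.

End Layout.

(** * Choice of the parameters *)

Section Instance.

Local Open Scope nat_scope.

Variables (Q u n K : nat) (e p : nat -> nat).
Hypothesis Q_gt0 : 0 < Q.
Hypothesis e_gt0 : forall i, 0 < e i.
Hypothesis p_gt0 : forall i, 0 < p i.
Hypothesis e0 : e 0 = Q ^ 2.
Hypothesis ep : forall i, i <= K -> e i * p i = Q ^ 2.
Hypothesis eS : forall i, i < K -> e i = 2 * e i.+1.
Hypothesis KQ : K.+2 <= 2 * Q.
Hypothesis u_gt0 : 0 < u.
Hypothesis n_ge : 4096 * Q ^ 2 * u ^ 2 <= n.

(* [a] is the size of a target, and [E] a bound on the number of its edges that
   gives average degree [400 * u]; [dev1] and [dev2] are the deviations of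
   [yes_drift] and [draw_drift] that a loss would require. *)
Let a := 512 * Q * u ^ 2.
(** As [e i * p i] is Q^2, the products of [c] with [k] and with [q] do not depend on the phase, and
    [ob] is proportional to [c], starting from a^2 / 2. *)
Let c i := 1024 * e i * u ^ 2.
Let k i := 100 * u * p i.
Let q i := 1100 * u ^ 2 * p i.
Let ob i := 512 * 256 * e i * u ^ 4.
Let E := 400 * 256 * Q * u ^ 3.
Let dev1 := 400 * 256 * Q ^ 2 * u ^ 3.
Let dev2 := 512 * 256 * Q * u ^ 4.

Lemma inst_a_gt0 : 0 < a.
Proof. by rewrite /a !muln_gt0 u_gt0 Q_gt0. Qed.

Lemma inst_fit : K.+2 * a + 2 * c 0 <= n.
Proof.
apply: leq_trans n_ge; rewrite /c e0 /a.
have : K.+2 * (512 * Q * u ^ 2) <= 2 * Q * (512 * Q * u ^ 2).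
  by rewrite leq_mul2r KQ orbT.
have -> : 2 * Q * (512 * Q * u ^ 2) = 2 * 512 * (Q ^ 2 * u ^ 2) by ring.
rewrite -!(mulnA _ (Q ^ 2)); set x := Q ^ 2 * u ^ 2; lia.
Qed.

Lemma inst_c_half i : i < K -> c i = 2 * c i.+1.
Proof. by move=> iK; rewrite /c (eS iK); ring. Qed.

Lemma bin2_double m : 2 * 'C(m, 2) = m * (m - 1).
Proof. by rewrite -mul_bin_diag bin1 subn1. Qed.

Lemma aa_double : a * a = 2 * ob 0.
Proof.
by rewrite /ob /a e0; ring.
Qed.

Lemma inst_ob0 : 'C(a, 2) <= ob 0.
Proof. have := aa_double; have := bin2_double a; nia. Qed.

Lemma inst_obS i : i < K -> ob i.+1 < 'C(a, 2).
Proof.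
move=> iK; have h : ob 0 >= 2 * ob i.+1.
  have : 2 * e i.+1 <= e 0 by rewrite -eS // e0 -(ep (ltnW iK)) leq_pmulr.
  rewrite /ob; set x := u ^ 4; nia.
have := aa_double; have := bin2_double a.
have : 512 <= a by rewrite /a -!mulnA leq_pmulr // !muln_gt0 Q_gt0 u_gt0.
nia.
Qed.

Lemma inst_dev1 i : i <= K -> k i * c i + dev1 <= 2 * Q * E.+1.
Proof.
move=> iK; rewrite /k /c.
have -> : 100 * u * p i * (1024 * e i * u ^ 2) = 100 * 1024 * u ^ 3 * (e i * p i) by ring.
rewrite ep // /dev1; apply: (@leq_trans (2 * Q * E)); last by rewrite leq_mul2l leqnSn orbT.
rewrite /E; have -> : 2 * Q * (400 * 256 * Q * u ^ 3) = 2 * 400 * 256 * Q ^ 2 * u ^ 3 by ring.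
set x := Q ^ 2; set y := u ^ 3; lia.
Qed.

Lemma inst_dev2 i : i <= K -> 4 * (2 * Q * ob i + dev2) <= 3 * a * c i.
Proof.
move=> iK; rewrite /ob /dev2 /a /c.
have -> : 3 * (512 * Q * u ^ 2) * (1024 * e i * u ^ 2) =
  3 * 512 * 1024 * (Q * e i * u ^ 4) by ring.
have -> : 2 * Q * (512 * 256 * e i * u ^ 4) = 2 * 512 * 256 * (Q * e i * u ^ 4) by ring.
have : Q * u ^ 4 <= Q * e i * u ^ 4 by rewrite leq_mul2r leq_pmulr ?orbT.
set x := Q * e i * u ^ 4; set y := u ^ 4; nia.
Qed.

Lemma inst_q i : i < K -> 8 * 'C(a, 2) < c i * q i.
Proof.
move=> iK; rewrite /c /q.
have -> : 1024 * e i * u ^ 2 * (1100 * u ^ 2 * p i) = 1024 * 1100 * u ^ 4 * (e i * p i) by ring.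
rewrite ep; last exact: ltnW.
have := inst_ob0; have := aa_double.
rewrite /ob e0.
have : 0 < u ^ 4 * Q ^ 2 by rewrite !muln_gt0 u_gt0 Q_gt0.
set x := u ^ 4; set y := Q ^ 2; nia.
Qed.

Hypothesis Qu : Q ^ 2 <= u.

Lemma inst_k_le i : i <= K -> k i <= a.
Proof.
move=> iK; have pQ : p i <= Q ^ 2 by rewrite -(ep iK) leq_pmull.
have QQ : Q <= Q ^ 2 by rewrite -mulnn leq_pmull.
rewrite /k /a; apply: leq_trans (_ : 100 * u * Q ^ 2 <= _); first by rewrite leq_mul2l pQ orbT.
have -> : 100 * u * Q ^ 2 = 100 * (Q * u) * Q by ring.
have -> : 512 * Q * u ^ 2 = 512 * (Q * u) * u by ring.
by apply: leq_mul; [rewrite leq_mul2r orbT|exact: leq_trans Qu].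
Qed.

Lemma inst_poor (R : realFieldType) (T : finType) (B : {set T}) i
    (O : {set {set T}}) : i < K -> #|B| = a -> O \subset pairs_of B -> ob i.+1 < #|O| ->
  (bad_freq R (poor K q i O) set0 B (k i) <= u%:R^-1)%R.
Proof.
move=> iK Ba OB obO; have iK' := ltnW iK.
have kB : k i <= #|B| by rewrite Ba inst_k_le.
have k100 : 100 <= k i by rewrite /k -mulnA leq_pmulr // muln_gt0 u_gt0 p_gt0.
have k2 : 2 <= k i by lia.
have k4 : 4 <= k i by lia.
have O2 e' : e' \in O -> #|e'| = 2.
  by move/(subsetP OB); rewrite in_set => /andP[_ /eqP].
have OsB e' : e' \in O -> e' \subset B.
  by move/(subsetP OB); rewrite in_set => /andP[].
have := @chebyshev_covered R T B (k i) kB k2 O O2 OsB k4 (q i).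
have -> : bad_freq R (poor K q i O) set0 B (k i) =
   (#|[set N in ksubsets B (k i) | (covered O N < q i)%N]|%:R / 'C(#|B|, k i)%:R)%R.
  rewrite /bad_freq; congr (_%:R / _)%R; apply: eq_card => X.
  by rewrite in_bad_completions in_set in_ksubsets set0U /poor iK andbA.
have mE : (mean_covered R B (k i) O = #|O|%:R *
   ((k i)%:R * ((k i)%:R - 1) / (a%:R * (a%:R - 1))))%R.
  by rewrite /mean_covered sup_freq2 // Ba.
have a512 : 512 <= a by rewrite /a -!mulnA leq_pmulr // !muln_gt0 Q_gt0 u_gt0.
(* [O] exceeds [ob i.+1], which is half of [ob i], and [ob i] is a^2 / 2 divided by [p i]. *)
have aO : a * a <= 4 * p i * #|O|.
  apply: leq_trans (_ : 4 * p i * ob i.+1 <= _); last by rewrite leq_mul2l ltnW ?orbT.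
  rewrite aa_double /ob e0 -(ep iK') (eS iK).
  by rewrite leq_eqVlt; apply/orP; left; apply/eqP; ring.
set mu := mean_covered R B (k i) O in mE *.
(* From k - 1 >= 0.99 k the mean is at least 0.99 k^2 / (4 p), where k = 100 u p. This exceeds 2 q =
   2200 u^2 p, and Chebyshev's bound 4 (2 k + 1) / mu is then below 1 / u. *)
have mu_ge : (2475 * u%:R ^+ 2 * (p i)%:R <= mu)%R.
  have UP : (1 <= u%:R * (p i)%:R :> R)%R by rewrite -natrM ler1n muln_gt0 u_gt0 p_gt0.
  have A1 : (512 <= a%:R :> R)%R by rewrite ler_nat.
  have {}aO : (a%:R * a%:R <= 4 * (p i)%:R * #|O|%:R :> R)%R by rewrite -!natrM ler_nat.
  have kE : ((k i)%:R = 100 * (u%:R * (p i)%:R) :> R)%R by rewrite /k -mulnA !natrM.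
  rewrite mE kE mulrA ler_pdivlMr; last by apply: mulr_gt0; lra.
  have O0 : (0 <= #|O|%:R :> R)%R by [].
  move: UP aO O0 A1; rewrite exprnP.
  have -> : (2475 * u%:R ^ 2 * (p i)%:R * (a%:R * (a%:R - 1)) =
     2475 * (u%:R * u%:R * (p i)%:R) * (a%:R * a%:R - a%:R) :> R)%R by rewrite -exprnP; ring.
  have U0 : (0 <= u%:R :> R)%R by [].
  have P0 : (0 < (p i)%:R :> R)%R by rewrite ltr0n.
  move: U0 P0; move: (u%:R)%R ((p i)%:R)%R (#|O|%:R)%R (a%:R)%R => U P o A U0 P0 UP aO o0 A1.
  apply: le_trans (_ : 2475 * (U * U * P) * (4 * P * o) <= _)%R.
    by apply: ler_wpM2l; [nra|lra].
  have -> : (2475 * (U * U * P) * (4 * P * o) = o * (9900 * ((U * P) * (U * P))))%R by ring.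
  apply: ler_wpM2l => //; move: (U * P)%R UP => v v1; nra.
have u0 : (0 < u%:R :> R)%R by rewrite ltr0n.
have p1 : (1 <= (p i)%:R :> R)%R by rewrite ler1n.
have U2 : (0 < u%:R ^+ 2 * (p i)%:R :> R)%R by rewrite mulr_gt0 ?exprn_gt0 // ltr0n.
have mu0 : (0 < mu)%R by rewrite -mulrA in mu_ge; lra.
move=> /(_ mu0) cheb; apply: le_trans (cheb _) _.
  have -> : (2 * (q i)%:R = 2200 * (u%:R ^+ 2 * (p i)%:R) :> R)%R.
    by rewrite /q !natrM; ring.
  by rewrite -mulrA in mu_ge; lra.
rewrite ler_pdivrMr // (_ : k i = 100 * (u * p i)); last by rewrite /k mulnA.
rewrite !natrM -ler_pdivrMl ?invr_gt0 // invrK.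
apply: le_trans mu_ge.
have -> : (2475 * u%:R ^+ 2 * (p i)%:R = u%:R * (2475 * (u%:R * (p i)%:R)) :> R)%R by ring.
apply: ler_wpM2l; first exact: ltW.
have : (1 <= u%:R * (p i)%:R :> R)%R by rewrite -natrM ler1n muln_gt0 u_gt0 p_gt0.
by move: (u%:R * (p i)%:R)%R => v; lra.
Qed.

(** The degree cap 800 u is twice the average degree. With 80 u for Alon's constant, the ratio 512 /
    (2 * 880) is 16 / 55. *)
Lemma inst_sparse (h : history n) (X : {set 'I_n}) s t : wf h -> #|X| = a ->
  t * (2 ^ (2 * t) + 1) <= 80 * u -> 55 * s <= 16 * t * Q * u ->
  #|edges_in (graph h) X| <= E ->
  exists2 S, independent (graph h) S & s <= #|S|.
Proof.
move=> wh Xa tu st EX.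
have [|S indS St] := @sparse_independent n h X (800 * u) (80 * u) t wh tu.
  rewrite Xa; apply: leq_trans (_ : 4 * E <= _); first by rewrite leq_mul2l EX orbT.
  rewrite mulnS; apply: leq_trans (leq_addl _ _).
  rewrite /E /a leq_eqVlt; apply/orP; left; apply/eqP; ring.
exists S => //; move: St; rewrite Xa /a.
have -> : t * (512 * Q * u ^ 2) = u * (512 * (t * Q * u)) by ring.
have -> : 2 * (800 * u + 80 * u) * #|S| = u * (1760 * #|S|) by ring.
by rewrite leq_pmul2l //; move: st; rewrite -!(mulnA 16); set x := t * (Q * u); rewrite -mulnA -/x; lia.
Qed.

End Instance.

(** * The concrete strategy and its failure probability *)

Section Strategy.

Variables (R : realFieldType).

Section Choice.

Variables (n l u : nat).
Let Q := (2 ^ l)%N.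
Let K := (2 * l)%N.

Definition ramsey_choice : history n.+1 -> rps_draw n.+1 Q -> {set 'I_n.+1} :=
  let a := (512 * Q * u ^ 2)%N in
  let c i := (1024 * 2 ^ (K - i) * u ^ 2)%N in
  rps_choice (block_role K a c) (block_center K a c (ltn0Sn n)) K c
    (fun i => 100 * u * 2 ^ i)%N (fun i => 1100 * u ^ 2 * 2 ^ i)%N
    (fun i => 512 * 256 * 2 ^ (K - i) * u ^ 4)%N.

Definition ramsey_seed0 : rps_draw n.+1 Q := (ord0, Ordinal (fact_gt0 n.+1)).

Definition ramsey_strategy : randomized R (proposer n.+1) :=
  seeded (@rps_weight_ge0 n.+1 Q R) (rps_weight_sum1 n.+1 Q R)
    (seeded_proposer ramsey_seed0 ramsey_choice (k := 'C(n.+1, 2))).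

End Choice.

Lemma sum18_le (x : R) : 0 <= x -> x + x + 16 * x <= 20 * x.
Proof. by lra. Qed.

Lemma leq_of_scaled (m x : nat) : (55 * m <= 16 * x -> m <= 100 * x)%N.
Proof. by lia. Qed.

(** Each drift contributes at most 1 / Q, since n is of order Q^2 u^2 while [u] is at least Q^2; the
    failed rows contribute 8 (K + 1) / u <= 16 / Q. *)
Lemma failure_le (n Q u K : nat) : (0 < Q)%N -> (0 < u)%N -> (Q ^ 2 <= u)%N ->
  (n <= 2 * (4096 * Q ^ 2 * u ^ 2))%N -> (K.+1 <= 2 * Q)%N ->
  2 * Q%:R * 'C(n, 2)%:R * (((400 * 256 * Q ^ 2 * u ^ 3)%N%:R ^+ 2)^-1 +
     ((512 * 256 * Q * u ^ 4)%N%:R ^+ 2)^-1) * K.+1%:R + 8 * u%:R^-1 * K.+1%:R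
  <= 20 / Q%:R :> R.
Proof.
move=> Q0 u0 Qu nQ KQ; set d1 := (400 * _ * _ * _)%N; set d2 := (512 * _ * _ * _)%N.
have Q1 : (1 <= Q)%N by [].
have Q3 : (Q ^ 3 <= u ^ 2)%N.
  apply: leq_trans (_ : Q ^ 4 <= _)%N; first by rewrite leq_pexp2l.
  by rewrite (expnM Q 2 2) leq_exp2r.
have Q5 : (Q ^ 5 <= u ^ 4)%N.
  apply: leq_trans (_ : Q ^ 8 <= _)%N; first by rewrite leq_pexp2l.
  by rewrite (expnM Q 2 4) leq_exp2r.
have Cn : (2 * 'C(n, 2) <= 4 * 4096 * 4096 * (Q ^ 4 * u ^ 4))%N.
  rewrite bin2_double; apply: leq_trans (_ : n * n <= _)%N.
    by rewrite leq_mul2l leq_subr orbT.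
  apply: leq_trans (leq_mul nQ nQ) _.
  by rewrite leq_eqVlt; apply/orP; left; apply/eqP; ring.
have b1 : (4 * Q ^ 3 * 'C(n, 2) <= d1 ^ 2)%N.
  have -> : (d1 ^ 2 = 400 * 256 * (400 * 256) * (Q ^ 4 * u ^ 4 * u ^ 2))%N by rewrite /d1; ring.
  have := leq_mul (leqnn (Q ^ 4 * u ^ 4)) Q3.
  have := leq_mul (leqnn (2 * Q ^ 3)) Cn.
  have -> : (2 * Q ^ 3 * (2 * 'C(n, 2)) = 4 * Q ^ 3 * 'C(n, 2))%N by ring.
  have -> : (2 * Q ^ 3 * (4 * 4096 * 4096 * (Q ^ 4 * u ^ 4)) =
     8 * 4096 * 4096 * (Q ^ 4 * u ^ 4 * Q ^ 3))%N by ring.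
  set x := (4 * _ * _)%N; set y := (_ * Q ^ 3)%N; set z := (_ * u ^ 2)%N.
  by move: x y z; lia.
have b2 : (4 * Q ^ 3 * 'C(n, 2) <= d2 ^ 2)%N.
  have -> : (d2 ^ 2 = 512 * 256 * (512 * 256) * (Q ^ 2 * u ^ 4 * u ^ 4))%N by rewrite /d2; ring.
  have := leq_mul (leqnn (Q ^ 2 * u ^ 4)) Q5.
  have := leq_mul (leqnn (2 * Q ^ 3)) Cn.
  have -> : (2 * Q ^ 3 * (2 * 'C(n, 2)) = 4 * Q ^ 3 * 'C(n, 2))%N by ring.
  have -> : (2 * Q ^ 3 * (4 * 4096 * 4096 * (Q ^ 4 * u ^ 4)) =
     8 * 4096 * 4096 * (Q ^ 2 * u ^ 4 * Q ^ 5))%N by ring.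
  set x := (4 * _ * _)%N; set y := (_ * Q ^ 5)%N; set z := (_ * u ^ 4)%N.
  by move: x y z; lia.
have d1p : (0 < d1)%N by rewrite /d1 !muln_gt0 Q0 u0.
have d2p : (0 < d2)%N by rewrite /d2 !muln_gt0 Q0 u0.
have Qr : 0 < Q%:R :> R by rewrite ltr0n.
have ur : 0 < u%:R :> R by rewrite ltr0n.
have part (dd : nat) : (0 < dd)%N -> (4 * Q ^ 3 * 'C(n, 2) <= dd ^ 2)%N ->
    2 * Q%:R * 'C(n, 2)%:R * (dd%:R ^+ 2)^-1 * K.+1%:R <= Q%:R^-1 :> R.
  move=> d0 bd; have dr : 0 < dd%:R ^+ 2 :> R by rewrite exprn_gt0 // ltr0n.
  rewrite mulrAC ler_pdivrMr // ler_pdivlMl //.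
  rewrite -natrX -!natrM ler_nat; apply: leq_trans bd.
  have := leq_mul (leqnn (2 * Q * Q * 'C(n, 2))) KQ.
  have -> : (2 * Q * Q * 'C(n, 2) * (2 * Q) = 4 * Q ^ 3 * 'C(n, 2))%N by ring.
  apply: leq_trans; rewrite leq_eqVlt; apply/orP; left; apply/eqP; ring.
have p3 : 8 * u%:R^-1 * K.+1%:R <= 16 * Q%:R^-1 :> R.
  rewrite mulrAC ler_pdivrMr // mulrAC ler_pdivlMr //.
  rewrite -!natrM ler_nat; move: Qu KQ; rewrite -mulnn; nia.
have Qi : 0 < Q%:R^-1 :> R by rewrite invr_gt0.
apply: le_trans (_ : Q%:R^-1 + Q%:R^-1 + 16 * Q%:R^-1 <= _).
  apply: lerD => //; rewrite mulrDr mulrDl; apply: lerD; exact: part.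
exact: sum18_le (ltW Qi).
Qed.

Lemma ramsey_strategy_wins n l u s t (d : decider n.+1) :
  (0 < u)%N -> ((2 ^ l) ^ 2 <= u)%N ->
  (4096 * (2 ^ l) ^ 2 * u ^ 2 <= n.+1)%N ->
  (n.+1 <= 2 * (4096 * (2 ^ l) ^ 2 * u ^ 2))%N ->
  (t * (2 ^ (2 * t) + 1) <= 80 * u)%N -> (55 * s <= 16 * t * 2 ^ l * u)%N ->
  (t <= 2 ^ l)%N ->
  1 - 20 / (2 ^ l)%:R <= \sum_(i : seed (ramsey_strategy n l u))
    weight i * (proposer_wins s (draw i) d)%:R.
Proof.
move=> u0 Qu nge nle tu st tQ; set Q := (2 ^ l)%N in Qu nge nle st tQ *.
pose K := (2 * l)%N.
pose e i := (2 ^ (K - i))%N; pose p i := (2 ^ i)%N.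
have Q0 : (0 < Q)%N by rewrite expn_gt0.
have e_gt0 i : (0 < e i)%N by rewrite expn_gt0.
have p_gt0 i : (0 < p i)%N by rewrite expn_gt0.
have e0 : e 0 = (Q ^ 2)%N by rewrite /e /Q -expnM subn0 mulnC.
have ep i : (i <= K)%N -> (e i * p i = Q ^ 2)%N.
  by move=> iK; rewrite -expnD subnK // /Q -expnM mulnC.
have eS i : (i < K)%N -> (e i = 2 * e i.+1)%N.
  by move=> iK; rewrite -expnS; congr (2 ^ _)%N; lia.
have lQ : (l < Q)%N by apply: ltn_expl.
have KQ : (K.+2 <= 2 * Q)%N by rewrite /K; lia.
have a0 := inst_a_gt0 Q0 u0.
have fit := inst_fit Q0 e0 KQ u0 nge.
have ch := inst_c_half u eS.
have ct := @card_block_target n.+1 K _ (fun i => 1024 * e i * u ^ 2)%N (ltn0Sn n) a0 fit.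
have rc := @role_block_center n.+1 K _ (fun i => 1024 * e i * u ^ 2)%N (ltn0Sn n) a0 fit ch.
have k0 i : (i <= K)%N -> (0 < 100 * u * p i)%N by rewrite !muln_gt0 u0 p_gt0.
have c0 i : (i <= K)%N -> (0 < 1024 * e i * u ^ 2)%N by rewrite !muln_gt0 e_gt0 u0.
have Qi : 0 < (400 * 256 * Q ^ 2 * u ^ 3)%N%:R ^+ 2 :> R.
  by rewrite exprn_gt0 // ltr0n !muln_gt0 Q0 u0.
have Qi2 : 0 < (512 * 256 * Q * u ^ 4)%N%:R ^+ 2 :> R.
  by rewrite exprn_gt0 // ltr0n !muln_gt0 Q0 u0.
have ui : 0 <= u%:R^-1 :> R by rewrite invr_ge0.
apply: le_trans (_ : 1 - (2 * Q%:R * 'C(n.+1, 2)%:R *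
   (((400 * 256 * Q ^ 2 * u ^ 3)%N%:R ^+ 2)^-1 +
     ((512 * 256 * Q * u ^ 4)%N%:R ^+ 2)^-1) * K.+1%:R + 8 * u%:R^-1 * K.+1%:R) <= _).
  by rewrite lerD2l lerN2; apply: failure_le => //; exact: ltnW.
have ob0 := inst_ob0 Q0 e0 KQ u0 nge.
have obS i (iK : (i < K)%N) := inst_obS Q0 p_gt0 e0 ep eS KQ u0 nge iK.
have poorP i (O : {set {set 'I_n.+1}}) (iK : (i < K)%N) :=
  inst_poor Q0 e_gt0 p_gt0 e0 ep eS KQ u0 nge Qu R iK (ct i.+1 (leqW iK)) (O := O).
have sparseP (h : history n.+1) i (wh : wf h) (iK : (i <= K)%N) :=
  inst_sparse Q0 e0 KQ u0 nge Qu wh (ct i (leqW iK)) tu st.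
have kP : (s <= 100 * u * p K)%N.
  have Ks : (16 * t * Q * u <= 16 * Q * Q * u)%N by rewrite !leq_mul2r !leq_mul2l tQ !orbT.
  have -> : p K = (Q * Q)%N by rewrite /p /K mulnC expnM mulnn.
  rewrite -mulnA (mulnC u).
  by apply: leq_of_scaled; apply: leq_trans st _; rewrite -!mulnA in Ks *.
have d1P i (iK : (i <= K)%N) := inst_dev1 Q0 e0 ep KQ u0 nge iK.
have d2P i (iK : (i <= K)%N) := inst_dev2 Q0 e_gt0 e0 KQ u0 nge iK.
have qP i (iK : (i < K)%N) := inst_q Q0 e0 ep KQ u0 nge iK.
have H := (rps_seeded_wins ct rc a0 k0 c0 ob0 obS d Qi Qi2 ui Q0 poorP sparseP kP
  d1P d2P qP (erefl _) (erefl _)).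
exact: H.
Qed.

End Strategy.

(** * The parameters as functions of n *)

Section ProposerAsymptotics.

Variable R : realType.

(* With [Q = 2 ^ scale n] of order [log2 n], the number of vertices in use,
   [4096 * Q ^ 2 * u ^ 2], is to be at most [n]. *)
Definition scale (n : nat) : nat := (trunc_log 2 (trunc_log 2 n)).+1.

Definition unit_size (n : nat) : nat :=
  Num.truncn (Num.sqrt (n%:R : R) / (64 * 2 ^ scale n)%N%:R).

Lemma ord1_sum1 : \sum_(i : 'I_1) (1 : R) = 1.
Proof. by rewrite big_ord1. Qed.

(** The main strategy needs some vertex as a default center, so the empty vertex set is treated
    apart. *)
Definition proposer_strategy (n : nat) : randomized R (proposer n) :=
  match n with
  | 0 => seeded (fun _ : 'I_1 => ler01 : 0 <= (1 : R)) ord1_sum1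
      (seeded_proposer ord0 (fun (_ : history 0) (_ : 'I_1) => set0) (k := 0))
  | n'.+1 => ramsey_strategy R n' (scale n'.+1) (unit_size n'.+1)
  end.

Lemma quadratic_le_exp_from (c b j : nat) : (3 <= b)%N ->
  (c * b ^ 2 <= 2 ^ b)%N -> (b <= j)%N -> (c * j ^ 2 <= 2 ^ j)%N.
Proof.
move=> b3 cb; elim: j => [|j IHj]; first by rewrite leqn0 => /eqP b0; move: b3; rewrite b0.
rewrite leq_eqVlt => /orP[/eqP <- //|]; rewrite ltnS => bj.
have j3 : (3 <= j)%N := leq_trans b3 bj.
have sqS : (j.+1 ^ 2 <= 2 * j ^ 2)%N by rewrite -!mulnn; nia.
rewrite [leqRHS]expnS; apply: leq_trans (leq_mul (leqnn 2) (IHj bj)).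
by rewrite mulnCA leq_mul2l sqS orbT.
Qed.

Lemma quadratic_le_exp (j : nat) : (24 <= j)%N -> (128 * 100 * j ^ 2 <= 2 ^ j)%N.
Proof.
apply: quadratic_le_exp_from; first exact: isT.
have : (128 * 100 * 24 ^ 2 <= 2 ^ 7 * 2 ^ 7 * 2 ^ 10)%N.
  by apply: leq_mul; [apply: leq_mul | ].
by rewrite -!expnD.
Qed.

Section Params.

Variable n : nat.
Let m := trunc_log 2 n.
Let j := (m %/ 50)%N.
Let Q := (2 ^ scale n)%N.
Let u := unit_size n.
Let t := (12 * j)%N.
Hypothesis j24 : (24 <= j)%N.

Lemma params_m : (50 * j <= m < 50 * j + 50)%N.
Proof.
have := divn_eq m 50; have : (m %% 50 < 50)%N by rewrite ltn_mod.
by rewrite -/j; lia.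
Qed.

Lemma params_n_gt0 : (0 < n)%N.
Proof.
rewrite lt0n; apply/eqP => n0; have := params_m.
by rewrite /m n0 trunc_log0; lia.
Qed.

Lemma params_n : (2 ^ m <= n < 2 ^ m.+1)%N.
Proof. by apply: trunc_log_bounds => //; exact: params_n_gt0. Qed.

Lemma params_Q : (m < Q <= 2 * m)%N.
Proof.
have m0 : (0 < m)%N by have := params_m; have j0 := j24; lia.
have /andP[lo hi] := @trunc_log_bounds 2 m isT m0.
by rewrite /Q /scale -/m hi expnS leq_mul2l.
Qed.

Lemma params_sqrt : (64 * Q * u)%N%:R <= Num.sqrt (n%:R : R) < (64 * Q * u.+1)%N%:R.
Proof.
have Q0 : 0 < (64 * Q)%N%:R :> R by rewrite ltr0n muln_gt0 expn_gt0.
have /truncn_itv/andP[lo hi] : 0 <= Num.sqrt (n%:R : R) / (64 * 2 ^ scale n)%N%:R.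
  by rewrite divr_ge0 ?sqrtr_ge0.
rewrite -/(unit_size n) -/u -/Q in lo hi.
by move: lo hi; rewrite ler_pdivlMr // ltr_pdivrMr // -!natrM ![(_ * (64 * Q))%N]mulnC => -> ->.
Qed.

Lemma params_sq : ((64 * Q * u) ^ 2 <= n < (64 * Q * u.+1) ^ 2)%N.
Proof.
have /andP[lo hi] := params_sqrt; have s0 := sqrtr_ge0 (n%:R : R).
have nE : Num.sqrt (n%:R : R) ^+ 2 = n%:R by rewrite sqr_sqrtr.
rewrite -(ler_nat R) -(ltr_nat R) !natrX -nE; apply/andP; split.
  by rewrite lerXn2r ?nnegrE.
by rewrite ltrXn2r ?nnegrE // (le_lt_trans s0).
Qed.

(** As n is at least 2^(50 j), its root is at least 2^(25 j), one factor 2^j more than 2^(2t) =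
    2^(24 j). That factor pays for 64 Q <= 12800 j and for the extra [j]. *)
Lemma params_u : (j * 2 ^ (2 * t) <= u)%N.
Proof.
have /andP[_ nu] := params_sq; have /andP[n2 _] := params_n.
have /andP[mj mj2] := params_m; have /andP[mQ Qm] := params_Q.
have big : (2 ^ (25 * j) < 64 * Q * u.+1)%N.
  rewrite -(ltn_exp2r _ _ (isT : (0 < 2)%N)); apply: leq_ltn_trans nu.
  apply: leq_trans n2; rewrite -expnM leq_exp2l //; lia.
have QX : (64 * Q <= 128 * 100 * j)%N by lia.
have X := quadratic_le_exp j24.
have E : (2 ^ (25 * j) = 2 ^ j * 2 ^ (2 * t))%N by rewrite -expnD /t; congr (2 ^ _)%N; lia.
rewrite -ltnS; have j0 : (0 < 128 * 100 * j)%N by lia.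
rewrite -(ltn_pmul2l j0); apply: leq_ltn_trans (_ : 2 ^ (25 * j) < _)%N.
  by rewrite E mulnA -(mulnA _ j j) mulnn leq_mul2r X orbT.
by apply: leq_trans big _; rewrite leq_mul2r QX orbT.
Qed.

Lemma params_u24 : (24 <= u)%N.
Proof.
apply: leq_trans params_u; apply: leq_trans j24 _.
by rewrite leq_pmulr // expn_gt0.
Qed.

Lemma params_Qu : (Q ^ 2 <= u)%N.
Proof.
apply: leq_trans params_u; have /andP[mj mj2] := params_m.
have /andP[mQ Qm] := params_Q.
have X := quadratic_le_exp j24.
have h1 : (Q <= 200 * j)%N by lia.
have h2 : (Q ^ 2 <= (200 * j) ^ 2)%N by rewrite leq_exp2r.
apply: leq_trans h2 _.
apply: leq_trans (_ : 2 ^ j * 2 ^ j <= _)%N; last first.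
  rewrite -expnD; apply: leq_trans (_ : 2 ^ (2 * t) <= _)%N; last by rewrite leq_pmull; lia.
  by rewrite leq_exp2l // /t; lia.
apply: leq_trans (leq_mul X X).
by rewrite expnMn; apply: leq_mul; rewrite -?mulnn; nia.
Qed.

Lemma params_t : (t * (2 ^ (2 * t) + 1) <= 80 * u)%N.
Proof.
have := params_u; have := expn_gt0 2 (2 * t); rewrite /= /t.
move: (2 ^ _)%N u => x v x0 xv; nia.
Qed.

Lemma params_tQ : (t <= Q)%N.
Proof. by have /andP[mQ _] := params_Q; have /andP[mj _] := params_m; rewrite /t; lia. Qed.

Lemma params_n_ge : (4096 * Q ^ 2 * u ^ 2 <= n)%N.
Proof.
have /andP[lo _] := params_sq; apply: leq_trans lo.
by rewrite !expnMn.
Qed.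

Lemma params_n_le : (n <= 2 * (4096 * Q ^ 2 * u ^ 2))%N.
Proof.
have /andP[_ hi] := params_sq; apply: leq_trans (ltnW hi) _.
have -> : ((64 * Q * u.+1) ^ 2 = 4096 * Q ^ 2 * u.+1 ^ 2)%N by rewrite !expnMn.
rewrite mulnCA leq_mul2l; apply/orP; right.
have := params_u24; rewrite -!mulnn; nia.
Qed.

Lemma params_s (s : nat) :
  s%:R <= 1000^-1 * Num.sqrt n%:R * log2 (n%:R : R) ->
  (55 * s <= 16 * t * Q * u)%N.
Proof.
move=> hs; have /andP[_ sq] := params_sqrt; have /andP[_ n2] := params_n.
have /andP[_ mj] := params_m; have u24 := params_u24.
have lg : log2 (n%:R : R) <= (50 * j.+1)%N%:R.
  rewrite /log2 ler_pdivrMr ?ln2_gt0 // mulr_natl -lnXn //.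
  rewrite ler_ln ?posrE ?exprn_gt0 ?ltr0n ?params_n_gt0 //.
  rewrite -natrX ler_nat; apply: leq_trans (ltnW n2) _.
  by rewrite leq_exp2l //; lia.
(* The constants are 55 * 64 * 50 / 1000 = 176 and 16 * 12 = 192, in ratio 11 / 12. The slack
   absorbs the roundings since [u] and [j] are at least 24 and (25/24)^2 < 12/11. *)
have key : (55 * 64 * 50 * (Q * u.+1 * j.+1) <= 1000 * (16 * t * Q * u))%N.
  have : (11 * (u.+1 * j.+1) <= 12 * (j * u))%N.
    by move: u24 j24; move: u j => v i v24 i24; nia.
  rewrite /t; move: u j => v i h; nia.
rewrite -(ler_nat R); apply: le_trans (_ : (55 * 64 * 50 * (Q * u.+1 * j.+1))%N%:R / 1000 <= _).
  have lg0 : 0 <= log2 (n%:R : R).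
    by rewrite /log2 divr_ge0 // ?(ltW (ln2_gt0 _)) // ln_ge0 // ler1n params_n_gt0.
  have := ler_pM (sqrtr_ge0 _) lg0 (ltW sq) lg.
  rewrite !natrM; move: hs; set S := Num.sqrt _; set L := log2 _.
  by move: (Q%:R) (u.+1%:R) (j.+1%:R) => a b c; lra.
by rewrite ler_pdivrMr // -natrM ler_nat [leqRHS]mulnC.
Qed.

End Params.

Lemma proposer_strategy_wins (eps : R) : 0 < eps ->
  exists N, forall n, (N <= n)%N -> forall s : nat,
    s%:R <= 1000^-1 * Num.sqrt n%:R * log2 (n%:R : R) ->
    forall D : randomized R (decider n),
      1 - eps <= prob (proposer_strategy n) D (@proposer_wins n s).
Proof.
move=> eps0; pose J := maxn 24 (Num.truncn (20 / eps)).+1.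
exists (2 ^ (50 * J))%N => n nN s hs D.
have mJ : (50 * J <= trunc_log 2 n)%N by apply: trunc_log_max.
have jJ' : (J <= trunc_log 2 n %/ 50)%N by rewrite leq_divRL // mulnC.
have jJ : (24 <= trunc_log 2 n %/ 50)%N.
  exact: leq_trans (leq_maxl _ _) jJ'.
have eQ : 20 / (2 ^ scale n)%N%:R <= eps.
  have /andP[mQ _] := params_Q jJ.
  rewrite ler_pdivrMr ?ltr0n ?expn_gt0 // mulrC -ler_pdivrMr //.
  apply/ltW/(lt_le_trans (truncnS_gt _)); rewrite ler_nat.
  apply: leq_trans (leq_maxr 24 _) _; rewrite -/J.
  apply: leq_trans (ltnW mQ); apply: leq_trans mJ; exact: leq_pmull.
have n0 := params_n_gt0 jJ; have u0 : (0 < unit_size n)%N by have := params_u24 jJ; lia.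
have := params_Qu jJ; have := params_n_ge n; have := params_n_le jJ.
have := params_t jJ; have := params_s jJ hs; have := params_tQ jJ.
case: n n0 u0 eQ hs D {nN mJ jJ' jJ} => // n _ u0 eQ _ D tQ st tu nle nge Qu.
apply: prob_ge_left => d.
apply: le_trans (ramsey_strategy_wins R d u0 Qu nge nle tu st tQ).
by rewrite lerD2l lerN2.
Qed.

End ProposerAsymptotics.

From mathcomp Require Import all_classical all_reals all_analysis.

Local Open Scope classical_set_scope.

Theorem theorem1p1 (R : realType) :
  (exists P : forall n s : nat, randomized R (proposer n),
     forall eps : R, 0 < eps ->
     \forall n \near \oo, forall s : nat,
       s%:R <= 1000^-1 * Num.sqrt n%:R * log2 (n%:R : R) ->
       forall D : randomized R (decider n),
         1 - eps <= prob (P n s) D (@proposer_wins n s))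
  /\
  (exists D : forall n s : nat, randomized R (decider n),
     forall eps : R, 0 < eps ->
     \forall n \near \oo, forall s : nat,
       1000 * Num.sqrt n%:R * log2 (n%:R : R) <= s%:R ->
       forall P : randomized R (proposer n),
         1 - eps <= prob P (D n s) (@decider_wins n s)).
Proof.
split.
  (* One strategy for each n serves all admissible [s]; the same holds for Decider below. *)
  exists (fun n _ => proposer_strategy R n) => eps eps0.
  have [N HN] := proposer_strategy_wins eps0.
  by exists N => // n /= Nn s hs D; exact: HN.
exists (fun n _ => decider_strategy R n) => eps eps0.
have [N HN] := decider_strategy_wins eps0.
by exists N => // n /= Nn s hs P; exact: HN.
Qed.
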